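(* The Algorithm described step by step in the context, which takes as input $k$ structured subsystems with state matrices $\bar A_s$ of dimension $n_s$ (i.e. $\bar A_s\in\{0,\star\}^{n_s\times n_s}$, the same for all $k$ subsystems) and the input matrix $\bar B\in\{0,\star\}^{n_T\times 1}$, and gives as output the interconnection edges $\mathcal I_A$, has running time complexity $O(n_T^3)$, where $n_T=k\times n_s$.
   Context: Structured systems. A structured pair $(\bar A,\bar B)$ has entries in $\{0,\star\}$. Real matrices $(A,B)$ of the same sizes are a numerical realization if $A_{ij}=0$ whenever $\bar A_{ij}=0$ and $B_{ij}=0$ whenever $\bar B_{ij}=0$. $(\bar A,\bar B)$ is structurally controllable if some numerical realization is controllable. Setting. There are $k$ subsystems with the same structured state matrix $\bar A_s$, and a single input column $\bar B\in\{0,\star\}^{n_T\times 1}$, $n_T=k n_s$. Any state of a subsystem may be connected to any state of any other subsystem, and the composite system (diagonal blocks $\bar A_s$) with all entries of all off-diagonal blocks equal to $\star$ is assumed structurally controllable with $\bar B$. The Algorithm is designed for the problem of choosing off-diagonal blocks with the fewest $\star$ entries (interconnections) such that the composite system is structurally controllable with $\bar B$. Digraphs. Subsystem $i$ has states $V_{X_i}=\{x^i_1,\dots,x^i_{n_s}\}$ and state digraph $\mathcal D_i(\bar A_s)=(V_{X_i},E_{X_i})$, with $(x^i_a,x^i_b)\in E_{X_i}$ iff $(\bar A_s)_{ba}=\star$. Interconnections: $E_{\mathcal I}=\{(x^i_p,x^j_r): i\ne j,\ 1\le p,r\le n_s\}$. $V_U=\{u_1\}$, and $(u_1,x^j_p)\in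 E_U$ iff the entry of $\bar B$ in row $n_s(j-1)+p$ is $\star$. In a digraph containing $u_1$, a state is accessible if there is a directed path to it from $u_1$; a strongly connected component (SCC) is accessible if its states are. An SCC of a digraph is non-top linked if no edge enters it from a node of another SCC. $\mathcal N=\{\mathcal N_1,\dots,\mathcal N_q\}$ is the set of non-top linked SCCs of the digraphs $\mathcal D_i(\bar A_s)$, $i=1,\dots,k$, that are not accessible in the digraph with vertex set $\cup_i V_{X_i}\cup V_U$ and edge set $\cup_i E_{X_i}\cup E_U$ (no interconnections). Bipartite graphs. Let $V_{X'_i}=\{x'^i_1,\dots,x'^i_{n_s}\}$. Every directed edge $(v,x^i_p)$ in $E_{X_i}$, $E_{\mathcal I}$, $E_U$ corresponds to an undirected bipartite edge $(x'^i_p,v)$; the resulting edge sets are $\mathcal E_{X_i}$, $\mathcal E_{\mathcal I}$, $\mathcal E_U$. $\mathcal B(\bar A,\bar B)$ has left nodes $\cup_i V_{X'_i}$, right nodes $\cup_i V_{X_i}\cup V_U$ and edges $\cup_i\mathcal E_{X_i}\cup\mathcal E_{\mathcal I}\cup\mathcal E_U$. $\mathcal B(\bar A,\bar B,\mathcal N)$ is obtained from it by adding right nodes $\mathcal N_1,\dots,\mathcal N_q$ and the edge set $\mathcal E_{\mathcal N}$, where $(x'^i_p,\mathcal N_h)\in\mathcal E_{\mathcal N}$ iff $x^i_p\in\mathcal N_h$. A matching is perfect if its size equals the smaller of the numbers of left and right nodes. Cost function $c$: $c(e)=0$ for $e\in\mathcal E_U$, $1$ for $e\in\cup_i\mathcal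 E_{X_i}$, $2$ for $e\in\mathcal E_{\mathcal N}$, $3$ for $e\in\mathcal E_{\mathcal I}$. For a matching $M'$, $\mathcal B(\bar A,\bar B)\odot M'$ is the graph obtained from $\mathcal B(\bar A,\bar B)$ by deleting all nodes matched in $M'$ together with their edges. Algorithm. Input: the $k$ structured subsystems with state matrices $\bar A_s$ and the single input matrix $\bar B$. Output: interconnections $\mathcal I_A$. (1)-(3) Construct $\mathcal B(\bar A,\bar B)$, $\mathcal B(\bar A,\bar B,\mathcal N)$ and the cost $c$. (4) Find a minimum cost perfect matching $M^\star$ in $\mathcal B(\bar A,\bar B,\mathcal N)$ under $c$. (5) $M'\leftarrow M^\star\cap\{\cup_i\mathcal E_{X_i}\cup\mathcal E_U\}$. (6) Find a perfect matching $M''$ in $\mathcal B(\bar A,\bar B)\odot M'$. (7) $\widetilde M\leftarrow M'\cup M''$. Throughout the following steps, accessibility with respect to $\widetilde M$ means accessibility in the digraph with vertex set $\cup_i V_{X_i}\cup V_U$ and edge set $\cup_i E_{X_i}\cup E_U$ together with the interconnections corresponding to $\widetilde M\cap\mathcal E_{\mathcal I}$. (8) $V_{\mathcal N'}\leftarrow$ the set of left nodes $x'^i_p$ that are matched in $\widetilde M$ by an edge $(x'^i_p,x^j_q)\in\mathcal E_{\mathcal I}$ and such that $x^i_p\in\mathcal N_h$ for some $\mathcal N_h\in\mathcal N$ not accessible with respect to $\widetilde M$. (9) Let $x^t_r$ be the unique unmatched accessible (right) node with respect to $\widetilde M$. (10)-(17) While $V_{\mathcal N'}\neq\emptyset$: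 take $x'^i_p\in V_{\mathcal N'}$, with $(x'^i_p,x^j_q)\in\widetilde M$. If $i\ne t$, set $\widetilde M\leftarrow\{\widetilde M\setminus(x'^i_p,x^j_q)\}\cup\{(x'^i_p,x^t_r)\}$. If $i=t$, find $x^w_v$ with $w\neq j$ such that $(x'^j_s,x^w_v)\in\widetilde M$ for some $s\in\{1,\dots,n_s\}$, and set $\widetilde M\leftarrow\{\widetilde M\setminus(x'^j_s,x^w_v)\}\cup\{(x'^j_s,x^t_r)\}$. After each change of $\widetilde M$, the set $V_{\mathcal N'}$ and the unmatched accessible node $x^t_r$ are updated for the new $\widetilde M$. (18) Let $\mathcal E^q_{\mathcal I}$ consist of one interconnection for each SCC in $\mathcal N$ that is still not accessible with respect to $\widetilde M$: an edge $(x'^i_j,x^t_r)$ with $x^i_j$ in that SCC (of subsystem $i$), $x^t_r$ an accessible state, and $i\ne t$. (19) $\mathcal I_A\leftarrow\{(x^i_p,x^j_q):(x'^j_q,x^i_p)\in\widetilde M,\ i\ne j\}\cup\mathcal E^q_{\mathcal I}$, where the edges of $\mathcal E^q_{\mathcal I}$ are read as the corresponding interconnections. *)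

(* Defs.v *)
From HB Require Import structures.
From mathcomp Require Import all_boot all_order all_algebra.
From mathcomp Require Import reals.
From mathcomp.real_closed Require Import mxtens.

Set Implicit Arguments.
Unset Strict Implicit.
Unset Printing Implicit Defensive.

Import GRing.Theory.

(** * Structured systems

    A structured matrix is a boolean matrix: [true] is a star, [false] a zero. *)

Section StructuredSystems.
Variable R : realType.
Local Open Scope ring_scope.

Definition numerical_realization m n (Abar : 'M[bool]_(m, n))
    (A : 'M[R]_(m, n)) : Prop :=
  forall i j, ~~ Abar i j -> A i j = 0.

(* The Kalman rank condition on [B, A B, ..., A^(n-1) B]. *)
Definition controllable n m (A : 'M[R]_n) (B : 'M[R]_(n, m)) : Prop :=
  \rank (\mxrow_(j < n) (A ^+ j *m B)) = n.

Definition structurally_controllable n m (Abar : 'M[bool]_n)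
    (Bbar : 'M[bool]_(n, m)) : Prop :=
  exists (A : 'M[R]_n) (B : 'M[R]_(n, m)),
    [/\ numerical_realization Abar A, numerical_realization Bbar B
      & controllable A B].

End StructuredSystems.

(** * Bipartite graphs and matchings *)

Section Bipartite.
Variables L V : finType.

Record bigraph := Bigraph {
  lnodes : {set L};
  rnodes : {set V};
  bedges : {set L * V} }.

Definition is_matching (G : bigraph) (M : {set L * V}) : Prop :=
  M \subset bedges G /\
  {in M &, forall e f, e.1 = f.1 \/ e.2 = f.2 -> e = f}.

Definition perfect_matching (G : bigraph) (M : {set L * V}) : Prop :=
  is_matching G M /\ #|M| = minn #|lnodes G| #|rnodes G|.

Definition matching_cost (c : L * V -> nat) (M : {set L * V}) : nat :=
  \sum_(e in M) c e.

Definition min_cost_perfect_matching (G : bigraph) (c : L * V -> nat)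
    (M : {set L * V}) : Prop :=
  perfect_matching G M /\
  forall M', perfect_matching G M' -> matching_cost c M <= matching_cost c M'.

Definition delete_matched (G : bigraph) (M : {set L * V}) : bigraph :=
  let l := lnodes G :\: [set e.1 | e in M] in
  let r := rnodes G :\: [set e.2 | e in M] in
  Bigraph l r [set e in bedges G | (e.1 \in l) && (e.2 \in r)].

End Bipartite.

(** * The composite system *)

(* [(i, p)] is the state x^i_p; [mxtens_index (i, p) = i * ns + p] is its row
   in the composite system. *)
Notation state k ns := ('I_k * 'I_ns)%type.

(* Right nodes: states, u_1 and the SCCs in N.  The left nodes have type [state],
   with [(i, p)] standing for x'^i_p. *)
Notation rnode k ns := (option (state k ns) + {set state k ns})%type.

Definition rstate k ns (x : state k ns) : rnode k ns := inl (Some x).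
Definition rinput k ns : rnode k ns := inl None.
Definition rscc k ns (N : {set state k ns}) : rnode k ns := inr N.

Definition full_composite k ns (A : 'M[bool]_ns) : 'M[bool]_(k * ns) :=
  \matrix_(r, c)
    let x := mxtens_unindex r in let y := mxtens_unindex c in
    if x.1 == y.1 then A x.2 y.2 else true.

Section Algorithm.
Variables (k ns : nat) (A : 'M[bool]_ns) (B : 'cV[bool]_(k * ns)).

Local Notation st := (state k ns).
Local Notation edge := (st * rnode k ns)%type.
Implicit Types (x y z : st) (N : {set st}) (J : {set st * st}).
Implicit Types (M : {set edge}) (Q : seq (st * st)).

(** ** Digraphs. A pair [(x, y)] is an edge from [x] to [y]. *)

Definition eX x y : bool := (x.1 == y.1) && A y.2 x.2.

Definition eU y : bool := B (mxtens_index y) ord0.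

(* The digraph with interconnections [J]; [None] is the input u_1. *)
Definition arc J : rel (option st) := fun v w =>
  match v, w with
  | None, Some y => eU y
  | Some x, Some y => eX x y || ((x, y) \in J)
  | _, None => false
  end.

Definition accessible J x : bool := connect (arc J) None (Some x).

Definition scc_accessible J N : bool := [forall x in N, accessible J x].

(* Since the state digraphs of distinct subsystems are disjoint, their SCCs are
   those of their union. *)
Definition scc x : {set st} := [set y | connect eX x y && connect eX y x].

Definition non_top_linked N : bool :=
  [forall y, forall z in N, (y \notin N) ==> ~~ eX y z].

Definition calN : {set {set st}} :=
  [set N | [&& N \in [set scc x | x : st], non_top_linked N
             & ~~ scc_accessible set0 N]].

(** ** Bipartite graphs. An edge is a pair (left node, right node). *)

Definition EX : {set edge} :=
  [set e | if e.2 is inl (Some y) then eX y e.1 else false].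
Definition EI : {set edge} :=
  [set e | if e.2 is inl (Some y) then y.1 != e.1.1 else false].
Definition EU : {set edge} :=
  [set e | if e.2 is inl None then eU e.1 else false].
Definition EN : {set edge} :=
  [set e | if e.2 is inr N then (N \in calN) && (e.1 \in N) else false].

Definition bip : bigraph st (rnode k ns) :=
  Bigraph setT [set v | if v is inl _ then true else false]
    (EX :|: EI :|: EU).

Definition bipN : bigraph st (rnode k ns) :=
  Bigraph setT (rnodes bip :|: [set rscc N | N in calN]) (bedges bip :|: EN).

(* The four edge sets are pairwise disjoint; the value off them is irrelevant. *)
Definition cost (e : edge) : nat :=
  if e \in EU then 0 else if e \in EX then 1 else if e \in EN then 2 else 3.

(** ** Steps of the algorithm *)

Definition interconnections M : {set st * st} :=
  [set a | (a.2, rstate a.1) \in M :&: EI].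

(* The SCCs in N not accessible with respect to [M]. *)
Definition unreached M : {set {set st}} :=
  [set N in calN | ~~ scc_accessible (interconnections M) N].

Definition VN' M : {set st} :=
  [set x | [exists y, (x, rstate y) \in M :&: EI]
         & [exists N in unreached M, x \in N]].

Definition unmatched_accessible M z : Prop :=
  unique (fun z' => rstate z' \notin [set e.2 | e in M]
                    /\ accessible (interconnections M) z') z.

Definition swap M (e f : edge) : {set edge} := f |: (M :\ e).

(* One iteration of the while loop: [x] is x'^i_p, [y] is x^j_q, [z] is x^t_r,
   [y'] is x'^j_s and [w] is x^w_v. *)
Definition loop_step M M1 : Prop :=
  exists x y z,
    [/\ x \in VN' M, (x, rstate y) \in M, unmatched_accessible M z
      & if x.1 != z.1 then M1 = swap M (x, rstate y) (x, rstate z)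
        else exists y' w,
          [/\ y'.1 = y.1, w.1 != y.1, (y', rstate w) \in M
            & M1 = swap M (y', rstate w) (y', rstate z)]].

(* [Ms] lists the successive values of the matching after [M]. *)
Fixpoint while_loop M (Ms : seq {set edge}) : Prop :=
  if Ms is M1 :: Ms' then loop_step M M1 /\ while_loop M1 Ms'
  else VN' M = set0.

(* [Q] lists the edges [(x, y)] of E^q in the order in which they are chosen:
   [x] lies in the SCC to be reached, and [y] is a state of another subsystem,
   accessible when the edge is chosen.  The edges chosen before count for this:
   all states accessible with respect to [M] alone may lie in the subsystem of
   an unreached SCC. *)
Definition connect_unreached M Q : Prop :=
  perm_eq [seq scc e.1 | e <- Q] (enum (unreached M)) /\
  forall Q1 e Q2, Q = Q1 ++ e :: Q2 ->
    e.1.1 != e.2.1 /\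
    accessible (interconnections M :|: [set a | (a.2, a.1) \in Q1]) e.2.

(* [Mstar], [Mpp] are M^* and M''; [Mt] is the value of \tilde M at the start
   of the loop and [Mts] its successive values in the loop. *)
Definition algorithm_run (Mstar Mpp Mt : {set edge}) (Mts : seq {set edge})
    Q (IA : {set st * st}) : Prop :=
  let Mp := Mstar :&: (EX :|: EU) in
  min_cost_perfect_matching bipN cost Mstar /\
  perfect_matching (delete_matched bip Mp) Mpp /\
  Mt = Mp :|: Mpp /\
  (exists z, unmatched_accessible Mt z) /\
  while_loop Mt Mts /\
  connect_unreached (last Mt Mts) Q /\
  IA = interconnections (last Mt Mts) :|: [set a | (a.2, a.1) \in Q].

End Algorithm.

(** * Machine model

    Running time is counted on a unit-cost random access machine, programmed in
    a while language whose memory consists of scalars and two-dimensional arrays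
    of natural numbers, named by numbers.  The arithmetic is addition and
    truncated subtraction only: unit-cost multiplication would make the model
    unreasonably strong. *)

Inductive expr :=
  | Const of nat
  | Var of nat
  | Get of nat & expr & expr
  | Add of expr & expr
  | Sub of expr & expr
  | Le of expr & expr
  | Eq of expr & expr.

Inductive cmd :=
  | Skip
  | Assign of nat & expr
  | Put of nat & expr & expr & expr
  | Seq of cmd & cmd
  | If of expr & cmd & cmd
  | While of expr & cmd.

Record memory := Memory {
  scalar : nat -> nat;
  array : nat -> nat -> nat -> nat }.

Definition set_scalar (s : memory) (a n : nat) : memory :=
  Memory (fun b => if b == a then n else scalar s b) (array s).

Definition set_array (s : memory) (a i j n : nat) : memory :=
  Memory (scalar s)
    (fun b i' j' =>
       if [&& b == a, i' == i & j' == j] then n else array s b i' j').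

Fixpoint eval (s : memory) (e : expr) : nat :=
  match e with
  | Const n => n
  | Var a => scalar s a
  | Get a e1 e2 => array s a (eval s e1) (eval s e2)
  | Add e1 e2 => eval s e1 + eval s e2
  | Sub e1 e2 => eval s e1 - eval s e2
  | Le e1 e2 => eval s e1 <= eval s e2
  | Eq e1 e2 => eval s e1 == eval s e2
  end.

Fixpoint esize (e : expr) : nat :=
  match e with
  | Const _ | Var _ => 1
  | Get _ e1 e2 | Add e1 e2 | Sub e1 e2 | Le e1 e2 | Eq e1 e2 =>
      (esize e1 + esize e2).+1
  end.

(* [exec c s s' t]: started in [s], the program [c] halts in [s'] after [t]
   elementary steps. *)
Inductive exec : cmd -> memory -> memory -> nat -> Prop :=
  | exec_skip s : exec Skip s s 1
  | exec_assign a e s :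
      exec (Assign a e) s (set_scalar s a (eval s e)) (esize e).+1
  | exec_put a e1 e2 e s :
      exec (Put a e1 e2 e) s (set_array s a (eval s e1) (eval s e2) (eval s e))
        (esize e1 + esize e2 + esize e).+1
  | exec_seq c1 c2 s s1 s2 t1 t2 :
      exec c1 s s1 t1 -> exec c2 s1 s2 t2 -> exec (Seq c1 c2) s s2 (t1 + t2)
  | exec_if e c1 c2 s s' t :
      exec (if eval s e != 0 then c1 else c2) s s' t ->
      exec (If e c1 c2) s s' (esize e + t).+1
  | exec_while_stop e c s :
      eval s e = 0 -> exec (While e c) s s (esize e).+1
  | exec_while_loop e c s s1 s2 t1 t2 :
      eval s e != 0 -> exec c s s1 t1 -> exec (While e c) s1 s2 t2 ->
      exec (While e c) s s2 (esize e + t1 + t2).+1.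

(** * Input and output conventions *)

Definition s_k := 0.
Definition s_ns := 1.
Definition s_iter := 2.
Definition s_q := 3.
Definition a_A := 0.
Definition a_B := 1.
Definition a_Mstar := 2.
Definition a_Mt := 3.
Definition a_Q := 4.
Definition a_IA := 5.

(* The rest of the memory is arbitrary. *)
Definition holds_input k ns (A : 'M[bool]_ns) (B : 'cV[bool]_(k * ns))
    (s : memory) : Prop :=
  [/\ scalar s s_k = k, scalar s s_ns = ns,
      forall i j : 'I_ns, array s a_A i j = A i j
    & forall r : 'I_(k * ns), array s a_B r 0 = B r ord0].

(* A state is encoded by its row, u_1 by n_T and an SCC by n_T + 1 plus the row
   of any of its states. *)
Definition encodes k ns (n : nat) (v : rnode k ns) : Prop :=
  match v with
  | inl (Some y) => n = mxtens_index y
  | inl None => n = k * ns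
  | inr N => exists2 y, y \in N & n = (k * ns).+1 + mxtens_index y
  end.

(* For a matching of all left nodes, this determines [M] from row [i] of the
   array [a]. *)
Definition holds_matching k ns (s : memory) (a i : nat)
    (M : {set state k ns * rnode k ns}) : Prop :=
  forall e, e \in M -> encodes (array s a i (mxtens_index e.1)) e.2.

(* The memory contains the interconnections [IA], as an adjacency matrix, and
   the successive objects constructed by the algorithm; M'' is not stored
   separately, being what M' leaves of the initial \tilde M. *)
Definition holds_run k ns (s : memory)
    (Mstar Mt : {set state k ns * rnode k ns})
    (Mts : seq {set state k ns * rnode k ns})
    (Q : seq (state k ns * state k ns))
    (IA : {set state k ns * state k ns}) : Prop :=
  [/\ holds_matching s a_Mstar 0 Mstar,
      scalar s s_iter = size Mts /\
      forall l, l <= size Mts ->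
        holds_matching s a_Mt l (nth set0 (Mt :: Mts) l),
      scalar s s_q = size Q /\
      forall Q1 e Q2, Q = Q1 ++ e :: Q2 ->
        array s a_Q (size Q1) 0 = mxtens_index e.1 /\
        array s a_Q (size Q1) 1 = mxtens_index e.2
    & forall x y,
        array s a_IA (mxtens_index x) (mxtens_index y) = ((x, y) \in IA)].

(* Main.v *)
(**
The cost of an edge depends on its class only, and equals 3 minus the number
of those among the sets E_U, E_U + E_X, E_U + E_X + E_N that contain it.  Hence
a matching of all left nodes has minimum cost as soon as it is maximum, in
cardinality, within each of the three sets.  Treating the right nodes in the
order input, states, SCCs and matching each of them by an augmenting path
whenever there is one achieves this: matched right nodes stay matched, and
Koenig's theorem certifies maximality for every initial segment of the order.
Each of the at most 2 n_T + 1 augmentations is one graph search, of cost n_T^2.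

M'' matches the free left nodes of subsystem i to free states of subsystem
i + 1 mod k.  There are enough of them: otherwise the part of M' inside
subsystem i + 1, copied to the identical subsystem i, would enlarge M'.  For
k = 1 there are no free left nodes, by structural controllability.

The edges of \tilde M form a path from u_1, which ends in the unique unmatched
state, and disjoint cycles.  Redirecting an edge that leaves an inaccessible
state makes that state accessible and keeps the others accessible, so that n_T
rounds with one search each suffice.  The SCCs outside the subsystem of a fixed
state x_0 driven by u_1 are finally connected to x_0; then every state outside
that subsystem is accessible and can serve the remaining SCCs.
*)

Require Import Defs.
From mathcomp Require Import all_boot all_order all_algebra.
From mathcomp Require Import reals.
From mathcomp.real_closed Require Import mxtens.
From mathcomp Require Import fingroup perm zify.
Import Defs.

Set Implicit Arguments.
Unset Strict Implicit.
Unset Printing Implicit Defensive.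

(** The running time can then be read off the syntax, as a constant times a power of the largest
    bound whose exponent is the nesting depth. Depth 3 suffices: a graph search has depth 2 and is
    called from within at most one loop, namely once per vertex for the reachability matrix, once
    per right node for the matching and once per round of steps (10)-(17). Correctness is proved for
    the functional semantics [run], apart from time.

    One assignment [f] of the left nodes outside M' to states of the next subsystem supplies both
    the interconnections of [Mstar] and all of M''. The value of \tilde M is thus always an
    injective function from left nodes to states and u_1, and a loop step changes this function at a
    single point. As it has n_T arguments and n_T + 1 possible values, the unmatched state of step
    (9) is unique by counting. *)

(** * Programs with counted loops *)

(* In [PFor i b p] the number of rounds is the value of scalar [b] on entry;
   [compile] tests [b] in each round instead, hence the side conditions of
   [exec_compile]. *)
Inductive prog :=
  | PSkip
  | PAssign of nat & expr
  | PPut of nat & expr & expr & expr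
  | PSeq of prog & prog
  | PIf of expr & prog & prog
  | PFor of nat & nat & prog.

Definition for_step (f : memory -> memory) (i : nat) (s : memory) : memory :=
  set_scalar (f s) i (scalar (f s) i + 1).

Fixpoint run (p : prog) (s : memory) : memory :=
  match p with
  | PSkip => s
  | PAssign a e => set_scalar s a (eval s e)
  | PPut a e1 e2 e => set_array s a (eval s e1) (eval s e2) (eval s e)
  | PSeq p q => run q (run p s)
  | PIf e p q => if eval s e != 0 then run p s else run q s
  | PFor i b p => iter (scalar s b) (for_step (run p) i) (set_scalar s i 0)
  end.

Fixpoint compile (p : prog) : cmd :=
  match p with
  | PSkip => Skip
  | PAssign a e => Assign a e
  | PPut a e1 e2 e => Put a e1 e2 e
  | PSeq p q => Seq (compile p) (compile q)
  | PIf e p q => If e (compile p) (compile q)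
  | PFor i b p =>
      Seq (Assign i (Const 0))
        (While (Le (Add (Var i) (Const 1)) (Var b))
           (Seq (compile p) (Assign i (Add (Var i) (Const 1)))))
  end.

Fixpoint modS (p : prog) : seq nat :=
  match p with
  | PSkip | PPut _ _ _ _ => [::]
  | PAssign a _ => [:: a]
  | PSeq p q | PIf _ p q => modS p ++ modS q
  | PFor i _ p => i :: modS p
  end.

Fixpoint modA (p : prog) : seq nat :=
  match p with
  | PSkip | PAssign _ _ => [::]
  | PPut a _ _ _ => [:: a]
  | PSeq p q | PIf _ p q => modA p ++ modA q
  | PFor _ _ p => modA p
  end.

Fixpoint bounds (p : prog) : seq nat :=
  match p with
  | PSkip | PAssign _ _ | PPut _ _ _ _ => [::]
  | PSeq p q | PIf _ p q => bounds p ++ bounds q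
  | PFor _ b p => b :: bounds p
  end.

(** The index of a loop then always equals the number of completed rounds. *)
Fixpoint wf (p : prog) : bool :=
  match p with
  | PSkip | PAssign _ _ | PPut _ _ _ _ => true
  | PSeq p q | PIf _ p q => wf p && wf q
  | PFor i _ p => (i \notin modS p) && wf p
  end.

Fixpoint depth (p : prog) : nat :=
  match p with
  | PSkip | PAssign _ _ | PPut _ _ _ _ => 0
  | PSeq p q | PIf _ p q => maxn (depth p) (depth q)
  | PFor _ _ p => (depth p).+1
  end.

(** The 18 of a loop is 8 + 10: initialisation and the failing test take 2 + 6 steps, and each round
    takes 10 steps besides its body. A conditional pays for both branches. *)
Fixpoint weight (p : prog) : nat :=
  match p with
  | PSkip => 1
  | PAssign _ e => (esize e).+1
  | PPut _ e1 e2 e => (esize e1 + esize e2 + esize e).+1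
  | PSeq p q => weight p + weight q
  | PIf e p q => (esize e + (weight p + weight q)).+1
  | PFor _ _ p => 18 + weight p
  end.

(** The frame relation of a program that writes only to the scalars [S] and the arrays [A]. *)
Definition agree (S A : seq nat) (s s' : memory) : Prop :=
  (forall a, a \notin S -> scalar s' a = scalar s a) /\
  (forall a x y, a \notin A -> array s' a x y = array s a x y).

Lemma agree_trans S A s1 s2 s3 :
  agree S A s1 s2 -> agree S A s2 s3 -> agree S A s1 s3.
Proof.
move=> [S12 A12] [S23 A23]; split=> [a aS|a x y aA].
  by rewrite S23 ?S12.
by rewrite A23 ?A12.
Qed.

Lemma agree_sub (S A S' A' : seq nat) s s' :
  {subset S <= S'} -> {subset A <= A'} -> agree S A s s' -> agree S' A' s s'.
Proof.
move=> SS AA [HS HA]; split=> [a aS|a x y aA].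
  by apply: HS; apply: contra aS; apply: SS.
by apply: HA; apply: contra aA; apply: AA.
Qed.

Lemma agree_set_scalar (S A : seq nat) s i v :
  i \in S -> agree S A s (set_scalar s i v).
Proof.
by move=> iS; split=> //= a aS; case: eqP => // ai; rewrite ai iS in aS.
Qed.

Lemma run_agree p s : agree (modS p) (modA p) s (run p s).
Proof.
elim: p s => [|a e|a e1 e2 e|p IHp q IHq|e p IHp q IHq|i b p IHp] s //=.
- by apply: agree_set_scalar; rewrite mem_head.
- split=> //= b x y; rewrite inE => /negbTE ba.
  by rewrite ba.
- apply: agree_trans (agree_sub _ _ (IHp s)) (agree_sub _ _ (IHq _)) => x xS;
    by rewrite mem_cat xS ?orbT.
- case: ifP => _; [apply: agree_sub (IHp s)|apply: agree_sub (IHq s)] => x xS;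
    by rewrite mem_cat xS ?orbT.
- elim: (scalar s b) => [|m IHm] /=.
    by apply: agree_set_scalar; rewrite mem_head.
  apply: agree_trans IHm _; rewrite /for_step.
  apply: agree_trans (agree_set_scalar _ _ _ (mem_head _ _)).
  by apply: agree_sub (IHp _) => x //; rewrite inE orbC => ->.
Qed.

Lemma scalar_run p s a : a \notin modS p -> scalar (run p s) a = scalar s a.
Proof. by case: (run_agree p s) => + _; apply. Qed.

Lemma array_run p s a x y :
  a \notin modA p -> array (run p s) a x y = array s a x y.
Proof. by case: (run_agree p s) => _; apply. Qed.

(** The step hypothesis supplies agreement with the memory [s] at loop entry, so [Inv] need only
    mention what the loop changes. *)
Lemma for_invariant i b p s (Inv : nat -> memory -> Prop) :
  i \notin modS p ->
  Inv 0 (set_scalar s i 0) ->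
  (forall j s', j < scalar s b -> scalar s' i = j ->
     agree (i :: modS p) (modA p) s s' -> Inv j s' ->
     Inv j.+1 (set_scalar (run p s') i j.+1)) ->
  Inv (scalar s b) (run (PFor i b p) s).
Proof.
move=> iS I0 IS /=; set f := for_step (run p) i.
suff: forall m, m <= scalar s b ->
    [/\ scalar (iter m f (set_scalar s i 0)) i = m,
        agree (i :: modS p) (modA p) s (iter m f (set_scalar s i 0))
      & Inv m (iter m f (set_scalar s i 0))].
  by move=> /(_ _ (leqnn _)) [].
elim=> [|m IHm] lem.
  by split=> //=; [rewrite eqxx|apply: agree_set_scalar; rewrite mem_head].
have [Hi Ha HI] := IHm (ltnW lem).
rewrite /= {1 3 5}/f /for_step scalar_run // Hi addn1; split.
- by rewrite /= eqxx.
- apply: agree_trans Ha _.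
  apply: agree_trans (agree_set_scalar _ _ _ (mem_head _ _)).
  by apply: agree_sub (run_agree _ _) => x //; rewrite inE orbC => ->.
- by apply: IS.
Qed.

(** [bs] collects the scalars used as loop bounds. No assignment touches them, so testing a bound in
    every round agrees with [run], and [D] bounds all iteration counts. The base is [D.+1] because a
    loop pays for its initialisation and final test even with zero rounds. *)
Lemma exec_compile (D : nat) (bs : seq nat) p s :
  wf p -> all (fun b => b \in bs) (bounds p) ->
  ~~ has (fun a => a \in bs) (modS p) ->
  (forall b, b \in bs -> scalar s b <= D) ->
  exists2 t, exec (compile p) s (run p s) t & t <= weight p * D.+1 ^ depth p.
Proof.
have step t m e d : t <= m * D.+1 ^ e -> e <= d -> t <= m * D.+1 ^ d.
  by move=> + ed => /leq_trans; apply; rewrite leq_mul2l leq_pexp2l ?orbT.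
elim: p s => [|a e|a e1 e2 e|p IHp q IHq|e p IHp q IHq|i b p IHp] s /=.
- by exists 1; first by constructor.
- by exists (esize e).+1; [constructor|rewrite muln1].
- by exists (esize e1 + esize e2 + esize e).+1; [constructor|rewrite muln1].
- move=> /andP[wp wq]; rewrite all_cat has_cat negb_or.
  move=> /andP[bp bq] /andP[mp mq] Hs.
  have [t1 E1 T1] := IHp s wp bp mp Hs.
  have [|t2 E2 T2] := IHq (run p s) wq bq mq.
    move=> c cb; rewrite scalar_run; first exact: Hs.
    by apply: contra mp => cS; apply/hasP; exists c.
  exists (t1 + t2); first exact: exec_seq E1 E2.
  rewrite mulnDl leq_add //.
    exact: step T1 (leq_maxl _ _).
  exact: step T2 (leq_maxr _ _).
- move=> /andP[wp wq]; rewrite all_cat has_cat negb_or.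
  move=> /andP[bp bq] /andP[mp mq] Hs.
  have [t1 E1 T1] := IHp s wp bp mp Hs.
  have [t2 E2 T2] := IHq s wq bq mq Hs.
  have {}T1 := step _ _ _ _ T1 (leq_maxl _ (depth q)).
  have {}T2 := step _ _ _ _ T2 (leq_maxr (depth p) _).
  set X := D.+1 ^ _ in T1 T2 *; have X0 : 0 < X by rewrite expn_gt0.
  case Ee: (eval s e != 0).
    exists (esize e + t1).+1; first by constructor; rewrite Ee.
    nia.
  exists (esize e + t2).+1; first by constructor; rewrite Ee.
  nia.
- move=> /andP[ip wp] /andP[bb bp]; rewrite negb_or => /andP[ib mp] Hs.
  set f := for_step (run p) i.
  set X := D.+1 ^ depth p in IHp *; have X0 : 0 < X by rewrite expn_gt0.
  (* The induction needs an arbitrary starting index: [m] is the number of rounds left. *)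
  have loop m s0 : (forall c, c \in bs -> scalar s0 c <= D) ->
      scalar s0 i + m = scalar s0 b ->
      exists2 t, exec (While (Le (Add (Var i) (Const 1)) (Var b))
        (Seq (compile p) (Assign i (Add (Var i) (Const 1))))) s0
        (iter m f s0) t & t <= 6 + m * (10 + weight p * X).
    elim: m s0 => [|m IHm] s0 Hs0 Em.
      exists 6 => //.
      change 6 with (esize (Le (Add (Var i) (Const 1)) (Var b))).+1.
      by constructor => /=; rewrite -Em addn0 addn1 ltnn.
    have [t1 E1 T1] := IHp s0 wp bp mp Hs0.
    have bi : (b == i) = false by apply: contraNF ib => /eqP <-.
    have mS c : c \in bs -> c \notin modS p.
      by move=> cb; apply: contra mp => cS; apply/hasP; exists c.
    have [||t2 E2 T2] := IHm (f s0).
    + move=> c cb; rewrite /f /for_step /=.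
      have -> : (c == i) = false by apply: contraNF ib => /eqP <-.
      by rewrite scalar_run ?mS ?Hs0.
    + rewrite /f /for_step /= eqxx bi scalar_run // scalar_run; last exact: mS.
      by rewrite -Em; lia.
    exists (5 + (t1 + 4) + t2).+1; last by nia.
    rewrite iterSr.
    change 5 with (esize (Le (Add (Var i) (Const 1)) (Var b))).
    apply: exec_while_loop E2.
      by rewrite /= -Em; lia.
    apply: exec_seq E1 _.
    exact: (exec_assign i (Add (Var i) (Const 1))).
  have bi : (b == i) = false by apply: contraNF ib => /eqP <-.
  have [||t E T] := loop (scalar s b) (set_scalar s i 0).
  + move=> c cb /=; have -> : (c == i) = false by apply: contraNF ib => /eqP <-.
    exact: Hs.
  + by rewrite /= eqxx bi.
  exists (2 + t).
    by apply: exec_seq E; apply: (exec_assign i (Const 0)).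
  have DB := Hs _ bb; move: (scalar s b) DB T => N ND T.
  rewrite expnS -/X.
  have : N * (10 + weight p * X) <= D * (10 + weight p * X) by rewrite leq_mul2r ND orbT.
  nia.
Qed.

Lemma run_if e p q s :
  run (PIf e p q) s = if eval s e != 0 then run p s else run q s.
Proof. by []. Qed.

Lemma run_seq p q s : run (PSeq p q) s = run q (run p s).
Proof. by []. Qed.

Lemma run_assign a e s : run (PAssign a e) s = set_scalar s a (eval s e).
Proof. by []. Qed.

Lemma run_put a e1 e2 e s :
  run (PPut a e1 e2 e) s = set_array s a (eval s e1) (eval s e2) (eval s e).
Proof. by []. Qed.

Lemma array_set_scalar s i m : array (set_scalar s i m) = array s.
Proof. by []. Qed.

(** Truth is being nonzero, so each operand is normalised by a comparison with 1 before the sum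
    counts the true ones. *)
Definition And a b :=
  Le (Const 2) (Add (Le (Const 1) a) (Le (Const 1) b)).
Definition Or a b := Le (Const 1) (Add a b).
Definition Not a := Eq a (Const 0).
Definition Lt a b := Le (Add a (Const 1)) b.

Lemma eval_And s a b :
  eval s (And a b) = ((eval s a != 0) && (eval s b != 0) : bool).
Proof. by rewrite /=; case: (eval s a) (eval s b) => [|m] [|n]. Qed.

Lemma eval_Or s a b :
  eval s (Or a b) = ((eval s a != 0) || (eval s b != 0) : bool).
Proof. by rewrite /=; case: (eval s a) (eval s b) => [|m] [|n]. Qed.

Lemma eval_Not s a : eval s (Not a) = (eval s a == 0 : bool).
Proof. by []. Qed.

Lemma eval_Lt s a b : eval s (Lt a b) = (eval s a < eval s b : bool).
Proof. by rewrite /= addn1. Qed.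

Lemma eval_Eq s a b : eval s (Eq a b) = (eval s a == eval s b : bool).
Proof. by []. Qed.

Lemma eval_Le s a b : eval s (Le a b) = (eval s a <= eval s b : bool).
Proof. by []. Qed.

Lemma eval_Get s a b c : eval s (Get a b c) = array s a (eval s b) (eval s c).
Proof. by []. Qed.

Lemma eval_Add s a b : eval s (Add a b) = eval s a + eval s b.
Proof. by []. Qed.

Lemma eval_Sub s a b : eval s (Sub a b) = eval s a - eval s b.
Proof. by []. Qed.

Lemma eval_Var s a : eval s (Var a) = scalar s a.
Proof. by []. Qed.

Lemma eval_Const s a : eval s (Const a) = a.
Proof. by []. Qed.

Lemma nat_of_bool_neq0 (b : bool) : ((b : nat) != 0) = b.
Proof. by case: b. Qed.

Lemma nat_of_bool_eq0 (b : bool) : ((b : nat) == 0) = ~~ b.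
Proof. by case: b. Qed.

Definition evalE := (eval_And, eval_Or, eval_Not, eval_Lt, eval_Eq, eval_Le,
  eval_Get, eval_Add, eval_Sub, eval_Var, eval_Const,
  nat_of_bool_neq0, nat_of_bool_eq0).

Arguments And : simpl never.
Arguments Or : simpl never.
Arguments Not : simpl never.
Arguments Lt : simpl never.

Fixpoint readS (e : expr) : seq nat :=
  match e with
  | Const _ => [::]
  | Var a => [:: a]
  | Get _ e1 e2 | Add e1 e2 | Sub e1 e2 | Le e1 e2 | Eq e1 e2 =>
      readS e1 ++ readS e2
  end.

Fixpoint readA (e : expr) : seq nat :=
  match e with
  | Const _ | Var _ => [::]
  | Get a e1 e2 => a :: readA e1 ++ readA e2
  | Add e1 e2 | Sub e1 e2 | Le e1 e2 | Eq e1 e2 => readA e1 ++ readA e2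
  end.

Lemma eval_ext e s s' :
  {in readS e, forall a, scalar s' a = scalar s a} ->
  {in readA e, forall a x y, array s' a x y = array s a x y} ->
  eval s' e = eval s e.
Proof.
elim: e => [n|a|a e1 IH1 e2 IH2|e1 IH1 e2 IH2|e1 IH1 e2 IH2|e1 IH1 e2 IH2
           |e1 IH1 e2 IH2] //= HS HA.
  by apply: HS; rewrite inE.
all: have [S1 S2] :
  {in readS e1, forall a, scalar s' a = scalar s a} /\
  {in readS e2, forall a, scalar s' a = scalar s a}
  by split=> b bS; apply: HS; rewrite mem_cat bS ?orbT.
all: have [A1 A2] :
  {in readA e1, forall a x y, array s' a x y = array s a x y} /\
  {in readA e2, forall a x y, array s' a x y = array s a x y}
  by split=> b bA; apply: HA; rewrite ?inE ?mem_cat bA ?orbT.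
all: rewrite (IH1 S1 A1) (IH2 S2 A2) //.
by rewrite HA ?mem_head.
Qed.

Lemma eval_agree S A e s s' :
  agree S A s s' -> all (fun a => a \notin S) (readS e) ->
  all (fun a => a \notin A) (readA e) -> eval s' e = eval s e.
Proof.
move=> [HS HA] /allP eS /allP eA.
by apply: eval_ext => [a /eS|a /eA] *; [apply: HS|apply: HA].
Qed.

(** * Loops filling array rows, and exhaustive search for an index *)

Definition Fill a r i b c e1 e2 :=
  PFor i b (PIf c (PPut a r (Var i) e1) (PPut a r (Var i) e2)).

(** Under these conditions the writes do not influence later rounds, and every cell can be computed
    from the memory at entry. *)
Definition fill_ok a r i c e1 e2 :=
  [&& i \notin readS r, a \notin readA r, a \notin readA c,
      a \notin readA e1 & a \notin readA e2].

Lemma eval_loop i a s s' j e :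
  agree [:: i] [:: a] s s' -> scalar s' i = j -> a \notin readA e ->
  eval s' e = eval (set_scalar s i j) e.
Proof.
move=> [HS HA] Hi ae; apply: eval_ext => [b _|b be x y] /=.
  by case: eqP => [->//|/eqP bi]; apply: HS; rewrite inE.
by apply: HA; rewrite inE; apply: contraNneq ae => <-.
Qed.

Lemma eval_set_scalar s i j e :
  i \notin readS e -> eval (set_scalar s i j) e = eval s e.
Proof.
move=> ie; apply: eval_ext => //= b be.
by case: eqP => // bi; rewrite -bi be in ie.
Qed.

Lemma fillP a r i b c e1 e2 s x y : fill_ok a r i c e1 e2 ->
  array (run (Fill a r i b c e1 e2) s) a x y =
  if (x == eval s r) && (y < scalar s b)
  then if eval (set_scalar s i y) c != 0
       then eval (set_scalar s i y) e1 else eval (set_scalar s i y) e2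
  else array s a x y.
Proof.
move=> /and5P[ir ar ac ae1 ae2].
pose Inv j s' := forall x y, array s' a x y =
  if (x == eval s r) && (y < j)
  then if eval (set_scalar s i y) c != 0
       then eval (set_scalar s i y) e1 else eval (set_scalar s i y) e2
  else array s a x y.
move: x y; apply: (@for_invariant i b _ s Inv) => //.
  by move=> x y /=; rewrite ltn0 andbF.
move=> j s' jb Hi /=.
move=> Ha IH x y.
have {}Ha : agree [:: i] [:: a] s s'.
  by apply: agree_sub Ha => z //=; rewrite !inE orbb.
rewrite (eval_loop Ha Hi ac).
have body e : a \notin readA e ->
    array (set_array s' a (eval s' r) (scalar s' i) (eval s' e)) a x y =
    if (x == eval s r) && (y == j) then eval (set_scalar s i j) e
    else array s' a x y.
  move=> ae; rewrite /= eqxx (eval_loop Ha Hi ar) eval_set_scalar // Hi /=.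
  by rewrite (eval_loop Ha Hi ae).
rewrite /= in body; case: ifP => Ec; rewrite /= body // IH ltnS [y <= j]leq_eqVlt.
  by case: (x == _) => //=; case: eqP => [->|_] //=; rewrite ?Ec.
by case: (x == _) => //=; case: eqP => [->|_] //=; rewrite ?Ec.
Qed.

Definition Fill2 a o i bi j bj e :=
  PFor i bi (PFor j bj (PPut a (Add o (Var i)) (Var j) e)).

Definition fill2_ok a o i j bj e :=
  [&& i != j, bj \notin [:: i; j], i \notin readS o, j \notin readS o, a \notin readA o
    & a \notin readA e].

Lemma fill1P a r i b e s x y :
  [&& i \notin readS r, a \notin readA r & a \notin readA e] ->
  array (run (PFor i b (PPut a r (Var i) e)) s) a x y =
  if (x == eval s r) && (y < scalar s b) then eval (set_scalar s i y) e
  else array s a x y.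
Proof.
move=> /and3P[ir ar ae].
pose Inv j s' := forall x y, array s' a x y =
  if (x == eval s r) && (y < j) then eval (set_scalar s i y) e
  else array s a x y.
move: x y; apply: (@for_invariant i b _ s Inv) => //.
  by move=> x y /=; rewrite ltn0 andbF.
move=> j s' jb Hi /= Ha IH x y.
rewrite /= eqxx (eval_loop Ha Hi ar) eval_set_scalar // Hi IH ltnS [y <= j]leq_eqVlt /=.
case: (x == _) => //=; case: eqP => // ->.
exact: eval_loop Ha Hi _.
Qed.

Lemma fill2P a o i bi j bj e s x y : fill2_ok a o i j bj e ->
  array (run (Fill2 a o i bi j bj e) s) a x y =
  if [&& eval s o <= x, x < eval s o + scalar s bi & y < scalar s bj]
  then eval (set_scalar (set_scalar s i (x - eval s o)) j y) e
  else array s a x y.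
Proof.
move=> /and5P[ij ibj io jo /andP[ao ae]].
pose Inv m s' := forall x y, array s' a x y =
  if [&& eval s o <= x, x < eval s o + m & y < scalar s bj]
  then eval (set_scalar (set_scalar s i (x - eval s o)) j y) e
  else array s a x y.
move: x y; apply: (@for_invariant i bi _ s Inv) => //=.
- by rewrite inE.
- move=> x y /=; case: ifP => // /and3P[]; lia.
move=> m s' mb Hi Ha IH x y.
change (iter _ _ _) with (run (PFor j bj (PPut a (Add o (Var i)) (Var j) e)) s').
rewrite fill1P; last by rewrite /= mem_cat inE negb_or jo eq_sym ij cats0 ao ae.
have Eo : eval s' o = eval s o.
  apply: eval_agree Ha _ _; apply/allP => z zo; rewrite !inE ?negb_or.
    by rewrite !(memPn _ _ zo) // andbT.
  by apply: contraNneq ao => <-.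
have -> : scalar s' bj = scalar s bj by apply: Ha.1.
rewrite IH /= Eo Hi.
have -> : (x == eval s o + m) && (y < scalar s bj) =
   [&& x == eval s o + m, eval s o <= x & y < scalar s bj].
  by case: eqP => //= ->; rewrite leq_addr.
have -> : (x < eval s o + m.+1) = (x == eval s o + m) || (x < eval s o + m).
  by rewrite addnS ltnS leq_eqVlt.
case: (leqP (eval s o) x) => [ox|]; last by rewrite !andbF.
case: (y < _); last by rewrite !andbF.
rewrite !andbT; case: eqP => //= xm.
apply: eval_ext => [b _|b be u v] /=.
  case: eqP => // bj'; case: eqP => [->|/eqP bi']; first by rewrite Hi xm addKn.
  by apply: Ha.1; rewrite !inE negb_or bi'; apply/eqP.
by apply: Ha.2; rewrite inE; apply: contraNneq ae => <-.
Qed.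

(** Without early exit the last hit survives; the value of [b], which is no index, signals that
    there is none. *)
Definition Find v i b c :=
  PSeq (PAssign v (Var b)) (PFor i b (PIf c (PAssign v (Var i)) PSkip)).

Lemma find_runP v i b c s : [&& v \notin readS c, v != i & b != v] ->
  let N := scalar s b in
  let r := scalar (run (Find v i b c) s) v in
  if r < N then is_true (eval (set_scalar s i r) c != 0)
  else r = N /\ forall j, j < N -> eval (set_scalar s i j) c = 0.
Proof.
move=> /and3P[vc vi bv] N.
pose Inv m s' := let r := scalar s' v in
  if r < N then is_true (eval (set_scalar s i r) c != 0)
  else r = N /\ forall j, j < m -> eval (set_scalar s i j) c = 0.
pose s0 := set_scalar s v N.
have EN : scalar s0 b = N by rewrite /= (negbTE bv).
suff : Inv (scalar s0 b) (run (PFor i b (PIf c (PAssign v (Var i)) PSkip)) s0).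
  by rewrite EN.
apply: (@for_invariant i b _ s0 Inv).
- by rewrite /= inE eq_sym.
- by rewrite /Inv /= (negbTE vi) eqxx ltnn.
rewrite EN => m s' mb Hi Ha.
have Ec : eval s' c = eval (set_scalar s i m) c.
  apply: eval_ext => [x xc|x xc u w] /=; last by rewrite Ha.2.
  case: eqP => [->//|/eqP xi]; rewrite Ha.1 /=.
    by case: eqP => // xv; rewrite -xv xc in vc.
  by rewrite !inE negb_or xi; apply: contraNneq vc => <-.
rewrite /Inv /= Ec (negbTE vi).
have [c0|c0] := eqVneq (eval (set_scalar s i m) c) 0; last first.
  by rewrite /= eqxx Hi mb c0.
rewrite /=.
case: ifP => // _ [-> H]; split=> // j.
by rewrite ltnS leq_eqVlt => /predU1P[->//|/H].
Qed.

Arguments Fill : simpl never.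
Arguments Fill2 : simpl never.
Arguments Find : simpl never.

(** * Graph search *)

(* Scalars 0 to 3 are those of the input and output conventions, whose arrays
   are 0 to 5.  [v_n], [v_n1] and [v_n2] hold n_T, n_T + 1 and 2 n_T + 1. *)
Notation v_k := 0.
Notation v_ns := 1.
Notation v_iter := 2.
Notation v_q := 3.
Notation v_n := 4.
Notation v_n1 := 5.
Notation v_n2 := 6.
Notation v_i := 7.
Notation v_j := 8.
Notation v_h := 9.
Notation v_w := 10.
Notation v_tl := 11.
Notation v_v := 12.
Notation v_src := 13.
Notation v_l := 14.
Notation v_x := 15.
Notation v_f := 16.
Notation v_g := 17.
Notation v_r := 18.
Notation v_y := 19.
Notation v_z := 20.

Notation a_sub := 6.
Notation a_pos := 7.
Notation a_adj := 8.
Notation a_reach := 9.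
Notation a_G := 10.
Notation a_vis := 11.
Notation a_par := 12.
Notation a_qu := 13.
Notation a_mate := 14.
Notation a_used := 15.
Notation a_asg := 16.
Notation a_inN := 17.
Notation a_rep := 18.
Notation a_link := 19.
Notation a_cur := 20.

Notation at0 a i := (Get a (Const 0) i).

Definition Scan :=
  PFor v_w v_n1
    (PIf (And (Get a_G (Var v_v) (Var v_w)) (Not (Get a_vis (Const 0) (Var v_w))))
       (PSeq (PPut a_vis (Const 0) (Var v_w) (Const 1))
       (PSeq (PPut a_par (Const 0) (Var v_w) (Var v_v))
       (PSeq (PPut a_qu (Const 0) (Var v_tl) (Var v_w))
             (PAssign v_tl (Add (Var v_tl) (Const 1))))))
       PSkip).

(** The loop index [v_h] is the head of the queue. A vertex is enqueued at most once, so one round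
    per vertex is enough; once the head has passed the tail, rounds do nothing. *)
Definition Expand :=
  PFor v_h v_n1
    (PIf (Lt (Var v_h) (Var v_tl))
       (PSeq (PAssign v_v (Get a_qu (Const 0) (Var v_h))) Scan)
       PSkip).

Definition Search :=
  PSeq (Fill a_vis (Const 0) v_w v_n1 (Const 1) (Const 0) (Const 0))
  (PSeq (PPut a_vis (Const 0) (Var v_src) (Const 1))
  (PSeq (PPut a_qu (Const 0) (Const 0) (Var v_src))
  (PSeq (PAssign v_tl (Const 1))
    Expand))).

Lemma code_surj (V : finType) (code : V -> nat) m :
  injective code -> (forall v, code v < #|V|) -> m < #|V| ->
  exists v, code v = m.
Proof.
move=> ci cb mV; pose f v := Ordinal (cb v).
have fi : injective f by move=> v w /(congr1 val) /ci.
have /codomP [v E] : Ordinal mV \in codom f.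
  by rewrite inj_card_onto // card_ord.
by exists v; rewrite -[m]/(val (Ordinal mV)) E.
Qed.

Section SearchCorrectness.
Variables (V : finType) (code : V -> nat) (e : rel V) (src : V).
Hypothesis code_inj : injective code.
Hypothesis code_lt : forall v, code v < #|V|.

(** The path is recorded, not only the reachability of [w]: augmentation follows the parent pointers
    back along it, and needs it to be simple. *)
Definition traced (s : memory) (q : seq V) (w : V) : Prop :=
  exists p, [/\ path e src p, last src p = w, uniq (src :: p), {subset p <= q}
    & forall i, i < size p ->
        array s a_par 0 (code (nth src p i)) = code (nth src (src :: p) i)].

(** Nothing is ever removed from the queue, so [q] is also the set of visited vertices. *)
Definition queued (q : seq V) (s : memory) : Prop :=
  [/\ uniq q /\ scalar s v_tl = size q, src \in q,
      forall i, i < size q -> array s a_qu 0 i = code (nth src q i),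
      forall w, array s a_vis 0 (code w) = (w \in q)
    & {in q, forall w, traced s q w}].

Definition graph_in (s : memory) : Prop :=
  scalar s v_n1 = #|V| /\
  forall v w, (array s a_G (code v) (code w) != 0) = e v w.

Lemma graph_in_agree S A s s' : agree S A s s' -> v_n1 \notin S ->
  a_G \notin A -> graph_in s -> graph_in s'.
Proof.
move=> [HS HA] nS nA [E1 E2]; split; first by rewrite HS.
by move=> v w; rewrite HA.
Qed.

(** Writing the parent of a new vertex [w] disturbs no recorded path, since those stay inside
    [q]. *)
Lemma traced_new s s' q v w : v \in q -> w \notin q -> traced s q v -> e v w ->
  (forall u, array s' a_par 0 (code u) =
     if u == w then code v else array s a_par 0 (code u)) ->
  src \in q -> traced s' (rcons q w) w.
Proof.
move=> vq wq [p [pp lp up sp cp]] evw Hs srcq; exists (rcons p w); split.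
- by rewrite rcons_path pp lp.
- by rewrite last_rcons.
- rewrite -rcons_cons rcons_uniq up andbT inE negb_or.
  rewrite (contra (@sp w)) // andbT.
  by apply: contraNneq wq => ->.
- by move=> u; rewrite !mem_rcons !inE => /predU1P[->|/sp ->]; rewrite ?eqxx ?orbT.
- move=> i; rewrite size_rcons ltnS => ip.
  rewrite nth_rcons -rcons_cons nth_rcons /=.
  case: ltngtP ip => // [ip _|-> _]; rewrite Hs.
    rewrite ltnS (ltnW ip) -cp //; case: eqP => // E; case/negP: wq.
    by rewrite -E; apply: sp; apply: mem_nth.
  by rewrite eqxx ltnSn -lp (last_nth src).
Qed.

Lemma traced_old s s' q w u : u \in q -> w \notin q -> traced s q u ->
  (forall u, u != w -> array s' a_par 0 (code u) = array s a_par 0 (code u)) ->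
  traced s' (rcons q w) u.
Proof.
move=> uq wq [p [pp lp up sp cp]] Hs; exists p; split=> //.
  by move=> x /sp; rewrite mem_rcons inE orbC => ->.
move=> i ip; rewrite Hs ?cp //; apply: contraNneq wq => <-.
by apply: sp; apply: mem_nth.
Qed.

Lemma scanP s q v : graph_in s -> queued q s -> v \in q ->
  scalar s v_v = code v ->
  exists q', [/\ queued (q ++ q') (run Scan s) & forall w, e v w -> w \in q ++ q'].
Proof.
move=> Gs Qs vq Hv.
pose Inv m s' := exists q', [/\ queued (q ++ q') s'
  & forall w, code w < m -> e v w -> w \in q ++ q'].
suff [q' [Qq Hq]] : Inv (scalar s v_n1) (run Scan s).
  by exists q'; split=> // w; apply: Hq; rewrite Gs.1; exact: code_lt.
apply: (@for_invariant v_w v_n1 _ s Inv) => //.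
  by exists [::]; rewrite cats0; split.
move=> m s' mV Hw Ha [q' [[[uq sq] srcq quq visq tq] Hq]].
have [w Ew] : exists w, code w = m by apply: code_surj code_inj code_lt _; rewrite -Gs.1.
have Gs' := graph_in_agree Ha isT isT Gs.
have Hv' : scalar s' v_v = code v by rewrite Ha.1.
rewrite run_if.
have -> : eval s' (And (Get a_G (Var v_v) (Var v_w))
            (Not (Get a_vis (Const 0) (Var v_w)))) =
          (e v w && (w \notin q ++ q') : bool).
  by rewrite !evalE Hw Hv' -Ew Gs'.2 visq nat_of_bool_eq0.
case: ifP => [|Ec]; last first.
  exists q'; split; first by split.
  move=> u; rewrite ltnS leq_eqVlt => /predU1P[/eqP|um]; last exact: Hq.
  rewrite -Ew (inj_eq code_inj) => /eqP ->.
  by move=> evw; move: Ec; rewrite evw /= nat_of_bool_neq0 => /negbFE.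
rewrite nat_of_bool_neq0 => /andP[evw wq]; exists (rcons q' w).
rewrite -rcons_cat; split; last first.
  move=> u; rewrite ltnS leq_eqVlt mem_rcons inE => /predU1P[/eqP|um euv].
    by rewrite -Ew (inj_eq code_inj) => ->.
  by rewrite Hq ?orbT.
have vq' : v \in q ++ q' by rewrite mem_cat vq.
have par u : array (set_scalar (run (PSeq
         (PPut a_vis (Const 0) (Var v_w) (Const 1))
       (PSeq (PPut a_par (Const 0) (Var v_w) (Var v_v))
       (PSeq (PPut a_qu (Const 0) (Var v_tl) (Var v_w))
             (PAssign v_tl (Add (Var v_tl) (Const 1)))))) s') v_w m.+1) a_par 0 (code u) =
   if u == w then code v else array s' a_par 0 (code u).
  by rewrite /= Hv' Hw -Ew (inj_eq code_inj).
split.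
- by rewrite /= rcons_uniq wq uq size_rcons sq addn1.
- by rewrite mem_rcons inE srcq orbT.
- move=> i; rewrite size_rcons ltnS /= => iq; rewrite sq nth_rcons Hw -Ew.
  by case: ltngtP iq => // iq _; rewrite quq.
- move=> u; rewrite /= Hw -Ew (inj_eq code_inj) mem_rcons inE.
  by case: eqP => //= _; rewrite visq.
- move=> u; rewrite mem_rcons inE => /predU1P[->|uq'].
    exact: traced_new vq' wq (tq _ vq') evw par srcq.
  apply: traced_old uq' wq (tq _ uq') _ => x xw.
  by rewrite par (negbTE xw).
Qed.

(** After round [m] the successors of the first [m] queue entries are in the queue. There are [#|V|]
    rounds and at most [#|V|] entries, so in the end the queue is closed under [e]. *)
Lemma searchP s : graph_in s -> scalar s v_src = code src ->
  (forall w, array (run Search s) a_vis 0 (code w) = connect e src w) /\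
  (forall w, connect e src w -> traced (run Search s) (enum V) w).
Proof.
move=> Gs Hsrc.
pose sF := run (Fill a_vis (Const 0) v_w v_n1 (Const 1) (Const 0) (Const 0)) s.
pose s0 := run (PSeq (PPut a_vis (Const 0) (Var v_src) (Const 1))
  (PSeq (PPut a_qu (Const 0) (Const 0) (Var v_src)) (PAssign v_tl (Const 1)))) sF.
have GF : graph_in sF by apply: graph_in_agree (run_agree _ _) _ _ Gs.
have HF : scalar sF v_src = code src by rewrite scalar_run.
have VF w : array sF a_vis 0 (code w) = 0 by rewrite fillP //= Gs.1 code_lt.
have -> : run Search s = run Expand s0 by [].
move: (sF) GF HF VF @s0 => {}sF GF HF VF s0.
pose Inv m s' := exists q, [/\ queued q s' &
  forall i, i < m -> i < size q -> forall w, e (nth src q i) w -> w \in q].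
have G0 : graph_in s0 by apply: graph_in_agree (run_agree _ _) _ _ GF.
suff [q [[[uq sq] srcq quq visq tq] Hq]] : Inv (scalar s0 v_n1) (run Expand s0).
  have qV : size q <= #|V| by rewrite -(card_uniqP uq) max_card.
  have qc w : connect e src w = (w \in q).
    apply/idP/idP => [/connectP[p ep ->]|/tq[p [ep <- _ _ _]]]; last first.
      by apply/connectP; exists p.
    elim/last_ind: p ep => //= p x IH; rewrite rcons_path last_rcons => /andP[ep ex].
    have xq := IH ep; apply: (Hq (index (last src p) q)).
    - by rewrite G0.1; apply: leq_trans qV; rewrite index_mem.
    - by rewrite index_mem.
    - by rewrite nth_index.
  split=> w; first by rewrite visq qc.
  rewrite qc => /tq[p [? ? ? ? ?]]; exists p; split=> // x _.
  by rewrite mem_enum.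
apply: (@for_invariant v_h v_n1 _ s0 Inv) => //.
  exists [:: src]; split; last first.
    by move=> i.
  split=> //.
  - by rewrite inE.
  - by case=> // _ /=; rewrite HF.
  - by move=> w; rewrite /= inE HF (inj_eq code_inj); case: eqP.
  - by move=> w; rewrite inE => /eqP ->; exists [::]; split.
move=> m s' mV Hm Ha [q [[[uq sq] srcq quq visq tq] Hq]].
have Gs' := graph_in_agree Ha isT isT G0.
rewrite run_if evalE !eval_Var Hm sq.
case: ifP => Ec; last first.
  exists q; split=> [|i]; first by split.
  rewrite ltnS leq_eqVlt => /predU1P[->|]; last exact: Hq.
  by move: Ec; rewrite nat_of_bool_neq0 => ->.
rewrite nat_of_bool_neq0 in Ec.
rewrite run_seq run_assign; set s1 := set_scalar s' v_v _.
have [||||q' [Qq' Hq']] := @scanP s1 q (nth src q m).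
- exact: graph_in_agree (agree_set_scalar [::] _ _ (mem_head v_v [::])) isT isT Gs'.
- by split.
- exact: mem_nth.
- by rewrite /s1 /= Hm quq.
exists (q ++ q'); split.
  case: Qq' => -[uq' sq'] srcq' quq' visq' tq'.
  split=> //; split=> //.
move=> i; rewrite ltnS leq_eqVlt => /predU1P[-> _|im iq] w.
  rewrite nth_cat Ec; apply: Hq'.
case: (ltnP i (size q)) => iq'.
  rewrite nth_cat iq' mem_cat => /(Hq i im iq') ->//.
lia.
Qed.

End SearchCorrectness.

Arguments Search : simpl never.

(** * Greedy maximum matchings *)

Section GreedyMatching.
Variables (L R : finType) (E : L -> R -> bool).
Implicit Types (m : L -> option R) (P : pred R) (W : {set L}) (p : seq (option L)).

Definition pmatching m : Prop :=
  (forall x r, m x = Some r -> E x r) /\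
  (forall x y r, m x = Some r -> m y = Some r -> x = y).

Definition matched m P : {set L} := [set x | oapp P false (m x)].

Lemma matchedP m P x : reflect (exists2 r, m x = Some r & P r) (x \in matched m P).
Proof.
rewrite inE; case: (m x) => [r|] /=; last by constructor=> -[].
by apply: (iffP idP) => [Pr|[_ [<-]]//]; exists r.
Qed.

(* Koenig certificate: [W] together with the partners of the matched left nodes
   outside [W] covers all edges into [P]. *)
Definition certificate m W P : Prop :=
  [/\ forall x, x \in W -> m x != None,
      forall x r y, x \in W -> m x = Some r -> E y r -> y \in W
    & forall r, P r -> (exists x, m x = Some r) \/ (forall y, E y r -> y \in W)].

(** Only the set of right nodes in use matters: send a left node to the one that has the same
    partner under [m']. *)
Lemma matched_image m m' P : pmatching m -> pmatching m' ->
  (forall x r, m x = Some r -> exists y, m' y = Some r) ->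
  #|matched m P| <= #|matched m' P|.
Proof.
move=> [_ im] [_ im'] mm'.
pose g x := odflt x [pick y | m' y == m x].
have gP x : x \in matched m P -> m' (g x) = m x.
  move=> /matchedP[r mr _]; rewrite /g; case: pickP => [y /eqP//|no].
  by have [y my] := mm' _ _ mr; have := no y; rewrite my mr eqxx.
have <- : #|g @: matched m P| = #|matched m P|.
  apply: card_in_imset.
  move=> x y xM yM gxy; have Ex := gP x xM; have Ey := gP y yM.
  move: xM => /matchedP[r mr _]; apply: (im _ _ r) => //.
  by rewrite -Ey -gxy Ex.
apply: subset_leq_card; apply/subsetP => _ /imsetP[x xM ->].
have xM' : x \in matched m P by [].
by move: (xM'); rewrite !inE (gP _ xM').
Qed.

(** All of [W] is matched by [m]. Outside [W], the [m']-partner of a left node has a neighbour not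
    in [W], hence is matched by [m], and its [m]-partner is again outside [W] because [W] is closed
    under neighbours of partners. *)
Lemma certificate_max m m' W P : pmatching m -> pmatching m' ->
  (forall x r, m x = Some r -> P r) -> certificate m W P ->
  #|matched m' P| <= #|matched m P|.
Proof.
move=> [em im] [em' im'] mP [W1 W2 W3].
rewrite -(cardsID W (matched m' P)) -(cardsID W (matched m P)); apply: leq_add.
  apply: subset_leq_card; apply/subsetP => x; rewrite !inE => /andP[_ xW].
  by rewrite xW andbT; move: (W1 x xW) (mP x); case: (m x) => //= r _; apply.
pose g x := odflt x [pick y | m y == m' x].
have gP x : x \in matched m' P :\: W -> m (g x) = m' x /\ g x \notin W.
  rewrite in_setD => /andP[xW /matchedP[r m'r Pr]].
  have gx : m (g x) = m' x.
    rewrite /g; case: pickP => [y /eqP//|no].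
    case: (W3 r Pr) => [[y my]|/(_ x (em' _ _ m'r))]; last by rewrite (negbTE xW).
    by have := no y; rewrite my m'r eqxx.
  split=> //; apply: contra xW => gW.
  by apply: W2 gW _ (em' _ _ m'r); rewrite gx.
have <- : #|g @: (matched m' P :\: W)| = #|matched m' P :\: W|.
  apply: card_in_imset.
  move=> x y xM yM gxy; have [Ex _] := gP x xM; have [Ey _] := gP y yM.
  move: xM; rewrite in_setD => /andP[_ /matchedP[r mr _]].
  by apply: (im' _ _ r) => //; rewrite -Ey -gxy Ex.
apply: subset_leq_card; apply/subsetP => _ /imsetP[x xM ->].
have xM' : x \in matched m' P :\: W by [].
have [gx gW] := gP x xM'; move: xM'.
by rewrite !inE gW gx => /andP[].
Qed.

Section Step.
Variables (m : L -> option R) (r0 : R).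
Hypothesis pm : pmatching m.
Hypothesis r0_free : forall x, m x <> Some r0.

(* The right node [r0] to be matched plays the role of the partner of [None]. *)
Definition mate_of (v : option L) : option R := oapp m (Some r0) v.

(** One step of an alternating walk: from a left node to its partner and on to a neighbour of that
    partner. No step leads back to [None]. *)
Definition alternate : rel (option L) := fun v w =>
  if w is Some x then oapp (E x) false (mate_of v) else false.

Lemma mate_of_inj v w r : mate_of v = Some r -> mate_of w = Some r -> v = w.
Proof.
case: v w => [x|] [y|] //=; first by move=> mx my; rewrite (pm.2 _ _ _ mx my).
  by move=> mx [rr]; case: (r0_free (x := x)); rewrite mx rr.
by move=> [<-] /r0_free.
Qed.

(** The left nodes reached by the failed search contain all neighbours of [r0], are matched, and are
    closed under neighbours of their partners. *)
Lemma certificate_fail W P :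
  (forall x, connect alternate None (Some x) -> m x != None) ->
  certificate m W P ->
  certificate m (W :|: [set x | connect alternate None (Some x)])
    (predU P (pred1 r0)).
Proof.
move=> full [W1 W2 W3]; split.
- by move=> x; rewrite !inE => /orP[/W1|/full].
- move=> x r y; rewrite !inE => /orP[xW mr Eyr|cx mr Eyr].
    by rewrite (W2 x r).
  apply/orP; right; apply: connect_trans cx (connect1 _).
  by rewrite /= mr.
- move=> r /= /orP[/W3[]|/eqP ->].
  + by left.
  + by move=> H; right=> y /H; rewrite inE => ->.
  + right=> y Ey; rewrite !inE; apply/orP; right; apply: connect1.
    exact: Ey.
Qed.

Variables (p : seq (option L)) (t : L).
Hypothesis p_path : path alternate None p.
Hypothesis p_last : last None p = Some t.
Hypothesis p_uniq : uniq (None :: p).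
Hypothesis t_free : m t = None.

(** Shifting partners along the path is a cyclic shift of [None :: p], so injectivity comes from
    that of [prev]. Off the path [prev] is the identity and the partner is kept. *)
Definition augment (x : L) : option R := mate_of (prev (None :: p) (Some x)).

Lemma augmentE x : augment x =
  if Some x \in p then mate_of (nth None (None :: p) (index (Some x) p)) else m x.
Proof. by rewrite /augment prev_nth inE /=; case: ifP. Qed.

Lemma mate_prev_None : mate_of (prev (None :: p) None) = None.
Proof.
have Np : None \notin p by case/andP: p_uniq.
rewrite prev_nth mem_head; move: Np; rewrite -index_mem -leqNgt => sp.
have -> : index None p = size p by apply/eqP; rewrite eqn_leq index_size.
by rewrite -last_nth p_last.
Qed.

(** [prev] permutes [option L], so [augment] has the values of [mate_of] except the one taken over
    by [None]. That one comes from the free end [t] of the path, hence no right node is lost. *)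
Lemma augment_image r :
  (exists x, augment x = Some r) <-> (exists x, m x = Some r) \/ r = r0.
Proof.
split=> [[x]|H].
  rewrite /augment; case: (prev _ _) => [y|] /= mr; first by left; exists y.
  by right; case: mr.
have [u mu] : exists u, mate_of u = Some r.
  by case: H => [[x mx]|->]; [exists (Some x)|exists None].
have : mate_of (prev (None :: p) (next (None :: p) u)) = Some r.
  by rewrite prev_next.
case: (next _ u) => [x mx|]; first by exists x.
by rewrite mate_prev_None.
Qed.

Lemma augment_pmatching : pmatching augment.
Proof.
split=> [x r|x y r mx my].
  rewrite augmentE; case: ifP => [xp mr|_]; last exact: pm.1.
  have ip : index (Some x) p < size p by rewrite index_mem.
  have := pathP None p_path _ ip; rewrite nth_index // /alternate.
  by rewrite mr.
have E' : prev (None :: p) (Some x) = prev (None :: p) (Some y).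
  exact: mate_of_inj mx my.
by have [] := can_inj (next_prev p_uniq) E'.
Qed.

(** The path avoids [W]: having entered it, it could not leave it, yet it ends in the free node [t],
    while all nodes of [W] are matched. So [augment] agrees with [m] on [W]. *)
Lemma augment_certificate W P : certificate m W P ->
  certificate augment W (predU P (pred1 r0)).
Proof.
move=> [W1 W2 W3].
have aW x : x \in W -> augment x = m x.
  move=> xW; rewrite augmentE; case: ifP => // xp.
  case/splitPr: xp p_path p_last => p1 p2; rewrite cat_path last_cat /=.
  move=> /and3P[_ _ pa la]; exfalso.
  clear p_uniq; elim: p2 x xW pa la => [|[y|] p2 IH] x xW /=.
    by move=> _ [xt]; have := W1 x xW; rewrite xt t_free.
    move=> /andP[a pa] la; apply: (IH y) pa la.
    case mx: (m x) a (W1 x xW) => [r|] //= Eyr _.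
    exact: W2 xW mx Eyr.
  by [].
split.
- by move=> x xW; rewrite aW // W1.
- by move=> x r y xW; rewrite aW //; apply: W2.
- move=> r /= /orP[/W3[H|H]|/eqP ->]; last by left; apply/augment_image; right.
    by left; apply/augment_image; left.
  by right.
Qed.

End Step.

Variable rank : R -> nat.
Hypothesis rank_inj : injective rank.

(** A certificate is carried along for the current threshold only; for smaller thresholds the
    maximality itself is remembered. *)
Definition greedy (i : nat) m : Prop :=
  [/\ pmatching m, forall x r, m x = Some r -> rank r < i,
      exists W, certificate m W (fun r => rank r < i)
    & forall j m', j <= i -> pmatching m' ->
        #|matched m' (fun r => rank r < j)| <= #|matched m (fun r => rank r < j)|].

Lemma greedy0 m : (forall x, m x = None) -> greedy 0 m.
Proof.
move=> m0; split=> //.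
- by split=> x; [rewrite m0|move=> y r; rewrite m0].
- by move=> x r; rewrite m0.
- exists set0; split=> // x; first by rewrite inE.
  by move=> r y; rewrite inE.
- move=> j m'; rewrite leqn0 => /eqP -> _.
  by rewrite (_ : matched m' _ = set0) ?cards0 //; apply/setP => x; rewrite !inE; case: (m' x).
Qed.

Lemma eq_certificate m W P P' : P =1 P' -> certificate m W P -> certificate m W P'.
Proof. by move=> PP' [? ? H]; split=> // r; rewrite -PP'; apply: H. Qed.

(** Thresholds up to [i] inherit maximality by [matched_image], as [m1] still uses every right node
    that [m] uses; the new threshold has the certificate. *)
Lemma greedy_step_max i r0 m m1 W :
  rank r0 = i -> greedy i m -> pmatching m1 ->
  (forall x r, m x = Some r -> exists y, m1 y = Some r) ->
  (forall x r, m1 x = Some r -> rank r < i.+1) ->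
  certificate m1 W (predU (fun r => rank r < i) (pred1 r0)) ->
  greedy i.+1 m1.
Proof.
move=> ri [pm lt _ mx] pm1 im1 lt1 cW.
have {}cW : certificate m1 W (fun r => rank r < i.+1).
  apply: eq_certificate cW => r /=.
  by rewrite ltnS [rank r <= i]leq_eqVlt orbC -ri (inj_eq rank_inj).
split=> //; first by exists W.
move=> j m'; rewrite leq_eqVlt => /predU1P[-> pm'|ji pm'].
  exact: certificate_max cW.
exact: leq_trans (mx _ _ _ pm') (matched_image _ _ _ _).
Qed.

Lemma greedy_fail i r0 m : rank r0 = i -> greedy i m ->
  (forall x, connect (alternate m r0) None (Some x) -> m x != None) ->
  greedy i.+1 m.
Proof.
move=> ri Gm full; case: (Gm) => pm lt [W cW] _.
apply: (greedy_step_max ri Gm pm _ _ (certificate_fail full cW)).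
  by move=> x r mr; exists x.
by move=> x r /lt /leqW.
Qed.

Lemma greedy_augment i r0 m p t : rank r0 = i -> greedy i m ->
  path (alternate m r0) None p -> last None p = Some t ->
  uniq (None :: p) -> m t = None -> greedy i.+1 (augment m r0 p).
Proof.
move=> ri Gm pp lp up mt; case: (Gm) => pm lt [W cW] _.
have r0_free x : m x <> Some r0 by move=> /lt; rewrite ri ltnn.
have aP := augment_pmatching pm r0_free pp up.
apply: (greedy_step_max ri Gm aP _ _ (augment_certificate pp lp up mt cW)).
  by move=> x r mr; apply/(augment_image r0 lp up mt); left; exists x.
move=> x r mr; have /(augment_image r0 lp up mt) : exists x, augment m r0 p x = Some r by exists x.
by case=> [[y /lt/leqW]//|->]; rewrite ri.
Qed.

End GreedyMatching.

(** * Necessary conditions for structural controllability *)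

Section StructuralControllability.
Variables (R : realType) (n : nat) (Abar : 'M[bool]_n) (Bbar : 'cV[bool]_n).
Hypothesis sc : structurally_controllable R Abar Bbar.
Import GRing.Theory.
Local Open Scope ring_scope.

(** Otherwise row [i] of every block A^t B vanishes, and a unit row vector would annihilate the
    Kalman matrix, which has full row rank. *)
Lemma controllable_accessible (S : pred 'I_n) :
  (forall i, Bbar i ord0 -> S i) ->
  (forall i j, Abar i j -> S j -> S i) -> forall i, S i.
Proof.
case: sc => A [B [rA rB rk]] SB SA i; apply/negPn/negP => nSi.
have zero t r : ~~ S r -> (A ^+ t *m B) r ord0 = 0.
  elim: t r => [|t IH] r nSr.
    by rewrite expr0 mul1mx rB //; apply: contra nSr => /SB.
  rewrite exprS -[A * _]/(A *m _) -mulmxA mxE big1 // => j _.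
  case Sj: (S j); last by rewrite IH ?Sj ?mulr0.
  by rewrite rA ?mul0r //; apply: contra nSr => /SA; apply.
have free : row_free (\mxrow_(j < n) (A ^+ j *m B)) by rewrite /row_free rk.
have : delta_mx (ord0 : 'I_1) i *m (\mxrow_(j < n) (A ^+ j *m B)) = 0.
  rewrite mul_mxrow; apply/mxrowP => j; rewrite mxrowK -rowE.
  apply/rowP => u; rewrite ord1 !mxE.
  by have := zero j i nSi; rewrite mxE.
move/eqP; rewrite mulmx_free_eq0 // => /eqP/matrixP/(_ ord0 i)/eqP.
by rewrite !mxE !eqxx oner_eq0.
Qed.

(** The Kalman matrix factors through [A B], which therefore has full row rank. A nonzero maximal
    minor has a nonzero term in its Leibniz expansion, and the permutation of this term is the
    matching. *)
Lemma controllable_matching :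
  exists2 f : 'I_n -> option 'I_n, injective f &
    forall i, if f i is Some j then Abar i j else Bbar i ord0.
Proof.
case: sc => A [B [rA rB rk]]; pose M := row_mx A B.
have rM : row_full M^T.
  rewrite /row_full mxrank_tr eqn_leq rank_leq_row -{1}rk.
  (* Block 0 is B itself; block j > 0 is A applied to A^(j-1) B. *)
  pose X (j : 'I_n) : 'M[R]_(n + 1, 1) :=
    if j : nat is j'.+1 then col_mx (A ^+ j' *m B) 0 else col_mx 0 1%:M.
  suff -> : \mxrow_(j < n) (A ^+ j *m B) = M *m \mxrow_(j < n) X j.
    exact: mxrankM_maxl.
  rewrite mul_mxrow; apply: eq_mxrow => j; rewrite /X /M; case: (j : nat) => [|j'].
    by rewrite mul_row_col expr0 mulmx0 add0r mul1mx mulmx1.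
  by rewrite mul_row_col mulmx0 addr0 exprS -mulmxA.
have := fullrowsub_unit rM; rewrite unitmxE unitfE /determinant.
set g := fullrankfun rM => det.
have /existsP[s /forallP sP] :
    [exists s : {perm 'I_n}, [forall i, M (s i) (g i) != 0]].
  apply: contraNT det; rewrite negb_exists => /forallP no.
  apply/eqP; apply: big1 => s _; apply/eqP; rewrite mulf_eq0; apply/orP; right.
  have := no s; rewrite negb_forall => /existsP[i /negPn/eqP Mi].
  by rewrite (bigD1 i) //= mxE [_^T _ _]mxE -/g Mi mul0r.
pose h (j : 'I_(n + 1)) : option 'I_n := if split j is inl j' then Some j' else None.
exists (fun i => h (g (s^-1%g i))).
  have hi : injective h.
    move=> a b; rewrite /h; case: splitP => a' Ea; case: splitP => b' Eb // E.
      by case: E => E; apply: val_inj; rewrite /= Ea Eb E.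
    by apply: val_inj; rewrite /= Ea Eb !ord1.
  by move=> a b /hi/fullrankfun_inj/perm_inj.
move=> i; have := sP (s^-1%g i); rewrite permKV /h mxE.
case: split => j; first by apply: contraNT => /rA ->.
by rewrite ord1; apply: contraNT => /rB ->.
Qed.

End StructuralControllability.

(** * The composite system *)

Section Domain.
Variables (k ns : nat) (A : 'M[bool]_ns) (B : 'cV[bool]_(k * ns)).

Local Notation st := (state k ns).
Local Notation edge := (st * rnode k ns)%type.
Implicit Types (x y z : st) (N : {set st}) (J : {set st * st}).

Definition idx x : nat := mxtens_index x.
Definition code (v : option st) : nat := oapp idx (k * ns) v.

Lemma idx_lt x : idx x < k * ns.
Proof. exact: ltn_ord. Qed.

Lemma idx_inj : injective idx.
Proof. by move=> x y /val_inj/(can_inj (@mxtens_indexK k ns)). Qed.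

Lemma idx_surj j : j < k * ns -> exists x, idx x = j.
Proof.
by move=> jn; exists (mxtens_unindex (Ordinal jn)); rewrite /idx mxtens_unindexK.
Qed.

Lemma code_inj : injective code.
Proof.
case=> [x|] [y|] //= => [/idx_inj ->//|E|E].
  by have := idx_lt x; rewrite E ltnn.
by have := idx_lt y; rewrite -E ltnn.
Qed.

Lemma card_st : #|{: st}| = k * ns.
Proof. by rewrite card_prod !card_ord. Qed.

Lemma card_ost : #|{: option st}| = (k * ns).+1.
Proof. by rewrite card_option card_st. Qed.

Lemma code_lt v : code v < #|{: option st}|.
Proof. by rewrite card_ost; case: v => [x|] //=; rewrite ltnS ltnW ?idx_lt. Qed.

Lemma code_leq v : code v <= k * ns.
Proof. by have := code_lt v; rewrite card_ost. Qed.

Definition feeds (v : option st) x : bool :=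
  if v is Some y then eX A y x else eU B x.

Lemma arc_Some J v x : arc A B J v (Some x) =
  feeds v x || (if v is Some y then (y, x) \in J else false).
Proof. by case: v => //=; rewrite orbF. Qed.

Lemma arc_None J v : arc A B J v None = false.
Proof. by case: v. Qed.

Lemma arc0 v x : arc A B set0 v (Some x) = feeds v x.
Proof. by rewrite arc_Some; case: v => [y|]; rewrite ?in_set0 orbF. Qed.

Lemma connect_eX J x y : connect (eX A) x y ->
  connect (arc A B J) (Some x) (Some y).
Proof.
case/connectP => p; elim: p x => [|z p IH] x /=; first by move=> _ ->.
move=> /andP[xz zp] ly; apply: connect_trans (IH _ zp ly).
by apply: connect1; rewrite arc_Some /= xz.
Qed.

Lemma connect_arc0 x y :
  connect (arc A B set0) (Some x) (Some y) = connect (eX A) x y.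
Proof.
apply/idP/idP; last exact: connect_eX.
case/connectP => p; elim: p x => [|[z|] p IH] x.
- by move=> _ [->].
- rewrite [path _ _ _]/= -/(arc A B set0 (Some x) (Some z)) arc0.
  move=> /andP[xz zp] ly; apply: connect_trans (connect1 xz) (IH _ zp ly).
- by [].
Qed.

Lemma accessible_connect J x y :
  accessible A B J x -> connect (eX A) x y -> accessible A B J y.
Proof. by move=> ax xy; apply: connect_trans ax (connect_eX J xy). Qed.

Lemma mem_scc x : x \in scc A x.
Proof. by rewrite inE connect0. Qed.

Lemma scc_eq x y : y \in scc A x -> scc A y = scc A x.
Proof.
rewrite inE => /andP[xy yx]; apply/setP => z; rewrite !inE.
by apply/andP/andP => -[a b]; split; try exact: connect_trans a;
  try exact: connect_trans xy a; try exact: connect_trans yx a;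
  exact: connect_trans b _.
Qed.

Lemma scc_accessibleE J x : scc_accessible A B J (scc A x) = accessible A B J x.
Proof.
apply/forall_inP/idP => [|ax y]; first by apply; apply: mem_scc.
by rewrite inE => /andP[xy _]; apply: accessible_connect xy.
Qed.

Definition inN x : bool := scc A x \in calN A B.

Lemma inN_mem N x : N \in calN A B -> x \in N -> N = scc A x.
Proof.
rewrite inE => /and3P[/imsetP[y _ ->] _ _] xy.
by rewrite (scc_eq xy).
Qed.

(** This is the form tested by [MarkN]. A predecessor of a node of a non-top linked SCC belongs to
    that SCC, so walking up any path into [x] never leaves the SCC of [x]. *)
Lemma inNE x : inN x =
  [forall y, connect (eX A) y x ==> connect (eX A) x y] &&
  ~~ accessible A B set0 x.
Proof.
rewrite /inN inE imset_f ?inE //= scc_accessibleE; congr (_ && _).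
apply/forallP/forallP => H y; last first.
  apply/forall_inP => z zx; apply/implyP => yx; apply/negP => yz.
  have := H y; move: zx yx; rewrite !inE => /andP[xz zx].
  have yx := connect_trans (connect1 yz) zx.
  by rewrite yx /= andbT => /negP.
apply/implyP => /connectP[p]; elim: p y => [|z p IH] y /=.
  by move=> _ ->; apply: connect0.
move=> /andP[yz zp] lx; have xz := IH _ zp lx.
have zs : z \in scc A x.
  by rewrite inE xz /= ; apply/connectP; exists p.
have := forall_inP (H y) z zs; case ys: (y \in scc A x).
  by move: ys; rewrite inE => /andP[].
by rewrite yz.
Qed.

(** The state of largest index stands for its SCC, which turns an SCC into a right node with a
    number. *)
Definition isrep y : bool := inN y && [forall z in scc A y, idx z <= idx y].

Lemma isrep_exists N : N \in calN A B ->
  exists y, [/\ y \in N, scc A y = N & isrep y].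
Proof.
move=> NN; have [x Nx] : exists x, N = scc A x.
  by move: NN; rewrite inE => /and3P[/imsetP[x _ ->] _ _]; exists x.
case: (arg_maxnP (P := mem N) idx (i0 := x)) => [|y yN ym].
  by rewrite /= Nx mem_scc.
have Ny := inN_mem NN yN; exists y; split=> //.
rewrite /isrep /inN -Ny NN; apply/forall_inP => z.
exact: ym.
Qed.

Lemma isrep_inj y z : isrep y -> isrep z -> scc A y = scc A z -> y = z.
Proof.
move=> /andP[_ /forall_inP Hy] /andP[_ /forall_inP Hz] yz.
apply: idx_inj; apply/eqP; rewrite eqn_leq; apply/andP; split.
  by apply: Hz; rewrite -yz mem_scc.
by apply: Hy; rewrite yz mem_scc.
Qed.

(* Right nodes of the matching problem: a state or the input, or the
   representative of an SCC in N. *)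
Local Notation right := (option st + st)%type.

Definition admits x (r : right) : bool :=
  match r with
  | inl v => feeds v x
  | inr y => isrep y && (x \in scc A y)
  end.

(* Right nodes in the order of increasing cost of their edges. *)
Definition rank (r : right) : nat :=
  match r with
  | inl None => 0
  | inl (Some y) => (idx y).+1
  | inr y => (k * ns).+1 + idx y
  end.

Lemma rank_inj : injective rank.
Proof.
move=> [[y|]|y] [[z|]|z] //=.
- by case=> /idx_inj ->.
- by move=> E; have := idx_lt y; lia.
- by move=> E; have := idx_lt z; lia.
- by move/addnI/idx_inj ->.
Qed.

Definition rnode_of (r : right) : rnode k ns :=
  match r with inl v => inl v | inr y => rscc (scc A y) end.

Definition gset (g : st -> rnode k ns) : {set edge} := [set e | e.2 == g e.1].

Lemma card_gset g : #|gset g| = k * ns.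
Proof.
have -> : gset g = [set (x, g x) | x : st].
  apply/setP => -[x r]; rewrite inE /=; apply/eqP/imsetP => [->|[y _ [-> ->]]//].
  by exists x.
by rewrite card_imset ?card_st // => x y [].
Qed.

Lemma gset_matching (G : bigraph st (rnode k ns)) g :
  (forall x, (x, g x) \in bedges G) -> injective g -> is_matching G (gset g).
Proof.
move=> gG gi; split; first by apply/subsetP => -[x r]; rewrite inE /= => /eqP ->.
move=> [x r] [y s]; rewrite !inE /= => /eqP -> /eqP -> [->//|/gi ->//].
Qed.

Lemma card_rnodes : k * ns < #|rnodes (bipN A B)|.
Proof.
have inlI : injective (inl : option st -> rnode k ns) by move=> v w [].
rewrite -card_ost -cardsT -(card_imset _ inlI).
apply: subset_leq_card; apply/subsetP => _ /imsetP[v _ ->].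
by rewrite !inE.
Qed.

(** Right nodes outnumber left nodes by [card_rnodes], so a perfect matching covers every left
    node. *)
Lemma perfect_gset (M : {set edge}) : perfect_matching (bipN A B) M ->
  exists g, [/\ M = gset g, injective g & forall x, (x, g x) \in bedges (bipN A B)].
Proof.
case=> -[Ms Mi]; rewrite cardsT card_st (minn_idPl (ltnW card_rnodes)) => cM.
have fi : {in M &, injective (fun e : edge => e.1)}.
  by move=> e f eM fM E; apply: Mi => //; left.
have im : [set e.1 | e in M] = setT.
  by apply/eqP; rewrite eqEcard subsetT cardsT card_st card_in_imset // cM /=.
have ex x : exists r, (x, r) \in M.
  have : x \in [set e.1 | e in M] by rewrite im.
  by case/imsetP => -[y r] eM /= ->; exists r.
pose g x := odflt (rinput k ns) [pick r | (x, r) \in M].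
have gM x : (x, g x) \in M.
  rewrite /g; case: pickP => [r //|no]; case: (ex x) => r rM.
  by have := no r; rewrite rM.
exists g; split.
- apply/setP => -[x r]; rewrite inE /=; apply/idP/eqP => [xM|->//].
  by have [] := fi (x, r) (x, g x) xM (gM x) erefl.
- move=> x y gxy; by have [] := Mi (x, g x) (y, g y) (gM x) (gM y) (or_intror gxy).
- by move=> x; apply: (subsetP Ms).
Qed.

(** [m] is the part of [g] with edges of cost below 3; [None] stands for an edge of cost 3. *)
Definition compatible (m : st -> option right) (g : st -> rnode k ns) : Prop :=
  forall x, match m x with
    | Some r => g x = rnode_of r /\ admits x r
    | None => exists2 y, g x = rstate y & ~~ eX A y x
    end.

Lemma compatible_pmatching m g : compatible m g -> injective g ->
  pmatching admits m.
Proof.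
move=> mg gi; split=> [x r mx|x y r mx my].
  by have := mg x; rewrite mx => -[].
apply: gi; have := mg x; have := mg y; rewrite mx my.
by move=> [-> _] [-> _].
Qed.

(** The rank thresholds 1, n_T + 1 and 2 n_T + 1 cut off the input, then the states, then the SCCs,
    so the identity holds edge by edge. *)
Lemma cost_compatible m g : compatible m g ->
  matching_cost (cost A B) (gset g)
    + #|matched m (fun r => rank r < 1)|
    + #|matched m (fun r => rank r < (k * ns).+1)|
    + #|matched m (fun r => rank r < (k * ns).*2.+1)| = 3 * (k * ns).
Proof.
move=> mg; rewrite /matching_cost.
have -> : \sum_(e in gset g) cost A B e = \sum_(x : st) cost A B (x, g x).
  rewrite (reindex_onto (fun x => (x, g x)) (fun e : edge => e.1)) /=.
    by apply: eq_bigl => x; rewrite inE !eqxx.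
  by move=> [x r]; rewrite inE /= => /eqP ->.
have cardE P : #|matched m P| = \sum_(x : st) (oapp P false (m x) : nat).
  by rewrite /matched -sum1dep_card big_mkcond; apply: eq_bigr => x _; case: (oapp _ _ _).
rewrite !cardE -!big_split /=.
have -> : 3 * (k * ns) = \sum_(x : st) 3 by rewrite sum_nat_const card_st mulnC.
apply: eq_bigr => x _.
have := mg x; rewrite /cost !inE /=.
case: (m x) => [[[y|]|y] [-> /=]|[y -> /= /negbTE ->]] //=.
- move=> -> /=; have yn := idx_lt y.
  have -> : (idx y).+1 < (k * ns).+1 by lia.
  by have -> : (idx y).+1 < (k * ns).*2.+1 by lia.
- by move=> ->.
- move=> /andP[/andP[Ny _] xy]; rewrite -/(inN y) Ny xy /= ltnNge leq_addr /=.
  by have -> : (k * ns).+1 + idx y < (k * ns).*2.+1 by have := idx_lt y; lia.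
Qed.

Lemma perfect_compatible M : perfect_matching (bipN A B) M ->
  exists m g, [/\ M = gset g, injective g & compatible m g].
Proof.
move=> /perfect_gset [g [-> gi gE]].
pose m x : option right :=
  match g x with
  | inl (Some y) => if eX A y x then Some (inl (Some y)) else None
  | inl None => Some (inl None)
  | inr N => omap inr [pick y | isrep y && (scc A y == N)]
  end.
exists m, g; split=> // x; rewrite /m.
have := gE x; rewrite !inE /=; case: (g x) => [[y|]|N] /=.
- by case: ifP => //= nX _; exists y; rewrite ?nX.
- by rewrite !orbF /=.
- move=> /andP[NN xN]; case: pickP => [y /andP[ry /eqP yN]|no] /=.
    by rewrite ry yN.
  have [y [_ yN ry]] := isrep_exists NN.
  by have := no y; rewrite ry yN eqxx.
Qed.

End Domain.

(** * The matchings of steps 4 to 7 *)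

Section Matchings.
Variables (R : realType) (k ns : nat) (A : 'M[bool]_ns) (B : 'cV[bool]_(k * ns)).
Hypotheses (k_gt0 : 0 < k) (ns_gt0 : 0 < ns).
Hypothesis sc : structurally_controllable R (full_composite k A) B.

Local Notation st := (state k ns).
Local Notation edge := (st * rnode k ns)%type.
Local Notation right := (option st + st)%type.
Implicit Types (x y z : st) (N : {set st}).

Lemma full_compositeE x y : full_composite k A (mxtens_index x) (mxtens_index y) =
  if x.1 == y.1 then A x.2 y.2 else true.
Proof. by rewrite mxE !mxtens_indexK. Qed.

Lemma input_exists : exists x, eU B x.
Proof.
have n0 : 0 < k * ns by rewrite muln_gt0 k_gt0.
apply/existsP; apply: contraT; rewrite negb_exists => /forallP no.
have := @controllable_accessible R _ _ _ sc xpred0 _ _ (Ordinal n0).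
apply=> // i; rewrite -(mxtens_unindexK i) => Bi.
by have := no (mxtens_unindex i); rewrite /eU Bi.
Qed.

(** With one subsystem the full composite system has no off-diagonal blocks, so its accessibility
    uses no interconnection. *)
Lemma single_accessible J x : k = 1 -> accessible A B J x.
Proof.
move=> k1; rewrite -(mxtens_indexK x).
apply: (@controllable_accessible R _ _ _ sc
  (fun i => accessible A B J (mxtens_unindex i))) => [i Bi|i j Aij aj].
  apply: connect1; rewrite arc_Some; apply/orP; left.
  by rewrite /= /eU mxtens_unindexK.
apply: connect_trans aj (connect1 _); rewrite arc_Some; apply/orP; left.
have one : forall a b : 'I_k, a = b.
  by rewrite k1 => a b; rewrite !ord1.
move: Aij; rewrite -{1}(mxtens_unindexK i) -{1}(mxtens_unindexK j) full_compositeE.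
set x' := mxtens_unindex i; set y' := mxtens_unindex j.
by rewrite (one x'.1 y'.1) eqxx /= /eX (one y'.1 x'.1) eqxx.
Qed.

Variable m : st -> option right.
Hypothesis greedy_m : greedy (admits A B) (@rank k ns) (k * ns).*2.+1 m.

Let m_match : pmatching (admits A B) m. Proof. by case: greedy_m. Qed.

(** These are the left nodes matched in M'. *)
Definition direct x : bool := if m x is Some (inl _) then true else false.

Definition used : {set st} := [set y | [exists x, m x == Some (inl (Some y))]].

Lemma usedP y : reflect (exists x, m x = Some (inl (Some y))) (y \in used).
Proof. by rewrite inE; apply: (iffP existsP) => -[x mx]; exists x; exact/eqP. Qed.

Lemma rank_direct (r : right) :
  (rank r < (k * ns).+1) = if r is inl _ then true else false.
Proof.
case: r => [[y|]|y] //=; first by rewrite ltnS idx_lt.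
by rewrite ltnNge leq_addr.
Qed.

Lemma matched_direct :
  matched m (fun r => rank r < (k * ns).+1) = [set x | direct x].
Proof.
apply/setP => x; rewrite !inE /direct; case: (m x) => [r|] //=.
by rewrite rank_direct; case: r.
Qed.

Lemma direct_max m' : pmatching (admits A B) m' ->
  #|[set x | if m' x is Some (inl _) then true else false]| <= #|[set x | direct x]|.
Proof.
move=> pm'; case: greedy_m => _ _ _ /(_ (k * ns).+1 m') H.
rewrite -matched_direct; apply: leq_trans (H _ pm'); last first.
  by rewrite ltnS -addnn leq_addr.
apply: subset_leq_card; apply/subsetP => x; rewrite !inE.
case: (m' x) => [r|] //=; rewrite rank_direct; by case: r.
Qed.

(** Compare, at threshold 1, with a matching that consists of one edge at the input. *)
Lemma input_matched : exists x, m x = Some (inl None).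
Proof.
have [x0 Bx0] := input_exists.
pose m' x : option right := if x == x0 then Some (inl None) else None.
case: greedy_m => _ _ _ /(_ 1 m' isT) H.
have /H : pmatching (admits A B) m'.
  split=> [x r|x y r]; rewrite /m'; case: eqP => // -> //; first by case=> <-.
  by case: eqP => // ->.
move=> le1; have : 0 < #|matched m (fun r => rank r < 1)|.
  apply: leq_trans le1; apply/card_gt0P; exists x0.
  by rewrite inE /m' eqxx.
case/card_gt0P => x /matchedP[[[y|]|y] // mx _].
by exists x.
Qed.

Lemma free_multi x : ~~ direct x -> 1 < k.
Proof.
rewrite ltnNge; apply: contra => k1.
have {}k1 : k = 1 by apply/eqP; rewrite eqn_leq k1.
have one : forall a b : 'I_k, a = b.
  by rewrite k1 => a b; rewrite !ord1.
have [f fi fP] := controllable_matching sc.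
pose m' x : option right := Some (inl (omap (@mxtens_unindex k ns) (f (mxtens_index x)))).
have pm' : pmatching (admits A B) m'.
  split=> [y r [<-] /=|y z r [Ey] [Ez]].
    have := fP (mxtens_index y); case: (f _) => [j|] //=.
    rewrite -{1}(mxtens_unindexK j) full_compositeE; set j' := mxtens_unindex j.
    by rewrite (one y.1 j'.1) eqxx /eX (one j'.1 y.1) eqxx.
  have : omap (@mxtens_unindex k ns) (f (mxtens_index y)) =
         omap (@mxtens_unindex k ns) (f (mxtens_index z)) by apply: (@inl_inj _ st); rewrite Ey.
  move/(inj_omap (can_inj (@mxtens_unindexK k ns)))/fi.
  exact: can_inj (@mxtens_indexK k ns) _ _.
have := direct_max pm'.
have -> : [set x | if m' x is Some (inl _) then true else false] = setT.
  by apply/setP => y; rewrite !inE.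
move=> le; have : [set x | direct x] = setT.
  by apply/eqP; rewrite eqEcard subsetT le.
by move/setP/(_ x); rewrite !inE.
Qed.

(* Otherwise the matching inside subsystem [i'], copied to subsystem [i], would
   be larger than the one inside [i]. *)
Lemma free_le_unused i i' : i != i' ->
  #|[set x : st | (x.1 == i) && ~~ direct x]| <=
  #|[set y : st | (y.1 == i') && (y \notin used)]|.
Proof.
move=> ii'.
(* The input edge is not copied, because u_1 can be matched only once. *)
pose m' x : option right :=
  if x.1 == i then
    if m (i', x.2) is Some (inl (Some y)) then Some (inl (Some (i, y.2))) else None
  else if m x is Some (inl v) then Some (inl v) else None.
have m_sub x y : m x = Some (inl (Some y)) -> y.1 = x.1.
  by move/m_match.1 => /= /andP[/eqP].
have st_eq (a b : st) : a.1 = b.1 -> a.2 = b.2 -> a = b.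
  by case: a b => ? ? [? ?] /= -> ->.
have pm' : pmatching (admits A B) m'.
  split=> [x r|x y r]; rewrite /m'.
    case: eqP => [xi|_].
      case mx: (m _) => [[[y|]|y]|] // [<-] /=.
      by have := m_match.1 _ _ mx; rewrite /= /eX /= xi eqxx => /andP[].
    by case mx: (m x) => [[v|y]|] // [<-]; apply: m_match.1 mx.
  case: eqP => [xi|xi].
    case mx: (m _) => [[[x'|]|x']|] // [<-]; case: eqP => [yi|yi].
      case my: (m _) => [[[y'|]|y']|] // [Ey].
      have Ex' : x' = y'.
        by apply: st_eq; rewrite ?(m_sub _ _ mx) ?(m_sub _ _ my) ?Ey.
      have [Exy] := m_match.2 _ _ _ mx (etrans my (congr1 (fun v => Some (inl (Some v))) (esym Ex'))).
      by apply: st_eq; rewrite ?xi ?yi ?Exy.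
    case my: (m _) => [[v|y']|] // [Ev]; move: my; rewrite Ev => /m_sub /= E.
    by case: yi.
  case mx: (m x) => [[v|x']|] // [<-]; case: eqP => [yi|yi].
    case my: (m _) => [[[y'|]|y']|] // [Ev]; move: mx; rewrite -Ev => /m_sub /= E.
    by case: xi.
  case my: (m y) => [[w|y']|] // [Ew].
  by apply: m_match.2 mx _; rewrite my Ew.
have := direct_max pm'.
rewrite -(cardsID [set x : st | x.1 == i] [set x | direct x]).
rewrite -(cardsID [set x : st | x.1 == i] 
  [set x | if m' x is Some (inl _) then true else false]).
have -> : [set x | if m' x is Some (inl _) then true else false] :\: [set x : st | x.1 == i] =
          [set x | direct x] :\: [set x : st | x.1 == i].
  apply/setP => x; rewrite !inE /m' /direct; case: eqP => //= _.
  by case: (m x) => [[]|].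
rewrite leq_add2r => le.
have cls (j : 'I_k) : #|[set x : st | x.1 == j]| = ns.
  have -> : [set x : st | x.1 == j] = [set (j, p) | p : 'I_ns].
    apply/setP => -[a p]; rewrite inE /=; apply/eqP/imsetP => [->|[q _ [-> _]]//].
    by exists p.
  by rewrite card_imset ?card_ord // => p q [].
have -> : [set x : st | (x.1 == i) && ~~ direct x] =
          [set x : st | x.1 == i] :\: [set x | direct x].
  by apply/setP => x; rewrite !inE andbC.
have -> : [set y : st | (y.1 == i') && (y \notin used)] =
          [set y : st | y.1 == i'] :\: used.
  by apply/setP => y; rewrite !inE andbC.
(* Both subsystems have [ns] states, so it remains to inject the used states of [i'] into the left
   nodes of [i] matched by [m']; [g] does this. *)
rewrite !cardsD !cls; apply: leq_sub2l.
rewrite (setIC [set x : st | x.1 == i]); apply: leq_trans le.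
pose g y : st := (i, (odflt y [pick x | m x == Some (inl (Some y))]).2).
have gP y : y \in [set y : st | y.1 == i'] :&: used ->
    m (i', (g y).2) = Some (inl (Some y)).
  rewrite in_setI inE => /andP[/eqP yi /usedP[x mx]]; rewrite /g.
  case: pickP => [[a p] /= /eqP my|no]; last by have := no x; rewrite mx eqxx.
  by rewrite -yi (m_sub _ _ my).
have <- : #|g @: ([set y : st | y.1 == i'] :&: used)| =
    #|[set y : st | y.1 == i'] :&: used|.
  apply: card_in_imset => y z yS zS gyz.
  by have := gP y yS; rewrite gyz gP // => -[].
apply: subset_leq_card; apply/subsetP => _ /imsetP[y yS ->].
by rewrite !inE /m' eqxx gP.
Qed.

Lemma ordS_neq x : ~~ direct x -> x.1 != ordS x.1.
Proof.
move=> fx; have k1 := free_multi fx; rewrite -val_eqE /=.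
have lt := ltn_ord x.1; case: (eqVneq x.1.+1 k) => [Ek|ne].
  by rewrite Ek modnn -lt0n -ltnS Ek.
rewrite modn_small; first by rewrite neq_ltn ltnSn.
by rewrite ltn_neqAle ne.
Qed.

(** [D] is the set of left nodes served so far. As [ordS] is injective, only those in the subsystem
    of [x] compete with [x], and [x] itself is not yet among them, which makes the count strict. *)
Lemma assign_exists (D : {set st}) (f : st -> st) x :
  (forall x', x' \in D -> ~~ direct x' /\ (f x').1 = ordS x'.1) ->
  ~~ direct x -> x \notin D ->
  exists y, [/\ y.1 = ordS x.1, y \notin used & y \notin f @: D].
Proof.
move=> DP fx xD.
have xi := ordS_neq fx.
have := free_le_unused xi; set U := [set y | _ & _ \notin used] => le.
pose D' := [set x' in D | x'.1 == x.1].
have lt : #|f @: D'| < #|U|.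
  apply: leq_ltn_trans (leq_imset_card _ _) _; apply: leq_trans le.
  apply: proper_card; apply/properP; split.
    by apply/subsetP => x'; rewrite !inE => /andP[/DP[-> _] ->].
  by exists x; rewrite inE ?eqxx // negb_and xD.
have /subsetPn[y yU yD] : ~~ (U \subset f @: D').
  by apply: contraL lt => /subset_leq_card; rewrite -leqNgt.
move: yU; rewrite inE => /andP[/eqP yi yu]; exists y; split=> //.
apply: contra yD => /imsetP[x' x'D yx']; apply/imsetP; exists x' => //.
rewrite inE x'D /=; have [_] := DP _ x'D; rewrite -yx' yi => E.
by apply/eqP/esym; apply: (@ordS_inj k).
Qed.

Variable f : st -> st.
Hypothesis f_next : forall x, ~~ direct x -> (f x).1 != x.1.
Hypothesis f_unused : forall x, ~~ direct x -> f x \notin used.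
Hypothesis f_inj : {in [pred x | ~~ direct x] &, injective f}.

(** A left node matched to an SCC keeps that partner here but gets [f x] in [tilde_of]; an unmatched
    one gets [f x] in both. *)
Definition star_of x : rnode k ns :=
  if m x is Some r then rnode_of A r else rstate (f x).

Definition tilde_of x : option st :=
  if m x is Some (inl v) then v else Some (f x).

Lemma tilde_direct x : direct x -> m x = Some (inl (tilde_of x)).
Proof. by rewrite /direct /tilde_of; case: (m x) => [[]|]. Qed.

Lemma tilde_free x : ~~ direct x -> tilde_of x = Some (f x).
Proof. by rewrite /direct /tilde_of; case: (m x) => [[]|]. Qed.

Lemma tilde_inj : injective tilde_of.
Proof.
move=> x y; have [dx|dx] := boolP (direct x); have [dy|dy] := boolP (direct y).
- move=> E; apply: (m_match.2 x y _ (tilde_direct dx)).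
  by rewrite E (tilde_direct dy).
- rewrite (tilde_free dy) => E; case/negP: (f_unused dy); apply/usedP; exists x.
  by rewrite tilde_direct // E.
- rewrite (tilde_free dx) => E; case/negP: (f_unused dx); apply/usedP; exists y.
  by rewrite tilde_direct // -E.
- by rewrite !tilde_free // => -[]; apply: f_inj.
Qed.

Lemma tilde_input : exists x, tilde_of x = None.
Proof. by have [x mx] := input_matched; exists x; rewrite /tilde_of mx. Qed.

Definition allowed (v : option st) x : bool :=
  feeds A B v x || (if v is Some y then y.1 != x.1 else false).

Lemma tilde_allowed x : allowed (tilde_of x) x.
Proof.
rewrite /allowed; have [dx|dx] := boolP (direct x).
  by have /= -> := m_match.1 x _ (tilde_direct dx).
by rewrite tilde_free //= f_next ?orbT.
Qed.

Lemma star_compatible : compatible A B m star_of.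
Proof.
move=> x; rewrite /star_of; case mx: (m x) => [r|].
  by split=> //; apply: m_match.1 mx.
exists (f x) => //; rewrite /eX (negbTE (f_next _)) //.
by rewrite /direct mx.
Qed.

Lemma rnode_of_inj x y r s : m x = Some r -> m y = Some s ->
  rnode_of A r = rnode_of A s -> r = s.
Proof.
move=> /m_match.1 + /m_match.1; case: r s => [v|x'] [w|y'] //=; first by move=> _ _ [->].
move=> /andP[rx _] /andP[ry _] [E].
by rewrite (isrep_inj rx ry E).
Qed.

Lemma star_inj : injective star_of.
Proof.
move=> x y; rewrite /star_of.
have free z : m z = None -> ~~ direct z by rewrite /direct => ->.
case mx: (m x) => [r|]; case my: (m y) => [s|].
- by move/(rnode_of_inj mx my) => rs; apply: m_match.2 mx _; rewrite rs.
- case: r mx => //= v mx [E]; case/negP: (f_unused (free y my)).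
  by apply/usedP; exists x; rewrite mx E.
- case: s my => //= v my [E]; case/negP: (f_unused (free x mx)).
  by apply/usedP; exists y; rewrite my -E.
- by case=> E; apply: f_inj; rewrite ?inE ?free.
Qed.

Lemma star_bedges x : (x, star_of x) \in bedges (bipN A B).
Proof.
have := star_compatible x; rewrite !inE /star_of /=.
case mx: (m x) => [r|]; last by rewrite /= f_next ?orbT // /direct mx.
by case: r {mx} => [[y|]|y] [_ /=] => [->|->|/andP[/andP[Ny _] ->]] //;
  rewrite ?andbT -?/(inN A B y) ?Ny ?orbT.
Qed.

Lemma star_min_cost : min_cost_perfect_matching (bipN A B) (cost A B) (gset star_of).
Proof.
split.
  split; first exact: gset_matching star_bedges star_inj.
  by rewrite card_gset cardsT card_st (minn_idPl (ltnW (card_rnodes A B))).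
move=> _ /perfect_compatible[m' [g [-> gi mg]]].
pose c (m : st -> option right) j := #|matched m (fun r : right => rank r < j)|.
have H j : j <= (k * ns).*2.+1 -> c m' j <= c m j.
  by move=> jn; case: greedy_m => _ _ _; apply=> //; apply: compatible_pmatching mg gi.
have E1 : matching_cost (cost A B) (gset star_of) + c m 1 + c m (k * ns).+1
  + c m (k * ns).*2.+1 = 3 * (k * ns) := cost_compatible star_compatible.
have E2 : matching_cost (cost A B) (gset g) + c m' 1 + c m' (k * ns).+1
  + c m' (k * ns).*2.+1 = 3 * (k * ns) := cost_compatible mg.
have H1 := H 1 isT; have H2 := H _ (leqnn _).
have {}H : c m' (k * ns).+1 <= c m (k * ns).+1.
  by apply: H; rewrite ltnS -addnn leq_addr.
move: (matching_cost _ (gset star_of)) (matching_cost _ (gset g)) E1 E2 H H1 H2.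
move: (c m 1) (c m (k * ns).+1) (c m (k * ns).*2.+1) => a1 a2 a3.
move: (c m' 1) (c m' (k * ns).+1) (c m' (k * ns).*2.+1) => b1 b2 b3.
move: (3 * (k * ns)) => d a b; lia.
Qed.

(** This is M''. *)
Definition second : {set edge} :=
  [set e | ~~ direct e.1 & e.2 == rstate (f e.1)].

Lemma star_direct : gset star_of :&: (EX k A :|: EU B) =
  [set e | direct e.1 & e.2 == inl (tilde_of e.1)].
Proof.
apply/setP => -[x r]; rewrite !inE /=.
have := star_compatible x; rewrite /star_of /tilde_of /direct.
case mx: (m x) => [[v|y]|] /=.
- case: eqP => [->|] //=; by case: v {mx} => [y|] /= [_ ->].
- by case: eqP => [->|].
- case: eqP => [->|] //= [y [->] /negbTE ->].
  by [].
Qed.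

Lemma tilde_split : gset (fun x => inl (tilde_of x)) =
  gset star_of :&: (EX k A :|: EU B) :|: second.
Proof.
rewrite star_direct; apply/setP => -[x r]; rewrite !inE /=.
have [dx|dx] := boolP (direct x); rewrite /= ?orbF //.
by rewrite tilde_free.
Qed.

(** All left nodes remaining after M' are covered, and [f] sends them to distinct remaining right
    nodes, so the left side is the smaller one. *)
Lemma second_perfect : perfect_matching
  (delete_matched (bip A B) (gset star_of :&: (EX k A :|: EU B))) second.
Proof.
rewrite star_direct; set Mp := [set e | _ & _].
set l := setT :\: [set e.1 | e in Mp].
have lE x : (x \in l) = ~~ direct x.
  rewrite !inE andbT; congr (~~ _); apply/imsetP/idP => [[e eM ->]|dx].
    by move: eM; rewrite inE => /andP[].
  by exists (x, inl (tilde_of x)); rewrite ?inE /= ?dx ?eqxx.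
set r := rnodes (bip A B) :\: [set e.2 | e in Mp].
have fr x : ~~ direct x -> rstate (f x) \in r.
  move=> dx; rewrite !inE andbT; apply/imsetP => -[[y s]]; rewrite inE /=.
  move=> /andP[dy /eqP ->] [E]; case/negP: (f_unused dx); apply/usedP; exists y.
  by rewrite tilde_direct // E.
have sE : second = [set (x, rstate (f x)) | x in l].
  apply/setP => -[x s]; rewrite inE /=; apply/andP/imsetP.
    by move=> [dx /eqP ->]; exists x; rewrite ?lE.
  by move=> [y yl [-> ->]]; rewrite -lE yl.
have cs : #|second| = #|l| by rewrite sE card_imset // => x y [].
split; last first.
  rewrite cs; apply/esym/minn_idPl.
  have <- : #|[set rstate (f x) | x in l]| = #|l|.
    by apply: card_in_imset => x y; rewrite !lE => xl yl [E]; apply: f_inj.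
  apply: subset_leq_card; apply/subsetP => _ /imsetP[x xl ->].
  by apply: fr; rewrite -lE.
split.
  apply/subsetP => -[x s]; rewrite inE /= => /andP[dx /eqP ->].
  rewrite inE -/l -/r lE dx fr // !inE /= andbT.
  by rewrite f_next ?orbT.
move=> [x s] [y u]; rewrite !inE /= => /andP[dx /eqP ->] /andP[dy /eqP ->].
case=> [->//|[E]]; by rewrite (f_inj _ _ E) ?inE.
Qed.

End Matchings.

(** * The while loop and the last interconnections *)

Section Dynamics.
Variables (k ns : nat) (A : 'M[bool]_ns) (B : 'cV[bool]_(k * ns)).

Local Notation st := (state k ns).
Local Notation edge := (st * rnode k ns)%type.
Implicit Types (x y z a b : st) (c : st -> option st).

Definition edges c : {set edge} := gset (fun x => inl (c x)).

Definition links c : {set st * st} := interconnections (edges c).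

(** The loop invariant: n_T left nodes are injected into the n_T states and u_1, with u_1 among the
    values, so exactly one state stays unmatched. *)
Definition valid c : Prop :=
  [/\ injective c, exists x, c x = None & forall x, allowed A B (c x) x].

Lemma mem_EI x y : ((x, rstate y) \in EI k ns) = (y.1 != x.1).
Proof. by rewrite inE. Qed.

Lemma mem_edges c x v : ((x, inl v) \in edges c) = (c x == v).
Proof.
by rewrite inE /= (inj_eq (f := inl)) 1?eq_sym // => ? ? [].
Qed.

Lemma mem_links c x y : ((x, y) \in links c) = (c y == Some x) && (x.1 != y.1).
Proof. by rewrite inE in_setI mem_edges mem_EI. Qed.

(** By [allowed], a matching edge inside a subsystem is already an edge of its digraph, so every
    matching edge is an arc. *)
Lemma arc_links c v x : valid c ->
  arc A B (links c) v (Some x) = feeds A B v x || (c x == v).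
Proof.
move=> [_ _ /(_ x) al]; rewrite arc_Some; case: v => [y|].
  rewrite mem_links; case: eqP => [cx|]; last by rewrite orbF.
  by move: al; rewrite cx /allowed /=; case: eX => //= ->.
by case: eqP => [cx|//]; move: al; rewrite cx /allowed /= orbF => ->.
Qed.

Lemma unmatchedE c z :
  (rstate z \notin [set e.2 | e in edges c]) = [forall y, c y != Some z].
Proof.
apply/idP/forallP => [no y|no].
  apply: contra no => cy; apply/imsetP; exists (y, rstate z) => //.
  by rewrite mem_edges.
apply/imsetP => -[[y r] + /= zr]; rewrite -zr mem_edges.
exact/negP.
Qed.

Lemma unmatched_unique c z z' : injective c -> (exists x, c x = None) ->
  (forall y, c y != Some z) -> (forall y, c y != Some z') -> z = z'.
Proof.
move=> ci _ nz nz'; apply/eqP; apply: contraT => zz'.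
have : c @: setT \subset ~: [set Some z; Some z'].
  by apply/subsetP => _ /imsetP[y _ ->]; rewrite !inE negb_or nz nz'.
move/subset_leq_card; rewrite card_imset // cardsT card_st cardsCs setCK.
rewrite cards2 card_ost.
have -> : Some z != Some z' by apply: contra zz' => /eqP[->].
have : 0 < k * ns by rewrite -card_st; apply/card_gt0P; exists z.
lia.
Qed.

(** If every accessible vertex, u_1 included, were matched, their partners would be as many; but
    these partners are accessible states, and there is one fewer of those than accessible
    vertices. *)
Lemma unmatched_accessibleP c : valid c ->
  exists z, [/\ unmatched_accessible A B (edges c) z,
    forall y, c y != Some z & accessible A B (links c) z].
Proof.
move=> vc; have [ci c0 al] := vc.
pose Acc := [set v | connect (arc A B (links c)) None v].
have [z [zA zc]] : exists z, Some z \in Acc /\ forall y, c y != Some z.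
  have [/subsetP sub|/subsetPn[[z|] zA zc]] := boolP (Acc \subset codom c).
  - pose P := [set x | c x \in Acc].
    have : #|Acc| <= #|P|.
      rewrite -(card_imset (mem P) ci); apply: subset_leq_card.
      apply/subsetP => v vA; have /codomP[x vx] := sub v vA.
      by apply/imsetP; exists x; rewrite // inE -vx.
    have sP : Some @: P \subset Acc :\ None.
      apply/subsetP => _ /imsetP[x xP ->]; rewrite in_setD1 /= inE.
      move: xP; rewrite !inE => cx; apply: connect_trans cx (connect1 _).
      by rewrite arc_links // eqxx orbT.
    have := subset_leq_card sP; rewrite card_imset; last by move=> ? ? [].
    rewrite (cardsD1 None Acc).
    by rewrite inE connect0 add1n => a1 /(leq_trans)/(_ a1); rewrite ltnn.
  - exists z; split=> // y; apply: contra zc => /eqP <-; exact: codom_f.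
  - by case: c0 zc => x <-; rewrite codom_f.
have az : accessible A B (links c) z by move: zA; rewrite inE.
exists z; split=> //; split.
  by split=> //; rewrite unmatchedE; apply/forallP.
move=> z' []; rewrite unmatchedE => /forallP zc' _.
exact: unmatched_unique zc zc'.
Qed.

(* Membership in V_N' for \tilde M = [edges c]. *)
Definition waiting c x : bool :=
  [&& (if c x is Some y then y.1 != x.1 else false), inN A B x
    & ~~ accessible A B (links c) x].

Lemma VN'E c : VN' A B (edges c) = [set x | waiting c x].
Proof.
apply/setP => x; rewrite [LHS]inE [RHS]inE /waiting; congr (_ && _).
  apply/existsP/idP => [[y]|].
    by rewrite in_setI mem_edges mem_EI => /andP[/eqP ->].
  case cx: (c x) => [y|] // xy; exists y.
  by rewrite in_setI mem_edges mem_EI cx eqxx.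
apply/exists_inP/andP => [[N]|[Nx ax]].
  rewrite inE => /andP[NN aN] xN; have NE := inN_mem NN xN.
  by rewrite /inN -NE NN -(scc_accessibleE _ _ _ x) -NE.
exists (scc A x); last exact: mem_scc.
by rewrite inE -/(inN A B x) Nx scc_accessibleE.
Qed.

Definition redirect c a z : st -> option st :=
  fun x => if x == a then Some z else c x.

Lemma edges_redirect c a b z : c a = Some b ->
  edges (redirect c a z) = swap (edges c) (a, rstate b) (a, rstate z).
Proof.
move=> ca; apply/setP => -[x [v|N]]; last first.
  by rewrite !inE /= xpair_eqE /= !andbF.
rewrite mem_edges /swap in_setU1 in_setD1 mem_edges /redirect !xpair_eqE.
have inlE (u w : option st) : (inl u == inl w :> rnode k ns) = (u == w) by [].
rewrite !inlE; case: (eqVneq x a) => [->|_] //=.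
by rewrite ca [Some b == v]eq_sym andNb orbF eq_sym.
Qed.

Section Redirect.
Variables (c : st -> option st) (a b z : st).
Hypotheses (vc : valid c) (ca : c a = Some b) (z_free : forall y, c y != Some z).
Hypothesis az : a.1 != z.1.

Lemma redirect_valid : valid (redirect c a z).
Proof.
have [ci [x0 cx0] al] := vc; split.
- move=> x y; rewrite /redirect; case: eqP => [->|_]; case: eqP => [->|_] //.
  + by move=> E; have := z_free y; rewrite -E eqxx.
  + by move=> E; have := z_free x; rewrite E eqxx.
  + exact: ci.
- by exists x0; rewrite /redirect; case: eqP => // E; move: cx0; rewrite E ca.
- move=> x; rewrite /redirect; case: eqP => [->|_] //.
  by rewrite /allowed eq_sym az orbT.
Qed.

Hypothesis b_far : ~~ accessible A B (links c) b.

(** The removed edge starts at the inaccessible [b], so no path from u_1 used it. *)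
Lemma redirect_mono x : accessible A B (links c) x ->
  accessible A B (links (redirect c a z)) x.
Proof.
rewrite /accessible; case/connectP => p; elim/last_ind: p x => [|p v IH] x //=.
rewrite rcons_path last_rcons => /andP[pp pv] xv; rewrite -{}xv in pv.
have c1 : connect (arc A B (links c)) None (last None p).
  by apply/connectP; exists p.
have c2 : connect (arc A B (links (redirect c a z))) None (last None p).
  case E: (last None p) => [y|]; last exact: connect0.
  by apply: IH pp (esym E).
apply: connect_trans c2 (connect1 _); move: pv.
rewrite (arc_links _ _ vc) (arc_links _ _ redirect_valid) /redirect.
case/orP => [->//|/eqP cx]; case: (eqVneq x a) => [xa|_]; last by rewrite cx eqxx orbT.
by case/negP: b_far; move: c1; rewrite -cx xa ca.
Qed.

(** After the redirection [b] is the unmatched state, and the unmatched state is always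
    accessible. *)
Lemma redirect_gain : accessible A B (links (redirect c a z)) b.
Proof.
have [z' [_ zc' az']] := unmatched_accessibleP redirect_valid.
suff -> : b = z' by [].
have [ri r0 _] := redirect_valid; apply: (unmatched_unique ri r0) zc' => y.
have [ci _ _] := vc; rewrite /redirect; case: (eqVneq y a) => [_|/eqP ya].
  by apply/eqP => -[zb]; have := z_free a; rewrite ca zb eqxx.
by apply/eqP => cy; case: ya; apply: ci; rewrite cy.
Qed.

Lemma redirect_card :
  #|[set x | accessible A B (links c) x]| <
  #|[set x | accessible A B (links (redirect c a z)) x]|.
Proof.
apply: proper_card; apply/properP; split.
  by apply/subsetP => x; rewrite !inE; apply: redirect_mono.
by exists b; rewrite inE ?redirect_gain.
Qed.

End Redirect.

Lemma matched_far c x y : valid c -> c x = Some y ->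
  ~~ accessible A B (links c) x -> ~~ accessible A B (links c) y.
Proof.
move=> vc cx; apply: contra => ay; apply: connect_trans ay (connect1 _).
by rewrite arc_links // cx eqxx orbT.
Qed.

(* [c] permutes the inaccessible states; if it mapped those of subsystem [y.1]
   into that subsystem, then [y] would have its preimage there, unlike [x]. *)
Lemma entering_edge c x y : valid c -> c x = Some y -> y.1 != x.1 ->
  ~~ accessible A B (links c) x ->
  exists a b, [/\ a.1 = y.1, c a = Some b, b.1 != y.1
    & ~~ accessible A B (links c) b].
Proof.
move=> vc cx yx fx; have [ci _ al] := vc.
pose I := [set a | ~~ accessible A B (links c) a & a.1 == y.1].
have far_some a : ~~ accessible A B (links c) a -> exists b, c a = Some b.
  move=> fa; case ca: (c a) => [b|]; first by exists b.
  by case/negP: fa; apply: connect1; rewrite arc_links // ca eqxx orbT.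
have [H|/forall_inPn[a aI ha]] := boolP [forall a in I,
   if c a is Some b then b.1 == y.1 else true].
  have yI : y \in I by rewrite inE eqxx andbT; apply: matched_far vc cx fx.
  have : Some @: I \subset c @: I.
    have sub : c @: I \subset Some @: I.
      apply/subsetP => _ /imsetP[a aI ->].
      have fa : ~~ accessible A B (links c) a by move: aI; rewrite inE => /andP[].
      have [b cb] := far_some a fa; rewrite cb; apply: imset_f.
      have := forall_inP H a aI; rewrite cb inE => ->.
      by rewrite (matched_far vc cb fa).
    have/eqP -> // : c @: I == Some @: I.
    by rewrite eqEcard sub (card_imset _ ci) card_imset ?leqnn // => ? ? [].
  move/subsetP/(_ (Some y)); rewrite imset_f // => /(_ isT)/imsetP[a aI].
  by rewrite -cx => /ci xa; move: aI; rewrite -xa inE eq_sym (negbTE yx) andbF.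
move: aI; rewrite inE => /andP[fa /eqP ay].
have [b cb] := far_some a fa; rewrite cb in ha.
by exists a, b; split=> //; apply: matched_far vc cb fa.
Qed.

(** The redirected node [a] is x'^i_p in one branch and x'^j_s in the other, so both branches are
    instances of [redirect]. *)
Lemma loop_stepP c x y z a b : valid c -> waiting c x -> c x = Some y ->
  unmatched_accessible A B (edges c) z ->
  (if x.1 != z.1 then a = x /\ b = y else
   [/\ a.1 = y.1, b.1 != y.1 & c a = Some b]) ->
  loop_step A B (edges c) (edges (redirect c a z)).
Proof.
move=> vc wx cx uz ab; exists x, y, z; split=> //.
- by rewrite VN'E inE.
- by rewrite mem_edges cx.
case: ifP ab => _ [].
  by move=> -> _; apply: edges_redirect.
move=> ay byy ca; exists a, b; split=> //; first by rewrite mem_edges ca.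
exact: edges_redirect.
Qed.

Lemma accessible_mono (J J' : {set st * st}) x : J \subset J' ->
  accessible A B J x -> accessible A B J' x.
Proof.
move=> /subsetP JJ; apply: connect_sub => v [w|]; last by rewrite arc_None.
rewrite arc_Some => aw; apply: connect1; rewrite arc_Some.
case/orP: aw => [->//|]; case: v => // u /JJ ->; exact: orbT.
Qed.

Lemma connect_eX_sub x y : connect (eX A) x y -> x.1 = y.1.
Proof.
case/connectP => p; elim: p x => [|z p IH] x /=; first by move=> _ ->.
by move=> /andP[/andP[/eqP -> _] zp] ly; apply: IH.
Qed.

(** Take an ancestor of [x] with the fewest ancestors. *)
Lemma top_ancestor x : exists2 w, connect (eX A) w x &
  forall y, connect (eX A) y w -> connect (eX A) w y.
Proof.
pose anc (w : st) := [set y : st | connect (eX A) y w].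
case: (arg_minnP (P := fun w : st => connect (eX A) w x) (fun w => #|anc w|)
  (connect0 _ x)) => w wx wmin; exists w => // y yw.
have sub : anc y \subset anc w.
  by apply/subsetP => z; rewrite !inE => zy; apply: connect_trans zy yw.
have := wmin y (connect_trans yw wx) => le.
have : w \in anc w by rewrite inE connect0.
have /eqP <- : anc y == anc w by rewrite eqEcard sub.
by rewrite inE.
Qed.

Section Connect.
Variables (c : st -> option st) (x0 o : st) (ls : seq st).
Hypotheses (x0_in : eU B x0) (ls_uniq : uniq ls) (ls_all : forall x, x \in ls).
Hypothesis o_other :
  forall y, ~~ accessible A B set0 y -> o.1 != x0.1.

Definition pending y : bool := isrep A B y && ~~ accessible A B (links c) y.

(** An interconnection into the subsystem of [x0] cannot start at [x0], hence the second state
    [o]. *)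
Definition link y : st := if y.1 == x0.1 then o else x0.

Definition connectors : seq (st * st) :=
  [seq (y, link y) | y <- ls & pending y && (y.1 != x0.1)] ++
  [seq (y, link y) | y <- ls & pending y && (y.1 == x0.1)].

Lemma mem_connectors x y : ((x, y) \in connectors) = pending x && (y == link x).
Proof.
rewrite mem_cat; apply/orP/andP.
  by case=> /mapP[z]; rewrite mem_filter => /andP[/andP[pz _] _] [-> ->].
move=> [px /eqP ->]; case x0x: (x.1 == x0.1); [right|left];
  by apply/mapP; exists x; rewrite // mem_filter px x0x ls_all.
Qed.

Lemma pending_other y : pending y -> o.1 != x0.1.
Proof.
move=> /andP[_ fy]; apply: o_other (y) _; apply: contra fy.
exact/accessible_mono/sub0set.
Qed.

Lemma connectors_perm :
  perm_eq [seq scc A e.1 | e <- connectors] (enum (unreached A B (edges c))).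
Proof.
have P y : y \in [seq e.1 | e <- connectors] -> pending y.
  by case/mapP => -[x' y']; rewrite mem_connectors => /andP[px _] /= ->.
rewrite map_comp; apply: uniq_perm.
- rewrite map_inj_in_uniq; last first.
    move=> y z /P/andP[ry _] /P/andP[rz _]; exact: isrep_inj ry rz.
  rewrite map_cat -!map_comp !map_id cat_uniq !filter_uniq //= andbT.
  apply/hasPn => y; rewrite !mem_filter => /andP[/andP[_ ->] _].
  by rewrite andbF.
- exact: enum_uniq.
move=> N; rewrite mem_enum; apply/mapP/idP.
  move=> [y /P/andP[/andP[Ny _] fy] ->].
  by rewrite inE -/(inN A B y) Ny scc_accessibleE.
rewrite inE => /andP[NN fN]; have [y [yN Ny ry]] := isrep_exists NN.
exists y; last by rewrite Ny.
apply/mapP; exists (y, link y); rewrite // mem_connectors eqxx andbT.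
by rewrite /pending ry -(scc_accessibleE _ _ _ y) Ny.
Qed.

(** The point is that [o] is accessible once the first group is in place. A top ancestor [w] of [o]
    is either accessible without interconnections or lies in an SCC of N; the representative of that
    SCC is accessible through [links c] or was connected from [x0] in the first group. *)
Lemma connectors_connect : connect_unreached A B (edges c) connectors.
Proof.
split; first exact: connectors_perm.
move=> Q1 [y e2] Q2 E /=.
have : (y, e2) \in connectors by rewrite E mem_cat mem_head orbT.
rewrite mem_connectors => /andP[py /eqP ->]; rewrite /link.
have x0_acc J : accessible A B J x0.
  by apply: connect1; rewrite arc_Some /= x0_in.
case: ifPn => yx0; last by split.
have ox0 := pending_other py; rewrite (eqP yx0) eq_sym; split=> //.
set J' := _ :|: _.
have JJ : links c \subset J' by apply: subsetUl.
have [w wo wtop] := top_ancestor o.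
apply: (accessible_connect _ wo).
have [w0|w0] := boolP (accessible A B set0 w).
  exact: accessible_mono (sub0set _) w0.
have Nw : inN A B w.
  by rewrite inNE w0 andbT; apply/forallP => u; apply/implyP; apply: wtop.
have [r [rw _ rr]] := isrep_exists Nw.
move: rw; rewrite inE => /andP[wr rw]; apply: accessible_connect rw.
have [ra|ra] := boolP (accessible A B (links c) r).
  exact: accessible_mono JJ ra.
have r1 : r.1 != x0.1.
  by rewrite -(connect_eX_sub wr) (connect_eX_sub wo).
have pr : pending r by rewrite /pending rr.
apply: connect_trans (x0_acc J') (connect1 _).
rewrite arc_Some in_setU inE /=.
suff -> : (r, x0) \in Q1 by rewrite !orbT.
move: E; rewrite /connectors; set F := map _ _; set S := map _ _ => E.
have rF : (r, x0) \in F.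
  by apply/mapP; exists r; rewrite /link ?(negbTE r1) // mem_filter pr r1 ls_all.
(* The current edge enters the subsystem of [x0], so it is not in the first group [F], and all of
   [F] precedes it. *)
have le : size F <= size Q1.
  rewrite leqNgt; apply/negP => lt.
  have : nth (x0, x0) (F ++ S) (size Q1) = (y, e2) by rewrite E nth_cat ltnn subnn.
  rewrite nth_cat lt => yF; have := mem_nth (x0, x0) lt; rewrite yF.
  by case/mapP => u; rewrite mem_filter => /andP[/andP[_ un] _] [yu _];
    case/negP: un; rewrite -yu.
have := congr1 (take (size F)) E; rewrite take_size_cat // takel_cat // => FE.
by rewrite FE in rF; apply: mem_take rF.
Qed.

Lemma mem_IA x y : ((x, y) \in links c :|: [set a | (a.2, a.1) \in connectors]) =
  (c y == Some x) && (x.1 != y.1) || pending y && (x == link y).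
Proof. by rewrite in_setU mem_links inE mem_connectors. Qed.

End Connect.

End Dynamics.

(** * The program *)

(** The product n_T is obtained by repeated addition, as the machine has no multiplication. *)
Definition Size :=
  PSeq (PAssign v_n (Const 0))
  (PSeq (PFor v_i v_k (PAssign v_n (Add (Var v_n) (Var v_ns))))
  (PSeq (PAssign v_n1 (Add (Var v_n) (Const 1)))
        (PAssign v_n2 (Add (Var v_n) (Var v_n1))))).

(** These tables replace the quotient and remainder of a row by [ns]. *)
Definition Coordinates :=
  PSeq (PAssign v_x (Const 0))
  (PFor v_i v_k (PFor v_j v_ns
     (PSeq (PPut a_sub (Const 0) (Var v_x) (Var v_i))
     (PSeq (PPut a_pos (Const 0) (Var v_x) (Var v_j))
           (PAssign v_x (Add (Var v_x) (Const 1))))))).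

(** Rows are numbered by right nodes: states, then the input in row n_T, then SCCs, added by
    [Components]. The zero row 2 n_T + 1 belongs to the marker of a free left node. *)
Definition Adjacency :=
  PSeq (Fill2 a_adj (Const 0) v_i v_n v_j v_n
         (And (Eq (at0 a_sub (Var v_i)) (at0 a_sub (Var v_j)))
              (Get a_A (at0 a_pos (Var v_j)) (at0 a_pos (Var v_i)))))
  (PSeq (Fill a_adj (Var v_n) v_j v_n (Const 1) (Get a_B (Var v_j) (Const 0)) (Const 0))
        (Fill a_adj (Var v_n2) v_j v_n (Const 1) (Const 0) (Const 0))).

Definition Closure :=
  PSeq (Fill2 a_G (Const 0) v_i v_n1 v_j v_n1
         (And (Lt (Var v_j) (Var v_n)) (Get a_adj (Var v_i) (Var v_j))))
  (PFor v_x v_n1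
     (PSeq (PAssign v_src (Var v_x))
     (PSeq Search
           (Fill a_reach (Var v_x) v_j v_n1 (Const 1) (at0 a_vis (Var v_j)) (Const 0))))).

(** [Find] looks for a violation of the first half of [inNE]; the result n_T says that there is
    none. *)
Definition MarkN :=
  PFor v_x v_n
    (PSeq (Find v_f v_i v_n
             (And (Get a_reach (Var v_i) (Var v_x))
                  (Not (Get a_reach (Var v_x) (Var v_i)))))
          (PPut a_inN (Const 0) (Var v_x)
             (And (Eq (Var v_f) (Var v_n)) (Not (Get a_reach (Var v_n) (Var v_x)))))).

Definition MarkRep :=
  PFor v_x v_n
    (PSeq (Find v_f v_i v_n
             (And (And (Get a_reach (Var v_i) (Var v_x))
                       (Get a_reach (Var v_x) (Var v_i)))
                  (Lt (Var v_x) (Var v_i))))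
          (PPut a_rep (Const 0) (Var v_x)
             (And (Eq (Var v_f) (Var v_n)) (at0 a_inN (Var v_x))))).

Definition Components :=
  PSeq MarkN
  (PSeq MarkRep
     (Fill2 a_adj (Var v_n1) v_i v_n v_j v_n
        (And (at0 a_rep (Var v_i))
             (And (Get a_reach (Var v_i) (Var v_j))
                  (Get a_reach (Var v_j) (Var v_i)))))).

(** * Correctness of the tables for adjacency, reachability and N *)

Section Preprocessing.
Variables (k ns : nat) (A : 'M[bool]_ns) (B : 'cV[bool]_(k * ns)).

Local Notation st := (state k ns).
Local Notation ost := (option st).
Local Notation right := (option st + st)%type.
Local Notation n := (k * ns).
Implicit Types (x y z : st) (v w : option st) (s : memory).

Definition sizes s : Prop :=
  [/\ scalar s v_n = n, scalar s v_n1 = n.+1 & scalar s v_n2 = n.*2.+1].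

Definition base s : Prop :=
  [/\ holds_input A B s, sizes s,
      forall x, array s a_sub 0 (idx x) = x.1
    & forall x, array s a_pos 0 (idx x) = x.2].

Lemma sizes_run p s : ~~ has (fun a => a \in [:: v_n; v_n1; v_n2]) (modS p) ->
  sizes s -> sizes (run p s).
Proof.
move=> /hasPn H [H1 H2 H3].
by split; rewrite scalar_run //; apply/negP => /H; rewrite !inE.
Qed.

Lemma base_run p s :
  ~~ has (fun a => a \in [:: v_k; v_ns; v_n; v_n1; v_n2]) (modS p) ->
  ~~ has (fun a => a \in [:: a_A; a_B; a_sub; a_pos]) (modA p) ->
  base s -> base (run p s).
Proof.
move=> /hasPn HS /hasPn HA [[E1 E2 E3 E4] [H1 H2 H3] H4 H5].
split; last 2 first.
- by move=> x; rewrite array_run //; apply/negP => /HA; rewrite !inE.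
- by move=> x; rewrite array_run //; apply/negP => /HA; rewrite !inE.
- split; [| |move=> i j|move=> r]; rewrite ?scalar_run ?array_run //;
    apply/negP => H; by [have := HS _ H|have := HA _ H].
- by split; rewrite scalar_run //; apply/negP => /HS; rewrite !inE.
Qed.

Lemma size_run s : scalar s v_k = k -> scalar s v_ns = ns ->
  sizes (run Size s) /\ (scalar (run Size s) v_k = k /\ scalar (run Size s) v_ns = ns).
Proof.
move=> Hk Hns; split; last by rewrite !scalar_run.
pose s0 := set_scalar s v_n 0.
pose s1 := run (PFor v_i v_k (PAssign v_n (Add (Var v_n) (Var v_ns)))) s0.
have Hn : scalar s1 v_n = n.
  rewrite -{1}Hk; change (scalar s v_k) with (scalar s0 v_k).
  apply: (@for_invariant v_i v_k _ s0 (fun j s' => scalar s' v_n = j * ns)) => //.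
  move=> j s' _ _ Ha /= ->; rewrite Ha.1 //= Hns mulSn addnC.
  by [].
rewrite /Size !run_seq !run_assign -/s0 -/s1.
by split; rewrite /= Hn // addn1 // -addnn addnS.
Qed.

Lemma coordinates_run s : scalar s v_k = k -> scalar s v_ns = ns ->
  (forall x, array (run Coordinates s) a_sub 0 (idx x) = x.1) /\
  (forall x, array (run Coordinates s) a_pos 0 (idx x) = x.2).
Proof.
move=> Hk Hns; pose s0 := set_scalar s v_x 0.
pose inner := PFor v_j v_ns
     (PSeq (PPut a_sub (Const 0) (Var v_x) (Var v_i))
     (PSeq (PPut a_pos (Const 0) (Var v_x) (Var v_j))
           (PAssign v_x (Add (Var v_x) (Const 1))))).
pose Inv m s' := scalar s' v_x = m /\ forall x, idx x < m ->
  array s' a_sub 0 (idx x) = x.1 /\ array s' a_pos 0 (idx x) = x.2.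
suff H : Inv (scalar s0 v_k * ns) (run (PFor v_i v_k inner) s0).
  have -> : run Coordinates s = run (PFor v_i v_k inner) s0 by [].
  by split=> x; have [|] := H.2 x; rewrite /= ?Hk // ?idx_lt.
apply: (@for_invariant v_i v_k inner s0 (fun i s' => Inv (i * ns) s')) => //.
move=> i s' ik Hi Ha I0.
suff [H1 H2] : Inv (i * ns + scalar s' v_ns) (run inner s').
  split; first by rewrite /= H1 Ha.1 //= Hns mulSn addnC.
  by move=> x xi; apply: H2; rewrite Ha.1 //= Hns addnC -mulSn.
apply: (@for_invariant v_j v_ns _ s' (fun j s' => Inv (i * ns + j) s')) => //.
  by rewrite addn0.
move=> j s1 jk Hj Ha1 [Hx H]; split; first by rewrite /= Hx addn1 addnS.
move=> x; rewrite addnS ltnS leq_eqVlt => /predU1P[xe|xlt]; last first.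
  by rewrite /= Hx (ltn_eqF xlt) /=; apply: H.
rewrite /= Hx xe eqxx /= Hj (Ha1.1 v_i) // Hi.
rewrite Ha.1 //= Hns in jk.
have := congr1 (fun m => m %/ ns) xe; have := congr1 (fun m => m %% ns) xe.
have ns0 : 0 < ns by apply: leq_ltn_trans jk.
rewrite /idx /= !modnMDl !divnMDl // !modn_small ?divn_small // !addn0.
by move=> -> ->.
Qed.

Lemma adjacency_run s : base s ->
  (forall v x, array (run Adjacency s) a_adj (code v) (idx x) = feeds A B v x) /\
  (forall x, array (run Adjacency s) a_adj n.*2.+1 (idx x) = 0).
Proof.
move=> [[_ _ HA HB] [Hn Hn1 Hn2] Hsub Hpos].
rewrite /Adjacency !run_seq; set s1 := run (Fill2 _ _ _ _ _ _ _) s.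
set s2 := run _ s1.
have E1 : scalar s1 v_n = n by rewrite scalar_run.
have E2 : scalar s2 v_n2 = n.*2.+1 by rewrite !scalar_run.
have E3 : scalar s2 v_n = n by rewrite !scalar_run.
split=> [v x|x]; rewrite fillP // eval_Var E2 E3 idx_lt andbT; last by rewrite eqxx.
rewrite ltn_eqF; last by rewrite ltnS (leq_trans (code_leq v)) // -addnn leq_addr.
rewrite fillP // eval_Var E1 idx_lt andbT.
case: v => [y|] /=; last by rewrite eqxx /= array_run // HB.
rewrite (ltn_eqF (idx_lt y)) fill2P // !evalE Hn !idx_lt /=.
by rewrite !subn0 !Hsub !Hpos HA /eX -val_eqE /= nat_of_bool_neq0.
Qed.

Lemma graph_arc s J : sizes s ->
  (forall v x, (array s a_G (code v) (idx x) != 0) = arc A B J v (Some x)) ->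
  (forall v, array s a_G (code v) n = 0) ->
  graph_in (@code k ns) (arc A B J) s.
Proof.
move=> [_ H1 _] H2 H3; split; first by rewrite H1 card_ost.
by move=> v [x|]; [apply: H2|rewrite /= H3 arc_None].
Qed.

Lemma closure_run s : base s ->
  (forall v x, array s a_adj (code v) (idx x) = feeds A B v x) ->
  forall v w, array (run Closure s) a_reach (code v) (code w) =
    connect (arc A B set0) v w.
Proof.
move=> Hb Hadj; have [_ Hs _ _] := Hb; have [Hn Hn1 Hn2] := Hs.
rewrite /Closure run_seq; set s0 := run (Fill2 _ _ _ _ _ _ _) s.
have S0 : sizes s0 by apply: sizes_run.
have G0 : graph_in (@code k ns) (arc A B set0) s0.
  apply: graph_arc S0 _ _ => [v x|v].
    rewrite fill2P // !evalE Hn1 /= !ltnS code_leq ltnW ?idx_lt //= Hn idx_lt subn0.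
    by rewrite Hadj arc0 !nat_of_bool_neq0.
  by rewrite fill2P // !evalE Hn1 /= !ltnS code_leq leqnn Hn ltnn.
pose Inv m s' := forall v w, code v < m ->
  array s' a_reach (code v) (code w) = connect (arc A B set0) v w.
suff H : Inv (scalar s0 v_n1) (run (PFor v_x v_n1 (PSeq (PAssign v_src (Var v_x))
     (PSeq Search (Fill a_reach (Var v_x) v_j v_n1 (Const 1) (at0 a_vis (Var v_j)) (Const 0))))) s0).
  move=> v w; apply: H; have [_ -> _] := S0.
  by rewrite ltnS code_leq.
apply: for_invariant => // m s' mn Hx Ha H u w.
have [_ H1 _] := S0; rewrite H1 in mn.
have [v Ev] : exists v : ost, code v = m.
  by apply: code_surj (@code_inj k ns) (@code_lt k ns) _; rewrite card_ost.
have G1 : graph_in (@code k ns) (arc A B set0) (set_scalar s' v_src (scalar s' v_x)).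
  split; first by rewrite /= Ha.1 // H1 card_ost.
  by move=> a b; rewrite /= Ha.2 // G0.2.
have Sv : scalar (set_scalar s' v_src (scalar s' v_x)) v_src = code v.
  by rewrite /= Hx Ev.
have [V1 _] := searchP (@code_inj k ns) (@code_lt k ns) G1 Sv.
rewrite run_seq run_seq run_assign; set s2 := run Search _ in V1 *.
rewrite array_set_scalar fillP // !eval_Var !scalar_run //= Hx Ha.1 // H1.
rewrite [code w < _]ltnS code_leq andbT.
rewrite ltnS [code u <= m]leq_eqVlt => /orP[/eqP um|um].
  rewrite um eqxx V1 /=.
  by have -> : u = v by apply: code_inj; rewrite um.
by rewrite ltn_eqF // array_run //= H.
Qed.

(** A rule for loops in which the round of [x] writes no state cell but that of [x]. *)
Lemma vector_loop a p s (f : st -> nat) : v_x \notin modS p -> scalar s v_n = n ->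
  (forall x s', scalar s' v_x = idx x -> agree (v_x :: modS p) (modA p) s s' ->
    forall y, array (run p s') a 0 (idx y) =
      if y == x then f x else array s' a 0 (idx y)) ->
  forall x, array (run (PFor v_x v_n p) s) a 0 (idx x) = f x.
Proof.
move=> xp Hn Hp.
suff H : forall x, idx x < scalar s v_n ->
    array (run (PFor v_x v_n p) s) a 0 (idx x) = f x.
  by move=> x; apply: H; rewrite Hn idx_lt.
pose Inv j s' := forall x, idx x < j -> array s' a 0 (idx x) = f x.
apply: (@for_invariant v_x v_n p s Inv) => // j s' jn Hx Ha H x.
rewrite Hn in jn; have [z zj] := idx_surj jn.
rewrite array_set_scalar (Hp z) ?Hx ?zj //; case: eqP => [-> //|xz].
rewrite ltnS leq_eqVlt -zj => /predU1P[/idx_inj //|xj].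
by apply: H; rewrite -zj.
Qed.

Lemma find_state (v i b : nat) c s (P : pred st) :
  [&& v \notin readS c, v != i & b != v] -> scalar s b = n ->
  (forall x, (eval (set_scalar s i (idx x)) c != 0) = P x) ->
  let r := scalar (run (Find v i b c) s) v in
  (exists2 x, r = idx x & P x) \/ (r = n /\ forall x, ~~ P x).
Proof.
move=> ok Hn HP; have := find_runP s ok; rewrite Hn /=.
case: ifP => [rn|_ [-> no]]; last first.
  by right; split=> // x; rewrite -HP no ?idx_lt.
by have [x xr] := idx_surj rn; rewrite -xr HP; left; exists x.
Qed.

Lemma components_run s : base s ->
  (forall v w, array s a_reach (code v) (code w) = connect (arc A B set0) v w) ->
  let s' := run Components s in
  [/\ forall x, array s' a_inN 0 (idx x) = inN A B x,
      forall x, array s' a_rep 0 (idx x) = isrep A B x,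
      forall y x, array s' a_adj (n.+1 + idx y) (idx x) =
         isrep A B y && (x \in scc A y)
    & forall r x, r < n.+1 \/ n.*2.+1 <= r ->
         array s' a_adj r (idx x) = array s a_adj r (idx x)].
Proof.
move=> Hb HR; have [_ [Hn Hn1 Hn2] _ _] := Hb.
have Rst s' x y : (forall i j, array s' a_reach i j = array s a_reach i j) ->
    array s' a_reach (idx x) (idx y) = connect (eX A) x y.
  by move=> ->; rewrite (HR (Some x) (Some y)) connect_arc0.
have Rin s' x : (forall i j, array s' a_reach i j = array s a_reach i j) ->
    array s' a_reach n (idx x) = accessible A B set0 x.
  by move=> ->; rewrite (HR None (Some x)).
rewrite /Components 2!run_seq.
set s1 := run MarkN s; set s2 := run MarkRep s1.
set s' := run (Fill2 _ _ _ _ _ _ _) s2.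
have H1 x : array s1 a_inN 0 (idx x) = inN A B x.
  move: x; apply: (@vector_loop a_inN _ s (inN A B)) => // x s0 Hx Ha y.
  have R0 i j : array s0 a_reach i j = array s a_reach i j by rewrite Ha.2.
  have N0 : scalar s0 v_n = n by rewrite Ha.1.
  rewrite run_seq run_put; set t := run (Find _ _ _ _) s0.
  have tR i j : array t a_reach i j = array s a_reach i j by rewrite array_run.
  have Tx : scalar t v_x = idx x by rewrite scalar_run.
  have Tn : scalar t v_n = n by rewrite scalar_run.
  rewrite !evalE /= Tx Tn (inj_eq (@idx_inj k ns)).
  case: eqP => [_|_]; last by rewrite array_run.
  rewrite Rin //; congr (nat_of_bool _); rewrite inNE nat_of_bool_eq0; congr (_ && _).
  have := @find_state v_f v_i v_n (And (Get a_reach (Var v_i) (Var v_x))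
      (Not (Get a_reach (Var v_x) (Var v_i)))) s0
      (fun z => connect (eX A) z x && ~~ connect (eX A) x z) isT N0.
  rewrite -/t; case=> [z|[w -> /andP[wx xw]]|[-> no]].
  - by rewrite !evalE /= Hx !Rst // nat_of_bool_neq0 nat_of_bool_eq0.
  - rewrite ltn_eqF ?idx_lt //; apply/esym/negP => /forallP/(_ w).
    by rewrite wx (negbTE xw).
  - rewrite eqxx; apply/esym/forallP => z; apply/implyP => zx.
    by have := no z; rewrite zx negbK.
have S1 : sizes s1 by apply: sizes_run => //; split.
have R1 i j : array s1 a_reach i j = array s a_reach i j by rewrite array_run.
have H2 x : array s2 a_rep 0 (idx x) = isrep A B x.
  move: x; apply: (@vector_loop a_rep _ s1 (isrep A B)) => //; first by case: S1.
  move=> x s0 Hx Ha y.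
  have R0 i j : array s0 a_reach i j = array s a_reach i j by rewrite Ha.2.
  have N0 : scalar s0 v_n = n by rewrite Ha.1 //; case: S1.
  rewrite run_seq run_put; set t := run (Find _ _ _ _) s0.
  have Tx : scalar t v_x = idx x by rewrite scalar_run.
  have Tn : scalar t v_n = n by rewrite scalar_run.
  rewrite !evalE /= Tx Tn (inj_eq (@idx_inj k ns)).
  case: eqP => [_|_]; last by rewrite array_run.
  rewrite array_run // Ha.2 // H1 nat_of_bool_neq0 andbC /isrep.
  congr (nat_of_bool (_ && _)).
  have := @find_state v_f v_i v_n (And (And (Get a_reach (Var v_i) (Var v_x))
                        (Get a_reach (Var v_x) (Var v_i)))
                   (Lt (Var v_x) (Var v_i))) s0
      (fun z => (z \in scc A x) && (idx x < idx z)) isT N0.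
  rewrite -/t; case=> [z|[w -> /andP[wx xw]]|[-> no]].
  - by rewrite !evalE /= Hx !Rst // !nat_of_bool_neq0 inE [X in X && _]andbC.
  - rewrite ltn_eqF ?idx_lt //; apply/esym/negP => /forall_inP/(_ w wx).
    by rewrite leqNgt xw.
  - rewrite eqxx; apply/esym/forall_inP => z zx.
    by have := no z; rewrite zx -leqNgt.
have S2 : sizes s2 by apply: sizes_run.
have [N2 N21 _] := S2.
have R2 i j : array s2 a_reach i j = array s a_reach i j by rewrite array_run.
split.
- by move=> x; rewrite /s' array_run // array_run.
- by move=> x; rewrite /s' array_run.
- move=> y x; rewrite /s' fill2P // !evalE N2 N21 leq_addr ltn_add2l !idx_lt /=.
  by rewrite addKn H2 !Rst // !nat_of_bool_neq0 inE [X in _ && X]andbC.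
- move=> r x hr; rewrite /s' fill2P // !evalE N2 N21; case: ifP => [|_].
    by move=> /and3P[]; lia.
  by rewrite !array_run.
Qed.

End Preprocessing.

(** * The greedy matching by successive augmentations *)

Definition Order :=
  PIf (Eq (Var v_x) (Const 0)) (PAssign v_r (Var v_n))
    (PIf (Le (Var v_x) (Var v_n)) (PAssign v_r (Sub (Var v_x) (Const 1)))
       (PAssign v_r (Var v_x))).

(** Walking backwards from the free end, each node takes the partner of its parent before the
    parent's own cell is overwritten. *)
Definition Trace :=
  PFor v_j v_n1
    (PIf (Eq (Var v_l) (Var v_src)) PSkip
       (PSeq (PPut a_mate (Const 0) (Var v_l) (at0 a_mate (at0 a_par (Var v_l))))
             (PAssign v_l (at0 a_par (Var v_l))))).

(* The right node to be matched is entered in cell n_T of [a_mate], as the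
   partner of a fictitious left node from which the search starts.  The value
   2 n_T + 1 in [a_mate] marks a free left node.  If the search fails, [Find]
   returns n_T and [Trace] does nothing. *)
Definition Insert :=
  PSeq Order
  (PSeq (PPut a_mate (Const 0) (Var v_n) (Var v_r))
  (PSeq (Fill2 a_G (Const 0) v_i v_n1 v_j v_n1
           (And (Lt (Var v_j) (Var v_n))
                (Get a_adj (at0 a_mate (Var v_i)) (Var v_j))))
  (PSeq (PAssign v_src (Var v_n))
  (PSeq Search
  (PSeq (Find v_l v_i v_n
           (And (at0 a_vis (Var v_i)) (Eq (at0 a_mate (Var v_i)) (Var v_n2))))
        Trace))))).

Definition Greedy :=
  PSeq (Fill a_mate (Const 0) v_j v_n (Const 1) (Var v_n2) (Const 0))
       (PFor v_x v_n2 Insert).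

Section GreedyStage.
Variables (k ns : nat) (A : 'M[bool]_ns) (B : 'cV[bool]_(k * ns)).

Local Notation st := (state k ns).
Local Notation ost := (option st).
Local Notation right := (option st + st)%type.
Local Notation n := (k * ns).
Implicit Types (x y z : st) (v w : option st) (s : memory) (m : st -> option right).

Definition ocode (r : option right) : nat :=
  match r with
  | Some (inl v) => code v
  | Some (inr y) => n.+1 + idx y
  | None => n.*2.+1
  end.

Lemma ocode_None r : (ocode r == n.*2.+1) = (r == None).
Proof.
case: r => [[v|y]|] /=; last by rewrite eqxx.
  by have := code_leq v; case: eqP => //; lia.
by have := idx_lt y; case: eqP => //; lia.
Qed.

Lemma trace_run s (M : ost -> nat) (p : seq ost) :
  sizes k ns s -> scalar s v_src = n -> uniq (None :: p) ->
  scalar s v_l = code (last None p) ->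
  (forall v, array s a_mate 0 (code v) = M v) ->
  (forall i, i < size p ->
     array s a_par 0 (code (nth None p i)) = code (nth None (None :: p) i)) ->
  forall v, array (run Trace s) a_mate 0 (code v) =
    if v \in p then M (nth None (None :: p) (index v p)) else M v.
Proof.
move=> [_ Hn1 _] Hsrc up Hl HM Hp.
(* After [j] rounds the last [j] nodes of [p] hold the old partners of their predecessors. As
   [size p <= n], the n_T + 1 rounds get back to the start, where the remaining ones idle. *)
pose Inv j s' := scalar s' v_l = code (nth None (None :: p) (size p - j)) /\
  forall v, array s' a_mate 0 (code v) =
    if (v \in p) && (size p - j <= index v p)
    then M (nth None (None :: p) (index v p)) else M v.
have Np : None \notin p by case/andP: up.
have up' : uniq p by case/andP: up.
suff [_ H] : Inv (scalar s v_n1) (run Trace s).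
  move=> v; rewrite H; have : size p < n.+1.
    have := max_card (mem (None :: p)); rewrite (card_uniqP up) /= card_ost.
    by [].
  move=> le; have -> : size p - scalar s v_n1 = 0 by rewrite Hn1; lia.
  by rewrite leq0n andbT.
apply: for_invariant => //.
  split; first by rewrite subn0 -last_nth /= Hl.
  move=> v; rewrite subn0 /= HM; case: ifP => // /andP[vp].
  by rewrite leqNgt index_mem vp.
move=> j s' jn Hj Ha [Hl' HM'].
have Hsrc' : scalar s' v_src = code (None : ost) by rewrite Ha.1.
set d := size p - j in Hl' HM'.
rewrite run_if evalE !eval_Var Hl' Hsrc' (inj_eq (@code_inj k ns)).
have dj : size p - j.+1 = d.-1 by rewrite /d; lia.
rewrite /Inv dj {dj}.
have dp : d <= size p by rewrite leq_subr.
clearbody d; case: d dp Hl' HM' => [|d] dp Hl' HM'.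
  by rewrite eqxx /=; split.
set v0 := nth None (None :: p) d.+1.
have v0p : v0 \in p by apply: mem_nth.
have -> : (v0 == None) = false by apply: contraNF Np => /eqP <-.
have ip : index v0 p = d by rewrite /v0 /= index_uniq.
rewrite /=.
have par : array s' a_par 0 (code v0) = code (nth None (None :: p) d).
  by rewrite Ha.2 // Hp.
rewrite Hl' -/v0 par; split=> // v.
rewrite (inj_eq (@code_inj k ns)) HM' HM'.
case: (eqVneq v v0) => [->|vv0].
  rewrite v0p ip leqnn /=; case: ifP => // /andP[up1 di].
  suff : d < d by rewrite ltnn.
  apply: leq_trans di _; case: (d) dp up1 => [|d'] dp' up1 /=.
    by move: up1; rewrite /= (negbTE Np).
  by rewrite index_uniq // ltnW.
case vp: (v \in p) => //=; congr (if _ then _ else _).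
rewrite [d <= _]leq_eqVlt; case: eqP => // dv; case/eqP: vv0.
by rewrite /v0 /= dv nth_index.
Qed.

Definition holds_mate s m : Prop :=
  forall x, array s a_mate 0 (idx x) = ocode (m x).

Definition adjacency_in s : Prop :=
  forall r x, array s a_adj (ocode r) (idx x) = oapp (admits A B x) false r.

(** [Order] converts ranks, which put the input first, into codes, which put it after the states. *)
Lemma order_run s (r : right) : sizes k ns s -> scalar s v_x = rank r ->
  scalar (run Order s) v_r = ocode (Some r).
Proof.
move=> [Hn _ _]; case: r => [[y|]|y] /= Hx; rewrite Hx /= ?Hn //.
  by rewrite idx_lt /= subn1.
by rewrite addSn ltnNge leq_addr.
Qed.

Lemma insert_run s (r0 : right) m : sizes k ns s -> adjacency_in s ->
  scalar s v_x = rank r0 -> holds_mate s m ->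
  greedy (admits A B) (@rank k ns) (rank r0) m ->
  exists2 m', holds_mate (run Insert s) m' &
    greedy (admits A B) (@rank k ns) (rank r0).+1 m'.
Proof.
move=> Hs Hadj Hx Hm Gm.
rewrite /Insert 6!run_seq; set s1 := run Order s.
have S1 : sizes k ns s1 by apply: sizes_run.
have r1 : scalar s1 v_r = ocode (Some r0) by apply: order_run.
set s2 := run (PPut _ _ _ _) s1.
have S2 : sizes k ns s2 by apply: sizes_run.
have M2 v : array s2 a_mate 0 (code v) = ocode (mate_of m r0 v).
  have [N1 _ _] := S1.
  rewrite /s2 run_put !evalE N1 r1 /= -[k * ns]/(code (None : ost)).
  rewrite (inj_eq (@code_inj k ns)); case: v => [x|] //=.
  by rewrite array_run // Hm.
have A2 : adjacency_in s2 by move=> r x; rewrite array_run // array_run.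
clearbody s2; set s3 := run (Fill2 _ _ _ _ _ _ _) s2.
have S3 : sizes k ns s3 by apply: sizes_run.
pose e := alternate (admits A B) m r0.
have G3 : graph_in (@code k ns) e s3.
  have [N2 N21 N22] := S2; split; first by have [_ -> _] := S3; rewrite card_ost.
  move=> v w; rewrite fill2P // !evalE N21 /= subn0 !ltnS !code_leq.
  case: w => [x|] /=; last by rewrite N2 ltnn.
  by rewrite N2 idx_lt /= M2 A2 !nat_of_bool_neq0.
set s4 := run (PAssign _ _) s3.
have S4 : sizes k ns s4 by apply: sizes_run.
have G4 : graph_in (@code k ns) e s4 by apply: graph_in_agree (run_agree _ _) _ _ G3.
have src4 : scalar s4 v_src = code (None : ost) by have [N3 _ _] := S3; rewrite /s4 /= N3.
have M4 v : array s4 a_mate 0 (code v) = ocode (mate_of m r0 v).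
  by rewrite array_run // array_run.
clearbody s4; have [V5 T5] := searchP (@code_inj k ns) (@code_lt k ns) G4 src4.
set s5 := run Search s4 in V5 T5 *.
have S5 : sizes k ns s5 by apply: sizes_run.
have M5 v : array s5 a_mate 0 (code v) = ocode (mate_of m r0 v).
  by rewrite array_run.
set s6 := run (Find _ _ _ _) s5.
have S6 : sizes k ns s6 by apply: sizes_run.
have src6 : scalar s6 v_src = n by rewrite scalar_run // scalar_run.
have M6 v : array s6 a_mate 0 (code v) = ocode (mate_of m r0 v).
  by rewrite array_run.
have [N5 _ N52] := S5.
have := @find_state k ns v_l v_i v_n
  (And (at0 a_vis (Var v_i)) (Eq (at0 a_mate (Var v_i)) (Var v_n2))) s5
  (fun x => connect e None (Some x) && (m x == None)) isT N5.
rewrite -/s6; case=> [x|[t lt /andP[ct /eqP mt]]|[l6 no]].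
- rewrite !evalE /= -[idx x]/(code (Some x)) V5 M5 N52 ocode_None.
  by rewrite !nat_of_bool_neq0.
- have [p [pp lp up _ parp]] := T5 _ ct.
  have G' := greedy_augment (@rank_inj k ns) (erefl (rank r0)) Gm pp lp up mt.
  exists (augment m r0 p); last exact: G'.
  move=> x; rewrite augmentE -[idx x]/(code (Some x)).
  rewrite (@trace_run s6 (fun v => ocode (mate_of m r0 v)) p) //; first by case: ifP.
    by rewrite lp.
  by move=> i ip; rewrite /s6 array_run // parp.
- exists m.
    move=> x; rewrite -[idx x]/(code (Some x)).
    by rewrite (@trace_run s6 (fun v => ocode (mate_of m r0 v)) [::]).
  have full x : connect e None (Some x) -> m x != None.
    by move=> cx; have := no x; rewrite cx.
  have G' := greedy_fail (@rank_inj k ns) (erefl (rank r0)) Gm full.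
  exact: G'.
Qed.

Lemma greedy_run s : sizes k ns s -> adjacency_in s ->
  exists2 m, holds_mate (run Greedy s) m &
    greedy (admits A B) (@rank k ns) n.*2.+1 m.
Proof.
move=> Hs Hadj; rewrite /Greedy run_seq; set s0 := run (Fill _ _ _ _ _ _ _) s.
have [Hn _ Hn2] := Hs; have S0 : sizes k ns s0 by apply: sizes_run.
have [_ _ N02] := S0.
pose Inv i s' := exists2 m, holds_mate s' m & greedy (admits A B) (@rank k ns) i m.
suff : Inv (scalar s0 v_n2) (run (PFor v_x v_n2 Insert) s0) by rewrite N02.
apply: for_invariant => //.
  exists (fun=> None); last exact: greedy0.
  by move=> x; rewrite array_set_scalar fillP // !evalE Hn idx_lt /=.
move=> i s' ilt Hx Ha [m Hm Gm]; rewrite N02 in ilt.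
have [r ri] : exists r : right, rank r = i.
  case: (ltnP i n.+1) => [|le].
    case: i {Hx Gm} ilt => [|i] _; first by exists (inl None).
    by rewrite ltnS => /idx_surj[y <-]; exists (inl (Some y)).
  have [|y yi] := @idx_surj k ns (i - n.+1); first by lia.
  by exists (inr y); rewrite /= yi subnKC.
rewrite -ri in Gm Hx *.
have S' : sizes k ns s' by case: S0 => H1 H2 H3; split; rewrite Ha.1.
have A' : adjacency_in s' by move=> u x; rewrite Ha.2 // array_run // Hadj.
have [m' Hm' Gm'] := insert_run S' A' Hx Hm Gm.
by exists m'.
Qed.

End GreedyStage.

(** * Assignment of the left nodes outside M', and output of [Mstar] and the initial \tilde M *)

Definition MarkUsed a :=
  PSeq (Fill a_used (Const 0) v_j v_n1 (Const 1) (Const 0) (Const 0))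
       (PFor v_j v_n (PPut a_used (Const 0) (at0 a (Var v_j)) (Const 1))).

(** A partner above n_T is an SCC or the marker of a free node, that is, the node is not [direct].
    The disjunction expresses [ordS], the cyclically next subsystem. *)
Definition AssignFree :=
  PSeq (MarkUsed a_mate)
  (PFor v_x v_n
    (PIf (Lt (Var v_n) (at0 a_mate (Var v_x)))
      (PSeq (Find v_f v_i v_n
         (And (Not (at0 a_used (Var v_i)))
            (Or (Eq (at0 a_sub (Var v_i)) (Add (at0 a_sub (Var v_x)) (Const 1)))
                (And (Eq (Add (at0 a_sub (Var v_x)) (Const 1)) (Var v_k))
                     (Eq (at0 a_sub (Var v_i)) (Const 0))))))
      (PSeq (PPut a_asg (Const 0) (Var v_x) (Var v_f))
            (PPut a_used (Const 0) (Var v_f) (Const 1))))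
      PSkip)).

Definition Output :=
  PSeq (Fill a_Mstar (Const 0) v_j v_n (Lt (at0 a_mate (Var v_j)) (Var v_n2))
          (at0 a_mate (Var v_j)) (at0 a_asg (Var v_j)))
       (Fill a_Mt (Const 0) v_j v_n (Le (at0 a_mate (Var v_j)) (Var v_n))
          (at0 a_mate (Var v_j)) (at0 a_asg (Var v_j))).

Section AssignStage.
Variables (R : realType) (k ns : nat) (A : 'M[bool]_ns) (B : 'cV[bool]_(k * ns)).
Hypotheses (k_gt0 : 0 < k) (ns_gt0 : 0 < ns).
Hypothesis sc : structurally_controllable R (full_composite k A) B.

Local Notation st := (state k ns).
Local Notation ost := (option st).
Local Notation right := (option st + st)%type.
Local Notation n := (k * ns).
Implicit Types (x y z : st) (v w : option st) (s : memory).

(** An entry [h x] that codes no state sets a cell beyond those of the states. *)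
Lemma mark_run a s (h : st -> nat) : a != a_used -> sizes k ns s ->
  (forall x, array s a 0 (idx x) = h x) ->
  forall y, array (run (MarkUsed a) s) a_used 0 (idx y) = [exists x, h x == idx y].
Proof.
move=> au [Hn Hn1 _] Ha; rewrite /MarkUsed run_seq; set s0 := run (Fill _ _ _ _ _ _ _) s.
have N0 : scalar s0 v_n = n by rewrite scalar_run.
pose Inv j s' := forall y, array s' a_used 0 (idx y) =
   [exists x, (idx x < j) && (h x == idx y)].
suff H : Inv (scalar s0 v_n)
    (run (PFor v_j v_n (PPut a_used (Const 0) (at0 a (Var v_j)) (Const 1))) s0).
  move=> y; rewrite H N0; congr (nat_of_bool _).
  by apply: eq_existsb => x; rewrite idx_lt.
apply: for_invariant => //.
  move=> y; rewrite array_set_scalar fillP // !evalE Hn1 ltnS ltnW ?idx_lt //=.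
  by apply/esym; rewrite (introF existsP) // => -[x].
move=> j s' jn Hj Hag H y; rewrite N0 in jn; have [x xj] := idx_surj jn.
have Ex : array s' a 0 (idx x) = h x.
  have au2 : a \notin [:: a_used] by rewrite inE.
  have au3 : a \notin [:: a_used; a_used] by rewrite !inE negb_or au.
  by rewrite (Hag.2 a 0 (idx x) au2) (@array_run (Fill _ _ _ _ _ _ _) s a _ _ au3) Ha.
rewrite run_put !evalE /= Hj -xj Ex H.
case: (eqVneq (idx y) (h x)) => [yx|yx].
  by apply/esym; rewrite (introT existsP) //; exists x; rewrite ltnSn yx eqxx.
congr (nat_of_bool _); apply: eq_existsb => z.
rewrite -xj ltnS [idx z <= idx x]leq_eqVlt (inj_eq (@idx_inj k ns)).
by case: (eqVneq z x) => [->|//]; rewrite ltnn /= eq_sym (negbTE yx).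
Qed.

Variable m : st -> option right.
Hypothesis greedy_m : greedy (admits A B) (@rank k ns) n.*2.+1 m.

Lemma ocode_direct x : (ocode (m x) <= n) = direct m x.
Proof.
rewrite /direct; case: (m x) => [[v|y]|] /=.
- exact: code_leq.
- by rewrite addSn ltnNge leq_addr.
- by apply/negbTE; rewrite -ltnNge ltnS -addnn leq_addr.
Qed.

Lemma ordS_val (i j : 'I_k) :
  (i == j.+1 :> nat) || ((j.+1 == k) && (i == 0 :> nat)) = (i == ordS j).
Proof.
rewrite -val_eqE /=; case: (eqVneq j.+1 k) => [jk|jk].
  by rewrite jk modnn (ltn_eqF (ltn_ord i)).
by rewrite orbF modn_small // ltn_neqAle jk ltn_ord.
Qed.

Lemma assign_run s : base A B s -> holds_mate s m ->
  exists f : st -> st,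
    [/\ forall x, ~~ direct m x -> array (run AssignFree s) a_asg 0 (idx x) = idx (f x),
        forall x, ~~ direct m x -> (f x).1 != x.1,
        forall x, ~~ direct m x -> f x \notin used m
      & {in [pred x | ~~ direct m x] &, injective f}].
Proof.
move=> Hb Hm; rewrite /AssignFree run_seq; set s0 := run (MarkUsed a_mate) s.
have B0 : base A B s0 by apply: base_run.
have [_ [N0 _ _] _ _] := B0.
have U0 y : array s0 a_used 0 (idx y) = (y \in used m).
  have [_ Hs _ _] := Hb; rewrite (mark_run (h := fun x => ocode (m x))) //.
  congr (nat_of_bool _); rewrite inE; apply: eq_existsb => x.
  apply/eqP/eqP => [|-> //]; case: (m x) => [[[z|]|z]|] /= E.
  - by rewrite (idx_inj E).
  - by have := idx_lt y; rewrite -E ltnn.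
  - by have := idx_lt y; lia.
  - by have := idx_lt y; lia.
pose Inv j s' := exists f : st -> st,
  [/\ forall x, ~~ direct m x -> idx x < j ->
        [/\ array s' a_asg 0 (idx x) = idx (f x), (f x).1 = ordS x.1
          & f x \notin used m],
      forall x x', ~~ direct m x -> idx x < j -> ~~ direct m x' -> idx x' < j ->
        f x = f x' -> x = x'
    & forall y, array s' a_used 0 (idx y) =
        (y \in used m) || [exists x, [&& ~~ direct m x, idx x < j & f x == y]]].
set body := PIf _ _ _.
suff [f [f1 f2 f3]] : Inv (scalar s0 v_n) (run (PFor v_x v_n body) s0).
  rewrite N0 in f1 f2; exists f; split.
  - by move=> x fx; have [] := f1 x fx (idx_lt x).
  - move=> x fx; have [_ -> _] := f1 x fx (idx_lt x).
    by rewrite eq_sym (ordS_neq k_gt0 sc greedy_m fx).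
  - by move=> x fx; have [] := f1 x fx (idx_lt x).
  - by move=> x y fx fy; apply: f2; rewrite ?idx_lt.
apply: for_invariant => //.
  exists id; split=> // y; rewrite array_set_scalar U0; congr (nat_of_bool _).
  by rewrite orbC (introF existsP) // => -[x /and3P[]].
move=> j s' jn Hx Ha [f [f1 f2 f3]]; rewrite N0 in jn; have [x xj] := idx_surj jn.
move: Hx jn f1 f2 f3; rewrite -{}xj => Hx jn f1 f2 f3 {j}.
have B' : base A B s'.
  have [[Hk Hns HA HB] [H1 H2 H3] Hsub Hpos] := B0.
  by split; [split|split| |] => *; rewrite ?Ha.1 ?Ha.2.
have [[Hk _ _ _] [N' _ _] Hsub _] := B'.
have M' z : array s' a_mate 0 (idx z) = ocode (m z).
  by rewrite Ha.2 // array_run.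
have less z : (idx z < (idx x).+1) = (z == x) || (idx z < idx x).
  by rewrite ltnS [idx z <= _]leq_eqVlt (inj_eq (@idx_inj k ns)).
rewrite run_if !evalE N' Hx M' ltnNge ocode_direct.
have [dx|fx] := boolP (direct m x).
  exists f; split=> [z fz|z z' fz + fz'|y].
  - by rewrite less; case: eqP => [zx|_ /=]; [rewrite zx dx in fz|apply: f1].
  - rewrite !less; case: eqP => [zx|_ /= lz]; first by rewrite zx dx in fz.
    by case: eqP => [zx|_ /=]; [rewrite zx dx in fz'|apply: f2].
  - rewrite array_set_scalar f3; congr (nat_of_bool (_ || _)).
    apply: eq_existsb => z; rewrite less.
    by case: (eqVneq z x) => [->|//]; rewrite dx.
rewrite run_seq run_seq; set t := run (Find _ _ _ _) s'.
pose D := [set z | ~~ direct m z & idx z < idx x].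
have [||y [y1 yu yD]] := assign_exists k_gt0 sc greedy_m (D := D) (f := f) _ fx.
- by move=> z; rewrite inE => /andP[fz lz]; have [_ ->] := f1 z fz lz.
- by rewrite inE fx ltnn.
have Uy z : (array s' a_used 0 (idx z) == 0) = (z \notin used m) && (z \notin f @: D).
  rewrite f3 nat_of_bool_eq0 negb_or; congr (_ && ~~ _).
  apply/existsP/imsetP => [[u /and3P[fu lu /eqP <-]]|[u uD ->]].
    by exists u; rewrite // inE fu.
  by exists u; move: uD; rewrite inE => /andP[-> ->] /=.
have Tx : scalar t v_x = idx x by rewrite scalar_run // Hx.
have := @find_state k ns v_f v_i v_n
  (And (Not (at0 a_used (Var v_i)))
            (Or (Eq (at0 a_sub (Var v_i)) (Add (at0 a_sub (Var v_x)) (Const 1)))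
                (And (Eq (Add (at0 a_sub (Var v_x)) (Const 1)) (Var v_k))
                     (Eq (at0 a_sub (Var v_i)) (Const 0))))) s'
  (fun z => [&& z \notin used m, z \notin f @: D & z.1 == ordS x.1]) isT N'.
rewrite -/t; case=> [z|[z tz /and3P[zu zD /eqP z1]]|[_ no]].
- rewrite !evalE /= Hx !Hsub Hk ?nat_of_bool_neq0 Uy addn1 -ordS_val.
  by rewrite -andbA.
- exists (fun u => if u == x then z else f u).
  have asg u : array (set_scalar (run (PPut a_used (Const 0) (Var v_f) (Const 1))
       (run (PPut a_asg (Const 0) (Var v_x) (Var v_f)) t)) v_x (idx x).+1) a_asg 0 (idx u)
      = if u == x then idx z else array s' a_asg 0 (idx u).
    by rewrite /= Tx tz (inj_eq (@idx_inj k ns)); case: eqP => // _; rewrite array_run.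
  have zf u : ~~ direct m u -> idx u < idx x -> z <> f u.
    by move=> fu lu E; case/negP: zD; apply/imsetP; exists u; rewrite // inE fu.
  split=> [u fu|u u' fu + fu'|u].
  - rewrite less asg; case: eqP => [-> _|_ /=]; first by split.
    exact: f1.
  - rewrite !less; case: eqP => [->|_] /= lu; case: eqP => [->|_] //= lu'.
    + by move/(zf _ fu' lu').
    + by move/esym/(zf _ fu lu).
    + exact: f2.
  - rewrite /= tz (inj_eq (@idx_inj k ns)).
    have -> : [exists x0, [&& ~~ direct m x0, idx x0 < (idx x).+1 &
         (if x0 == x then z else f x0) == u]] = (u == z) ||
       [exists x0, [&& ~~ direct m x0, idx x0 < idx x & f x0 == u]].
      apply/existsP/orP => [[u' /and3P[fu']]|[/eqP ->|/existsP[u' /and3P[fu' lu' /eqP fe]]]].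
      + rewrite less; case: (eqVneq u' x) => [_ _ /eqP ->|_ /= lu' fe]; first by left.
        by right; apply/existsP; exists u'; rewrite fu' lu'.
      + by exists x; rewrite fx less eqxx /=.
      + exists u'; rewrite fu' less lu' orbT /= ifN ?fe //.
        by apply: contraTneq lu' => ->; rewrite ltnn.
    case: eqP => [->|_] /=; first by rewrite orbT.
    by rewrite array_run // f3.
- by have := no y; rewrite yu yD y1 eqxx.
Qed.

Variable f : st -> st.

Lemma output_run s : sizes k ns s -> holds_mate s m ->
  (forall x, ~~ direct m x -> array s a_asg 0 (idx x) = idx (f x)) ->
  holds_matching (run Output s) a_Mstar 0 (gset (star_of A m f)) /\
  forall x, array (run Output s) a_Mt 0 (idx x) = code (tilde_of m f x).
Proof.
move=> [Hn Hn1 Hn2] Hm Hf; rewrite /Output run_seq.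
set s1 := run (Fill _ _ _ _ _ _ _) s.
have N1 : scalar s1 v_n = n by rewrite scalar_run.
split=> [|x]; last first.
  rewrite fillP // !evalE /= N1 idx_lt array_run // array_run // Hm.
  rewrite ocode_direct; case: ifPn => dx.
    by rewrite (tilde_direct f dx).
  by rewrite tilde_free // Hf.
suff H x : encodes (array s1 a_Mstar 0 (idx x)) (star_of A m f x).
  by move=> [x r]; rewrite inE => /eqP ->; rewrite array_run //; apply: H.
rewrite fillP // !evalE /= Hn Hn2 idx_lt.
rewrite Hm /star_of; case mx: (m x) => [[v|y]|] /=.
- have -> : code v < n.*2.+1 by have := code_leq v; lia.
  by case: v {mx}.
- have -> : n.+1 + idx y < n.*2.+1 by have := idx_lt y; lia.
  by exists y; rewrite ?mem_scc.
- rewrite ltnn /= Hf //.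
  by rewrite /direct mx.
Qed.

End AssignStage.

(** * The while loop of steps (10)-(17) *)

Definition Fetch :=
  Fill a_cur (Const 0) v_j v_n (Const 1) (Get a_Mt (Var v_iter) (Var v_j)) (Const 0).

Definition Access :=
  PSeq (Fill2 a_G (Const 0) v_i v_n1 v_j v_n1
         (And (Lt (Var v_j) (Var v_n))
              (Or (Get a_adj (Var v_i) (Var v_j)) (Eq (at0 a_cur (Var v_j)) (Var v_i)))))
  (PSeq (PAssign v_src (Var v_n)) Search).

Definition FindWaiting :=
  Find v_f v_i v_n
    (And (And (Lt (at0 a_cur (Var v_i)) (Var v_n))
              (Not (Eq (at0 a_sub (at0 a_cur (Var v_i))) (at0 a_sub (Var v_i)))))
         (And (at0 a_inN (Var v_i)) (Not (at0 a_vis (Var v_i))))).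

Definition FindEntering :=
  Find v_g v_i v_n
    (And (And (Eq (at0 a_sub (Var v_i)) (at0 a_sub (Var v_y)))
              (Lt (at0 a_cur (Var v_i)) (Var v_n)))
         (And (Not (Eq (at0 a_sub (at0 a_cur (Var v_i))) (at0 a_sub (Var v_y))))
              (Not (at0 a_vis (at0 a_cur (Var v_i)))))).

Definition Redirect :=
  PSeq (PAssign v_y (at0 a_cur (Var v_f)))
  (PSeq (PIf (Eq (at0 a_sub (Var v_f)) (at0 a_sub (Var v_z)))
           FindEntering (PAssign v_g (Var v_f)))
  (PSeq (Fill a_Mt (Add (Var v_iter) (Const 1)) v_j v_n (Eq (Var v_j) (Var v_g))
           (Var v_z) (at0 a_cur (Var v_j)))
        (PAssign v_iter (Add (Var v_iter) (Const 1))))).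

Definition Round :=
  PSeq Fetch
  (PSeq Access
  (PSeq (MarkUsed a_cur)
  (PSeq (Find v_z v_i v_n (Not (at0 a_used (Var v_i))))
  (PSeq FindWaiting
        (PIf (Lt (Var v_f) (Var v_n)) Redirect PSkip))))).

(** Every value of \tilde M is kept, in row [v_iter]; rounds without a waiting node neither add a
    row nor advance [v_iter]. *)
Definition Loop :=
  PSeq (PAssign v_iter (Const 0)) (PFor v_x v_n Round).

Section LoopStage.
Variables (k ns : nat) (A : 'M[bool]_ns) (B : 'cV[bool]_(k * ns)).

Local Notation st := (state k ns).
Local Notation ost := (option st).
Local Notation n := (k * ns).
Local Notation edge := (st * rnode k ns)%type.
Implicit Types (x y z u a b : st) (v w : option st) (s : memory) (c : st -> option st).

Definition feeds_in s : Prop :=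
  forall v x, array s a_adj (code v) (idx x) = feeds A B v x.

Definition current s c : Prop := forall x, array s a_cur 0 (idx x) = code (c x).

Lemma code_Some v y : (code v == idx y) = (v == Some y).
Proof. by rewrite -[idx y]/(code (Some y)) (inj_eq (@code_inj k ns)). Qed.

Lemma code_ltn v : (code v < n) = (v != None).
Proof. by case: v => [x|] /=; rewrite ?idx_lt ?ltnn. Qed.

Lemma fetch_run s c : sizes k ns s ->
  (forall x, array s a_Mt (scalar s v_iter) (idx x) = code (c x)) ->
  current (run Fetch s) c.
Proof. by move=> [Hn _ _] Hc x; rewrite fillP // !evalE /= Hn idx_lt Hc. Qed.

Lemma access_run s c : sizes k ns s -> feeds_in s -> valid A B c -> current s c ->
  forall x, array (run Access s) a_vis 0 (idx x) = accessible A B (links c) x.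
Proof.
move=> Hs Hf vc Hc; rewrite /Access run_seq run_seq.
set s1 := run (Fill2 _ _ _ _ _ _ _) s; set s2 := run (PAssign _ _) s1.
have [Hn Hn1 _] := Hs; have S1 : sizes k ns s1 by apply: sizes_run.
have S2 : sizes k ns s2 by apply: sizes_run.
have G2 : graph_in (@code k ns) (arc A B (links c)) s2.
  apply: graph_arc S2 _ _ => [v x|v]; rewrite array_run // fill2P // !evalE Hn1 /= subn0.
    rewrite !ltnS code_leq ltnW ?idx_lt //= Hn idx_lt Hf Hc !nat_of_bool_neq0.
    by rewrite (inj_eq (@code_inj k ns)) arc_links.
  by rewrite !ltnS code_leq leqnn Hn ltnn.
have src2 : scalar s2 v_src = code (None : ost) by have [N1 _ _] := S1; rewrite /s2 /= N1.
have [V _] := searchP (@code_inj k ns) (@code_lt k ns) G2 src2.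
by move=> x; apply: (V (Some x)).
Qed.

(** [while_loop] without its exit condition, so that a run can be extended at its end. *)
Fixpoint chain (M : {set edge}) (Ms : seq {set edge}) : Prop :=
  if Ms is M1 :: Ms' then loop_step A B M M1 /\ chain M1 Ms' else True.

Lemma chain_rcons M Ms M1 : chain M Ms -> loop_step A B (last M Ms) M1 ->
  chain M (rcons Ms M1).
Proof. by elim: Ms M => [|M' Ms IH] M //= [? ?] ?; split=> //; apply: IH. Qed.

Lemma chain_while M Ms : chain M Ms -> VN' A B (last M Ms) = set0 ->
  while_loop A B M Ms.
Proof. by elim: Ms M => [|M' Ms IH] M //= [? ?] ?; split=> //; apply: IH. Qed.

Definition trajectory (c0 : st -> option st) (cs : seq (st -> option st)) s : Prop :=
  [/\ scalar s v_iter = size cs,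
      forall l x, l <= size cs -> array s a_Mt l (idx x) = code (nth c0 (c0 :: cs) l x),
      chain (edges c0) [seq edges c | c <- cs]
    & valid A B (last c0 cs)].

Lemma round_run c0 cs s : base A B s -> feeds_in s ->
  (forall x, array s a_inN 0 (idx x) = inN A B x) ->
  trajectory c0 cs s ->
  let c := last c0 cs in
  (forall x, ~~ waiting A B c x) /\ trajectory c0 cs (run Round s) \/
  (exists x, waiting A B c x) /\
  exists c', trajectory c0 (rcons cs c') (run Round s) /\
    #|[set x | accessible A B (links c) x]| < #|[set x | accessible A B (links c') x]|.
Proof.
move=> Hb Hf HN [Hit HM Hch vc] c; rewrite -/c in vc.
rewrite /Round 5!run_seq; set s1 := run Fetch s; set s2 := run Access s1.
set s3 := run (MarkUsed a_cur) s2; set s4 := run (Find _ _ _ _) s3.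
set s5 := run FindWaiting s4.
have B1 : base A B s1 by apply: base_run.
have B2 : base A B s2 by apply: base_run.
have B3 : base A B s3 by apply: base_run.
have B4 : base A B s4 by apply: base_run.
have B5 : base A B s5 by apply: base_run.
have [_ Hs _ _] := Hb; have [_ S1 _ _] := B1; have [_ S2 _ _] := B2.
have [_ [N3 _ _] _ _] := B3; have [_ [N4 _ _] Sub4 _] := B4.
have [_ [N5 _ _] Sub5 _] := B5.
have C1 : current s1 c.
  apply: fetch_run => // x; rewrite Hit HM // /c (last_nth c0).
  by [].
have F1 : feeds_in s1 by move=> v x; rewrite array_run.
have V2 := access_run S1 F1 vc C1; rewrite -/s2 in V2.
have C2 : current s2 c by move=> x; rewrite array_run.
have U3 := mark_run (a := a_cur) isT S2 C2; rewrite -/s3 in U3.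
have [z [uz zc az]] := unmatched_accessibleP vc.
have z4 : scalar s4 v_z = idx z.
  have := @find_state k ns v_z v_i v_n (Not (at0 a_used (Var v_i))) s3
    (fun y => [forall x, c x != Some y]) isT N3.
  rewrite -/s4; case=> [x|[z' -> /forallP z'c]|[_ no]].
  - rewrite !evalE /= U3 nat_of_bool_eq0 negb_exists ?nat_of_bool_neq0.
    by apply: eq_forallb => y; rewrite code_Some.
  - by have [ci c00 _] := vc; rewrite (unmatched_unique ci c00 z'c zc).
  - by have := no z => /negP; case; apply/forallP.
have C4 : current s4 c by move=> x; rewrite array_run // array_run.
have V4 x : array s4 a_vis 0 (idx x) = accessible A B (links c) x.
  by rewrite array_run // array_run.
have N4' x : array s4 a_inN 0 (idx x) = inN A B x.
  by rewrite array_run // array_run // array_run // array_run.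
have C5 : current s5 c by move=> x; rewrite array_run.
have z5 : scalar s5 v_z = idx z by rewrite scalar_run.
have it5 : scalar s5 v_iter = size cs.
  by rewrite scalar_run // scalar_run // scalar_run // scalar_run // scalar_run.
have M5 l x : array s5 a_Mt l (idx x) = array s a_Mt l (idx x).
  by rewrite array_run // array_run // array_run // array_run // array_run.
have := @find_state k ns v_f v_i v_n
    (And (And (Lt (at0 a_cur (Var v_i)) (Var v_n))
              (Not (Eq (at0 a_sub (at0 a_cur (Var v_i))) (at0 a_sub (Var v_i)))))
         (And (at0 a_inN (Var v_i)) (Not (at0 a_vis (Var v_i))))) s4
    (waiting A B c) isT N4.
rewrite -/FindWaiting -/s5; case=> [x|[x fx wx]|[fn no]].
- rewrite !evalE /= C4 N4 code_ltn V4 N4' Sub4 ?nat_of_bool_neq0 ?nat_of_bool_eq0.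
  rewrite /waiting; congr (_ && _); case: (c x) => [y|] //=.
  by rewrite Sub4 -val_eqE.
- right; have -> : run (PIf (Lt (Var v_f) (Var v_n)) Redirect PSkip) s5 = run Redirect s5.
    by rewrite run_if !evalE fx N5 idx_lt.
  have /and3P[+ _ ax] := wx; case cx: (c x) => [y|] // yx.
  have ay := matched_far vc cx ax.
  rewrite /Redirect 3!run_seq.
  set t1 := run (PAssign _ _) s5; set t2 := run (PIf _ _ _) t1.
  set t3 := run (Fill _ _ _ _ _ _ _) t2.
  have y1 : scalar t1 v_y = idx y by rewrite /t1 /= fx C5 cx.
  have f1 : scalar t1 v_f = idx x by rewrite scalar_run.
  have z1 : scalar t1 v_z = idx z by rewrite scalar_run.
  have n1 : scalar t1 v_n = n by rewrite scalar_run.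
  have Sub1 u : array t1 a_sub 0 (idx u) = u.1 by apply: Sub5.
  have C1' : current t1 c by apply: C5.
  have V1 u : array t1 a_vis 0 (idx u) = accessible A B (links c) u.
    by rewrite -V4 -[RHS](@array_run FindWaiting).
  have it1 : scalar t1 v_iter = size cs by rewrite scalar_run.
  have M1 l u : array t1 a_Mt l (idx u) = array s a_Mt l (idx u) by apply: M5.
  clearbody t1.
  (* If [x] lies in the subsystem of [z], then [y] does not, so a node [a] from the subsystem of [y]
     satisfies [a.1 != z.1]. *)
  have [a [b [g2 ca az' fb ab]]] : exists a b,
    [/\ scalar t2 v_g = idx a, c a = Some b, a.1 != z.1,
        ~~ accessible A B (links c) b
      & if x.1 != z.1 then a = x /\ b = y else
        [/\ a.1 = y.1, b.1 != y.1 & c a = Some b]].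
    rewrite /t2 run_if !evalE f1 z1 !Sub1 val_eqE.
    case: (eqVneq x.1 z.1) => [xz|xz]; last by exists x, y; split=> //; exact: f1.
    have := @find_state k ns v_g v_i v_n
      (And (And (Eq (at0 a_sub (Var v_i)) (at0 a_sub (Var v_y)))
              (Lt (at0 a_cur (Var v_i)) (Var v_n)))
         (And (Not (Eq (at0 a_sub (at0 a_cur (Var v_i))) (at0 a_sub (Var v_y))))
              (Not (at0 a_vis (at0 a_cur (Var v_i)))))) t1
      (fun a => (a.1 == y.1) && (if c a is Some b then
         (b.1 != y.1) && ~~ accessible A B (links c) b else false)) isT n1.
    rewrite -/FindEntering; case=> [a|[a -> /andP[/eqP ay1]]|[_ no]].
    - rewrite !evalE /= y1 n1 C1' !Sub1 code_ltn val_eqE -andbA; congr (_ && _).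
      case: (c a) => [b|] //=.
      by rewrite Sub1 V1 val_eqE nat_of_bool_eq0.
    - case ca: (c a) => [b|] // /andP[by1 fb]; exists a, b; split=> //.
      by rewrite ay1 -xz.
    - have [a [b [ay1 ca by1 fb]]] := entering_edge vc cx yx ax.
      by have := no a; rewrite ay1 eqxx ca by1 fb.
  have C2' : current t2 c by move=> u; rewrite array_run.
  have z2 : scalar t2 v_z = idx z by rewrite scalar_run.
  have n2 : scalar t2 v_n = n by rewrite scalar_run.
  have it2 : scalar t2 v_iter = size cs by rewrite scalar_run.
  have M2 l u : array t2 a_Mt l (idx u) = array s a_Mt l (idx u) by rewrite array_run.
  clearbody t2.
  have it3 : scalar t3 v_iter = size cs by rewrite scalar_run.
  split; first by exists x.
  exists (redirect c a z); split; last exact: redirect_card vc ca zc az' fb.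
  split.
  - by rewrite run_assign /= it3 size_rcons addn1.
  - move=> l u; rewrite size_rcons run_assign array_set_scalar => lc.
    rewrite fillP // !evalE it2 addn1 n2 idx_lt andbT -rcons_cons nth_rcons /=.
    case: ltngtP lc => // [lc _|_ _].
      by rewrite M2 HM.
    rewrite g2 (inj_eq (@idx_inj k ns)) z2 /redirect.
    by case: eqP => // _; rewrite C2'.
  - rewrite map_rcons; apply: chain_rcons => //.
    rewrite last_map; exact: loop_stepP vc wx cx uz ab.
  - by rewrite last_rcons; apply: redirect_valid ca _ _.
- left; split=> //; rewrite run_if !evalE fn N5 ltnn /=; split=> // l u lc.
  by rewrite M5 HM.
Qed.

Lemma loop_run c0 s : base A B s -> feeds_in s ->
  (forall x, array s a_inN 0 (idx x) = inN A B x) -> valid A B c0 ->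
  (forall x, array s a_Mt 0 (idx x) = code (c0 x)) ->
  exists2 cs, trajectory c0 cs (run Loop s) &
    forall x, ~~ waiting A B (last c0 cs) x.
Proof.
move=> Hb Hf HN v0 H0; rewrite /Loop run_seq run_assign.
set s0 := set_scalar _ _ _.
have N0 : scalar s0 v_n = n by have [_ [H _ _] _ _] := Hb.
pose done cs := forall x, ~~ waiting A B (last c0 cs) x.
(* The unmatched accessible state provides the first accessible state, and every effective round
   adds one. For [j] = n_T the second alternative exceeds the number of states, so the loop is
   done. *)
pose Inv j s' := exists2 cs, trajectory c0 cs s' &
  done cs \/ j < #|[set x | accessible A B (links (last c0 cs)) x]|.
suff [cs T [D|]] : Inv (scalar s0 v_n) (run (PFor v_x v_n Round) s0).
- by exists cs.
- by rewrite N0 -(card_st k ns) ltnNge max_card.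
apply: for_invariant => //.
  exists [::]; first by split=> // l x; rewrite leqn0 => /eqP ->; apply: H0.
  right; have [z [_ _ az]] := unmatched_accessibleP v0.
  by apply/card_gt0P; exists z; rewrite inE.
move=> j s' jn Hx Ha [cs [T1 T2 T3 T4] D].
have Hb' : base A B s'.
  have [[Hk Hns HA HB] [H1 H2 H3] Hsub Hpos] : base A B s0.
    exact: (base_run (p := PAssign v_iter (Const 0)) isT isT Hb).
  by split; [split|split| |] => *; rewrite ?Ha.1 ?Ha.2.
have Hf' : feeds_in s' by move=> v x; rewrite Ha.2 //; apply: Hf.
have HN' x : array s' a_inN 0 (idx x) = inN A B x.
  by rewrite Ha.2 //; apply: HN.
case: (round_run Hb' Hf' HN' (And4 T1 T2 T3 T4)) => [[Dn [R1 R2 R3 R4]]|].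
  by exists cs; [|left].
move=> [[x wx] [c' [[R1 R2 R3 R4] lt]]]; exists (rcons cs c'); first by split.
rewrite last_rcons; case: D => [Dn|/leq_ltn_trans/(_ lt)]; last by right.
by have := Dn x; rewrite wx.
Qed.

End LoopStage.

(** * The last interconnections and the output of the adjacency matrix *)

Definition Select e :=
  PFor v_x v_n
    (PIf e
       (PSeq (PPut a_Q (Var v_q) (Const 0) (Var v_x))
       (PSeq (PPut a_Q (Var v_q) (Const 1) (at0 a_link (Var v_x)))
             (PAssign v_q (Add (Var v_q) (Const 1)))))
       PSkip).

(* [v_y] becomes a state driven by the input and [v_z] a state of another
   subsystem; if there is none, all states are accessible and [v_z] is not used. *)
Definition Sources :=
  PSeq (Find v_y v_i v_n (Get a_B (Var v_i) (Const 0)))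
  (PSeq (Find v_z v_i v_n
           (Not (Eq (at0 a_sub (Var v_i)) (at0 a_sub (Var v_y)))))
  (PSeq (Fill a_link (Const 0) v_j v_n
           (Eq (at0 a_sub (Var v_j)) (at0 a_sub (Var v_y))) (Var v_z) (Var v_y))
        (Fill a_used (Const 0) v_j v_n (Const 1)
           (And (at0 a_rep (Var v_j)) (Not (at0 a_vis (Var v_j)))) (Const 0)))).

Definition Connectors :=
  PSeq (PAssign v_q (Const 0))
  (PSeq (Select (And (at0 a_used (Var v_x))
                     (Not (Eq (at0 a_sub (Var v_x)) (at0 a_sub (Var v_y))))))
        (Select (And (at0 a_used (Var v_x))
                     (Eq (at0 a_sub (Var v_x)) (at0 a_sub (Var v_y)))))).

Definition Interconnect :=
  PSeq Fetch
  (PSeq Access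
  (PSeq Sources
  (PSeq Connectors
        (Fill2 a_IA (Const 0) v_i v_n v_j v_n
           (Or (And (Eq (at0 a_cur (Var v_j)) (Var v_i))
                    (Not (Eq (at0 a_sub (Var v_i)) (at0 a_sub (Var v_j)))))
               (And (at0 a_used (Var v_j)) (Eq (at0 a_link (Var v_j)) (Var v_i)))))))).

Section FinalStage.
Variables (R : realType) (k ns : nat) (A : 'M[bool]_ns) (B : 'cV[bool]_(k * ns)).
Hypotheses (k_gt0 : 0 < k) (ns_gt0 : 0 < ns).
Hypothesis sc : structurally_controllable R (full_composite k A) B.

Local Notation st := (state k ns).
Local Notation ost := (option st).
Local Notation n := (k * ns).
Implicit Types (x y z u a b : st) (v w : option st) (s : memory) (c : st -> option st).

(** The states in the order of their rows, in which [Select] visits them. *)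
Definition states : seq st := [seq mxtens_unindex i | i <- enum 'I_n].

Lemma nth_states x0 x : nth x0 states (idx x) = x.
Proof.
rewrite (nth_map (mxtens_index x)) ?size_enum_ord ?idx_lt //.
by rewrite nth_ord_enum mxtens_indexK.
Qed.

Lemma states_uniq : uniq states.
Proof. by rewrite map_inj_uniq ?enum_uniq //; apply: can_inj (@mxtens_unindexK k ns). Qed.

Lemma mem_states x : x \in states.
Proof. by apply/mapP; exists (mxtens_index x); rewrite ?mem_enum ?mxtens_indexK. Qed.

Lemma size_states : size states = n.
Proof. by rewrite size_map size_enum_ord. Qed.

Definition queue_in s (Q : seq (st * st)) : Prop :=
  scalar s v_q = size Q /\
  forall e0 i, i < size Q -> array s a_Q i 0 = idx (nth e0 Q i).1 /\
                             array s a_Q i 1 = idx (nth e0 Q i).2.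

Lemma select_run e (P : pred st) (l : st -> st) s Q :
  scalar s v_n = n ->
  (forall x s', agree [:: v_x; v_q] [:: a_Q] s s' -> scalar s' v_x = idx x ->
     (eval s' e != 0) = P x) ->
  (forall x, P x -> array s a_link 0 (idx x) = idx (l x)) ->
  queue_in s Q -> queue_in (run (Select e) s) (Q ++ [seq (y, l y) | y <- states & P y]).
Proof.
move=> Hn He Hl HQ.
pose Inv j s' := queue_in s' (Q ++ [seq (y, l y) | y <- take j states & P y]).
suff : Inv (scalar s v_n) (run (Select e) s).
  by rewrite /Inv Hn -size_states take_size.
apply: for_invariant => //; first by rewrite /Inv take0 cats0.
move=> j s' jn Hx Ha HI; rewrite Hn in jn.
have {}Ha : agree [:: v_x; v_q] [:: a_Q] s s'.
  by apply: agree_sub Ha => u //=; rewrite !inE ?orbF // !orbb.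
have [x xj] := idx_surj jn; move: Hx HI jn; rewrite -{}xj => Hx HI jn {j}.
rewrite /Inv (take_nth x) ?size_states // nth_states filter_rcons run_if (He x) //.
case: ifP => [Px|_]; last exact: HI.
rewrite map_rcons -rcons_cat; case: HI; set L := Q ++ _ => q0 H.
have lx : array s' a_link 0 (idx x) = idx (l x) by rewrite Ha.2 // Hl.
split; first by rewrite /= size_rcons q0 addn1.
move=> e0 i; rewrite size_rcons ltnS => iq /=; rewrite q0 Hx lx nth_rcons.
by case: (ltngtP i (size L)) iq => // iq _; apply: H.
Qed.

Lemma sources_run c s : base A B s ->
  (forall x, array s a_rep 0 (idx x) = isrep A B x) ->
  (forall x, array s a_vis 0 (idx x) = accessible A B (links c) x) ->
  let s' := run Sources s in
  exists x0 o, [/\ eU B x0,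
    forall y, ~~ accessible A B set0 y -> o.1 != x0.1,
    array s' a_sub 0 (scalar s' v_y) = x0.1,
    forall y, pending A B c y -> array s' a_link 0 (idx y) = idx (link x0 o y)
    & forall y, array s' a_used 0 (idx y) = pending A B c y].
Proof.
move=> Hb Hr Hv; rewrite /Sources 3!run_seq.
set s1 := run (Find _ _ _ _) s; set s2 := run (Find _ _ _ _) s1.
set s3 := run (Fill a_link _ _ _ _ _ _) s2.
set s' := run (Fill a_used _ _ _ _ _ _) s3.
have B1 : base A B s1 by apply: base_run.
have B2 : base A B s2 by apply: base_run.
have B3 : base A B s3 by apply: base_run.
have B4 : base A B s' by apply: base_run.
have [[_ _ _ HB] [N0 _ _] _ _] := Hb; have [_ [N1 _ _] Sub1 _] := B1.
have [_ [N2 _ _] Sub2 _] := B2; have [_ [N3 _ _] _ _] := B3; have [_ _ Sub4 _] := B4.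
have [x0 y1 Bx0] : exists2 x0, scalar s1 v_y = idx x0 & eU B x0.
  have := @find_state k ns v_y v_i v_n (Get a_B (Var v_i) (Const 0)) s (eU B) isT N0.
  rewrite -/s1; case=> [x|[x ? ?]|[_ no]]; last by have [x Bx] := input_exists k_gt0 ns_gt0 sc; have := no x; rewrite Bx.
    by rewrite !evalE /= HB nat_of_bool_neq0.
  by exists x.
have y2 : scalar s2 v_y = idx x0 by rewrite scalar_run.
have y4 : scalar s' v_y = idx x0 by rewrite scalar_run // scalar_run.
have [o [oP oz]] : exists o : st, (forall y, ~~ accessible A B set0 y -> o.1 != x0.1) /\
    (o.1 != x0.1 -> scalar s2 v_z = idx o).
  have := @find_state k ns v_z v_i v_n
    (Not (Eq (at0 a_sub (Var v_i)) (at0 a_sub (Var v_y)))) s1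
    (fun y => y.1 != x0.1) isT N1.
  rewrite -/s2; case=> [x|[x ? ?]|[_ no]].
  - by rewrite !evalE /= y1 !Sub1 val_eqE.
  - by exists x.
  (* Here there is no other subsystem: [k] is 1, every state is accessible, and [x0] is a mere
     default for [o]. *)
  - exists x0; split=> [y|]; last by rewrite eqxx.
    rewrite (single_accessible sc) //; apply/eqP; rewrite eqn_leq k_gt0 andbT.
    have p0 : 'I_ns := Ordinal ns_gt0.
    rewrite -[k in k <= 1]card_ord; apply/card_le1_eqP => i j _ _.
    have := no (i, p0); have := no (j, p0); rewrite /= !negbK.
    by move=> /eqP -> /eqP ->.
exists x0, o; split=> //.
- by rewrite y4 Sub4.
- move=> y py; rewrite array_run // fillP // !evalE /= N2 idx_lt y2 !Sub2 val_eqE.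
  rewrite /link; case: eqP => // _.
  by apply: oz; apply: (pending_other oP py).
- move=> y; rewrite fillP // !evalE /= N3 idx_lt.
  by rewrite !array_run // Hr Hv ?nat_of_bool_neq0 nat_of_bool_eq0.
Qed.

Lemma interconnect_run c s : base A B s -> feeds_in A B s ->
  (forall x, array s a_rep 0 (idx x) = isrep A B x) -> valid A B c ->
  (forall x, array s a_Mt (scalar s v_iter) (idx x) = code (c x)) ->
  exists x0 o, let Q := connectors A B c x0 o states in
    [/\ connect_unreached A B (edges c) Q, queue_in (run Interconnect s) Q
      & forall x y, array (run Interconnect s) a_IA (idx x) (idx y) =
          ((x, y) \in links c :|: [set a | (a.2, a.1) \in Q])].
Proof.
move=> Hb Hf Hr vc Hc; rewrite /Interconnect 4!run_seq.
set s1 := run Fetch s; set s2 := run Access s1; set s3 := run Sources s2.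
set s4 := run Connectors s3.
have B1 : base A B s1 by apply: base_run.
have B2 : base A B s2 by apply: base_run.
have B3 : base A B s3 by apply: base_run.
have B4 : base A B s4 by apply: base_run.
have [_ Hs _ _] := Hb; have [_ S1 _ _] := B1.
have C1 : current s1 c by apply: fetch_run.
have F1 : feeds_in A B s1 by move=> v x; rewrite array_run.
have V2 := access_run S1 F1 vc C1; rewrite -/s2 in V2.
have R2 x : array s2 a_rep 0 (idx x) = isrep A B x by rewrite array_run // array_run.
have [x0 [o [Bx0 oP sub3 link3 used3]]] := sources_run B2 R2 V2.
rewrite -/s3 in sub3 link3 used3.
exists x0, o; have [_ [N3 _ _] Sub3 _] := B3; have [_ [N4 _ _] Sub4 _] := B4.
have C4 x : array s4 a_cur 0 (idx x) = code (c x).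
  by rewrite array_run // array_run // array_run.
have link4 y : pending A B c y -> array s4 a_link 0 (idx y) = idx (link x0 o y).
  by move=> py; rewrite array_run // link3.
have used4 y : array s4 a_used 0 (idx y) = pending A B c y by rewrite array_run.
split.
- exact: connectors_connect Bx0 states_uniq mem_states oP.
- suff [q4 H] : queue_in s4 (connectors A B c x0 o states).
    split=> [|e0 i iq]; first by rewrite scalar_run.
    by have [H1 H2] := H e0 i iq; split; rewrite array_run.
  rewrite /s4 /Connectors 2!run_seq /connectors; set t := run (PAssign _ _) s3.
  have used_t y : array t a_used 0 (idx y) = pending A B c y by exact: used3.
  have link_t y : pending A B c y -> array t a_link 0 (idx y) = idx (link x0 o y).
    exact: link3.
  have N_t : scalar t v_n = n by exact: N3.
  have sub_t : array t a_sub 0 (scalar t v_y) = x0.1 by exact: sub3.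
  have Sub_t x : array t a_sub 0 (idx x) = x.1 by exact: Sub3.
  have Q_t : queue_in t [::] by [].
  clearbody t; rewrite -[X in X ++ _]cat0s.
  set e2 := And _ _; set e1 := And _ _.
  have Q1 : queue_in (run (Select e1) t)
      ([::] ++ [seq (y, link x0 o y) | y <- states & pending A B c y && (y.1 != x0.1)]).
    apply: select_run => // [x s0 Ha Hx|x /andP[/link_t]//].
    rewrite /e1 !evalE Hx !Ha.2 // Ha.1 // used_t Sub_t sub_t.
    by rewrite val_eqE ?nat_of_bool_neq0.
  apply: select_run Q1 => [|x s0 Ha Hx|x /andP[/link_t]].
  + by rewrite scalar_run.
  + rewrite /e2 !evalE Hx !Ha.2 // Ha.1 // !array_run // scalar_run //.
    by rewrite used_t Sub_t sub_t val_eqE ?nat_of_bool_neq0.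
  + by move=> <-; rewrite array_run.
- move=> x y; rewrite mem_IA; last exact: mem_states.
  clearbody s4; rewrite fill2P // !evalE /= N4 !idx_lt !subn0 C4 !Sub4 used4 code_Some val_eqE.
  rewrite ?nat_of_bool_neq0; case py: (pending A B c y) => //=.
  by rewrite link4 // (inj_eq (@idx_inj k ns)) [x == _]eq_sym.
Qed.

End FinalStage.

(** * The whole program and its running time *)

Definition Init := PSeq Size Coordinates.

(** Separated from [Init] because [exec_compile] wants unmodified loop bounds: those of [Main] are
    computed by [Init]. *)
Definition Main :=
  PSeq Adjacency
  (PSeq Closure
  (PSeq Components
  (PSeq Greedy
  (PSeq AssignFree
  (PSeq Output
  (PSeq Loop Interconnect)))))).

Lemma base_init k ns (A : 'M[bool]_ns) (B : 'cV[bool]_(k * ns)) s :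
  holds_input A B s -> base A B (run Init s).
Proof.
move=> [Hk Hns HA HB]; rewrite /Init run_seq.
have [S1 [K1 NS1]] := size_run Hk Hns; set s1 := run Size s in S1 K1 NS1 *.
have [Hsub Hpos] := coordinates_run K1 NS1; split=> //; last exact: sizes_run.
by split=> *; rewrite ?scalar_run ?array_run.
Qed.

Lemma holds_edges k ns s a l (c : state k ns -> option (state k ns)) :
  (forall x, array s a l (idx x) = code (c x)) -> holds_matching s a l (edges c).
Proof.
move=> H [x r]; rewrite inE => /eqP ->.
rewrite -[nat_of_ord (mxtens_index _)]/(idx x) H.
by rewrite /=; case: (c x).
Qed.

Lemma main_run (R : realType) k ns (A : 'M[bool]_ns) (B : 'cV[bool]_(k * ns)) s :
  0 < k -> 0 < ns -> structurally_controllable R (full_composite k A) B ->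
  base A B s ->
  exists (Mstar Mpp Mt : {set state k ns * rnode k ns})
    (Mts : seq {set state k ns * rnode k ns}) (Q : seq (state k ns * state k ns))
    (IA : {set state k ns * state k ns}),
    algorithm_run A B Mstar Mpp Mt Mts Q IA /\
    holds_run (run Main s) Mstar Mt Mts Q IA.
Proof.
move=> k0 ns0 sc B0; rewrite /Main 7!run_seq.
set s1 := run Adjacency s; set s2 := run Closure s1; set s3 := run Components s2.
set s4 := run Greedy s3; set s5 := run AssignFree s4; set s6 := run Output s5.
set s7 := run Loop s6; set s8 := run Interconnect s7.
have B1 : base A B s1 by apply: base_run.
have B2 : base A B s2 by apply: base_run.
have B3 : base A B s3 by apply: base_run.
have B4 : base A B s4 by apply: base_run.
have B5 : base A B s5 by apply: base_run.
have B6 : base A B s6 by apply: base_run.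
have B7 : base A B s7 by apply: base_run.
have [_ S3 _ _] := B3; have [_ S5 _ _] := B5.
have [F1 none1] := adjacency_run B0; rewrite -/s1 in F1 none1.
have R2 := closure_run B1 F1; rewrite -/s2 in R2.
have [N3 rep3 adjN3 adj3] := components_run B2 R2; rewrite -/s3 in N3 rep3 adjN3 adj3.
have F3 : feeds_in A B s3.
  move=> v x; rewrite adj3; last by left; rewrite ltnS code_leq.
  by rewrite array_run // F1.
have A3 : adjacency_in A B s3.
  move=> [[v|y]|] x /=.
  - by rewrite F3.
  - by rewrite adjN3.
  - by rewrite adj3; [rewrite array_run // none1|right].
have [m M4 Gm] := greedy_run S3 A3; rewrite -/s4 in M4.
have [f [asg5 f_next f_unused f_inj]] := assign_run k0 ns0 sc Gm B4 M4.
rewrite -/s5 in asg5.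
have M5 : holds_mate s5 m by move=> x; rewrite array_run.
have [star6 tilde6] := output_run A k0 ns0 S5 M5 asg5; rewrite -/s6 in star6 tilde6.
set c0 := tilde_of m f in tilde6.
have v0 : valid A B c0.
  split; first by move=> x y; apply: (tilde_inj Gm f_unused f_inj).
    exact: (tilde_input k0 ns0 sc Gm f).
  exact: (tilde_allowed Gm f_next).
have F6 : feeds_in A B s6.
  by move=> v x; rewrite array_run // array_run // array_run // F3.
have N6 x : array s6 a_inN 0 (idx x) = inN A B x.
  by rewrite array_run // array_run // array_run // N3.
have rep6 x : array s6 a_rep 0 (idx x) = isrep A B x.
  by rewrite array_run // array_run // array_run // rep3.
have [cs [it7 M7 ch7 v7] D7] := loop_run B6 F6 N6 v0 tilde6.
rewrite -/s7 in it7 M7; set c := last c0 cs in v7 D7.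
have F7 : feeds_in A B s7 by move=> v x; rewrite array_run // F6.
have rep7 x : array s7 a_rep 0 (idx x) = isrep A B x by rewrite array_run // rep6.
have last7 x : array s7 a_Mt (scalar s7 v_iter) (idx x) = code (c x).
  by rewrite it7 M7 // /c (last_nth c0).
have [x0 [o [conn [q8 Q8] IA8]]] := interconnect_run k0 ns0 sc B7 F7 rep7 v7 last7.
rewrite -/s8 in q8 Q8 IA8.
exists (gset (star_of A m f)), (second m f), (edges c0), [seq edges c | c <- cs].
exists (connectors A B c x0 o (states k ns)).
eexists; split; last first.
  split; last exact: IA8.
  - move=> e eM; rewrite array_run // array_run //; exact: star6.
  - split; first by rewrite size_map scalar_run.
    move=> l; rewrite size_map => lc; rewrite -map_cons (nth_map c0) //.
    by apply: holds_edges => x; rewrite array_run // M7.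
  - split; first by rewrite q8.
    move=> Q1 e Q2 E; have lt : size Q1 < size (connectors A B c x0 o (states k ns)).
      by rewrite E size_cat /= addnS ltnS leq_addr.
    by have := Q8 e _ lt; rewrite E nth_cat ltnn subnn.
split; first exact: (star_min_cost k0 ns0 Gm f_next f_unused f_inj).
split; first exact: (second_perfect Gm f_next f_unused f_inj).
split; first exact: (tilde_split Gm f_next).
split; first by have [z [uz _ _]] := unmatched_accessibleP v0; exists z.
split.
  apply: chain_while => //; rewrite last_map VN'E.
  by apply/setP => x; rewrite !inE; apply/negbTE.
by split; rewrite last_map.
Qed.

Theorem mainTheorem2 (R : realType) :
  exists (P : cmd) (C : nat),
    forall (k ns : nat) (A : 'M[bool]_ns) (B : 'cV[bool]_(k * ns)) (s : memory),
      0 < k -> 0 < ns ->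
      structurally_controllable R (full_composite k A) B ->
      holds_input A B s ->
      exists (s' : memory) (t : nat)
        (Mstar Mpp Mt : {set state k ns * rnode k ns})
        (Mts : seq {set state k ns * rnode k ns})
        (Q : seq (state k ns * state k ns))
        (IA : {set state k ns * state k ns}),
        [/\ exec P s s' t,
            t <= C * (k * ns) ^ 3,
            algorithm_run A B Mstar Mpp Mt Mts Q IA
          & holds_run s' Mstar Mt Mts Q IA].
Proof.
(* 64 is 4 ^ 3: the largest bound 2 n_T + 1 of [Main] gives the base 2 n_T + 2, which is at most 4
   n_T as n_T > 0. [Init] has depth 2 and bounds at most n_T, and is absorbed. *)
exists (Seq (compile Init) (compile Main)), ((weight Init + weight Main) * 64).
move=> k ns A B s k0 ns0 sc Hin; have [Hk Hns _ _] := Hin.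
have B0 := base_init Hin; have [_ [Hn Hn1 Hn2] _ _] := B0.
have n0 : 0 < k * ns by rewrite muln_gt0 k0.
have [||||t1 E1 T1] := @exec_compile (k * ns) [:: v_k; v_ns] Init s.
- by [].
- by [].
- by [].
- move=> b; rewrite !inE => /orP[/eqP ->|/eqP ->].
    by rewrite [scalar _ _]Hk leq_pmulr.
  by rewrite [scalar _ _]Hns leq_pmull.
have [||||t2 E2 T2] := @exec_compile (k * ns).*2.+1 [:: v_n; v_n1; v_n2] Main (run Init s).
- by [].
- by [].
- by [].
- move=> b; rewrite !inE => /or3P[/eqP ->|/eqP ->|/eqP ->].
  + by rewrite Hn -addnn leqW // leq_addr.
  + by rewrite Hn1 ltnS -addnn leq_addr.
  + by rewrite Hn2.
have [Mstar [Mpp [Mt [Mts [Q [IA [HA HR]]]]]]] := main_run k0 ns0 sc B0.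
exists (run Main (run Init s)), (t1 + t2), Mstar, Mpp, Mt, Mts, Q, IA.
split=> //; first exact: exec_seq E1 E2.
have depthI : depth Init = 2 by []; have depthM : depth Main = 3 by [].
rewrite depthI in T1; rewrite depthM in T2.
have X : (k * ns).*2.+2 ^ 3 <= 64 * (k * ns) ^ 3.
  have -> : 64 = 4 ^ 3 by [].
  by rewrite -expnMn leq_exp2r //; lia.
have Y : (k * ns).+1 ^ 2 <= (k * ns).*2.+2 ^ 3.
  apply: leq_trans (leq_pexp2l _ (_ : 2 <= 3)) => //.
  by rewrite leq_exp2r // -addnn ltnS leqW // leq_addr.
rewrite mulnDl mulnDl leq_add //.
  apply: leq_trans T1 _; rewrite -mulnA leq_mul2l; apply/orP; right.
  exact: leq_trans Y X.
by apply: leq_trans T2 _; rewrite -mulnA leq_mul2l X orbT.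
Qed.
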